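(* Let $a_{ij}$ ($i+j=3$ or $i+j=5$) be real numbers and consider the planar system $$\dot x = y+a_{30}x^3+a_{21}x^2y+a_{12}xy^2+a_{03}y^3+a_{50}x^5+a_{41}x^4y+a_{32}x^3y^2+a_{23}x^2y^3+a_{14}xy^4+a_{05}y^5,\qquad \dot y=-2x^3 .$$ The origin of this system is an analytic center if and only if $$a_{30}=a_{12}=a_{32}=a_{14}=a_{50}=0 .$$
   Context: The origin of a planar real analytic system is called an analytic center if it is a center and the system has a (nonconstant) analytic first integral in a neighborhood of the origin. *)

(* Defs.v *)
From HB Require Import structures.
From mathcomp Require Import all_boot all_order all_algebra.
From mathcomp Require Import all_classical all_reals all_analysis.
Set Implicit Arguments.
Unset Strict Implicit.
Unset Printing Implicit Defensive.
Import Order.TTheory GRing.Theory Num.Theory numFieldNormedType.Exports.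
Local Open Scope classical_set_scope.
Local Open Scope ring_scope.

Definition double_term (R : realType) (c : nat -> nat -> R) (x y : R)
    (k : nat * nat) : R :=
  c k.1 k.2 * x ^+ k.1 * y ^+ k.2.

(* Near p, H is the sum of an absolutely convergent double power series; thanks
   to absolute convergence its sum is the limit of the square partial sums. *)
Definition analytic_at (R : realType) (H : R * R -> R) (p : R * R) : Prop :=
  exists (c : nat -> nat -> R) (r : R), 0 < r /\
    forall x y : R, `|x| < r -> `|y| < r ->
      summable [set: nat * nat] (fun k => (double_term c x y k)%:E) /\
      (fun n : nat => \sum_(i < n) \sum_(j < n)
         double_term c x y (nat_of_ord i, nat_of_ord j)) @ \oo
        --> H (p.1 + x, p.2 + y).

(* I is meant to be open, so that the derivative is two-sided. *)
Definition solution_on (R : realType) (X : R * R -> R * R) (I : set R)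
    (g : R -> R * R) : Prop :=
  forall t : R, I t -> is_derive t 1 g (X (g t)).

Definition first_integral_on (R : realType) (X : R * R -> R * R)
    (U : set (R * R)) (H : R * R -> R) : Prop :=
  forall (a b : R) (g : R -> R * R),
    solution_on X `]a, b[ g ->
    (forall t, t \in `]a, b[ -> U (g t)) ->
    forall s t, s \in `]a, b[ -> t \in `]a, b[ -> H (g s) = H (g t).

(* Nonconstancy is required of the germ of H at p: on a disconnected U, H could
   otherwise be constant around p and vary only on another component of U. *)
Definition has_analytic_first_integral (R : realType) (X : R * R -> R * R)
    (p : R * R) : Prop :=
  exists (U : set (R * R)) (H : R * R -> R),
    [/\ open U, U p,
        forall q, U q -> analytic_at H q,
        first_integral_on X U H
      & ~ (\forall q \near p, H q = H p)].

Definition periodic_orbit (R : realType) (X : R * R -> R * R)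
    (O : set (R * R)) : Prop :=
  exists (g : R -> R * R) (T : R),
    [/\ solution_on X setT g,
        0 < T,
        forall t, g (t + T) = g t,
        exists t, g t <> g 0
      & O = range g].

(* p lies off O, in the inside of O. The first conjunct is needed because
   connected_component A p is empty when p is not in A. *)
Definition surrounds (R : realType) (O : set (R * R)) (p : R * R) : Prop :=
  ~ O p /\ bounded_set (connected_component (~` O) p).

Definition is_center (R : realType) (X : R * R -> R * R) (p : R * R) : Prop :=
  X p = (0, 0) /\
  exists U : set (R * R), nbhs p U /\
    forall q, U q -> q <> p ->
      exists O : set (R * R),
        [/\ periodic_orbit X O, O q, O `<=` U & surrounds O p].

Definition is_analytic_center (R : realType) (X : R * R -> R * R)
    (p : R * R) : Prop :=
  is_center X p /\ has_analytic_first_integral X p.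

Definition cubic_quintic_field (R : realType)
    (a30 a21 a12 a03 a50 a41 a32 a23 a14 a05 : R) (p : R * R) : R * R :=
  let x := p.1 in let y := p.2 in
  (y + a30 * x ^+ 3 + a21 * x ^+ 2 * y + a12 * x * y ^+ 2 + a03 * y ^+ 3
     + a50 * x ^+ 5 + a41 * x ^+ 4 * y + a32 * x ^+ 3 * y ^+ 2
     + a23 * x ^+ 2 * y ^+ 3 + a14 * x * y ^+ 4 + a05 * y ^+ 5,
   - 2 * x ^+ 3).

(* Main.v *)
(* Suppose first that the five coefficients vanish. The system is then reversible
   in both axes, with x' = y F(x^2, y^2). The power series h given by h(0, v) = v
   and F h_u = 2 u h_v has coefficients of at most geometric growth, so that
   H(x, y) = h(x^2, y^2) is an analytic first integral, lying between
   y^2 + x^4 / 2 and y^2 + 3 x^4 / 2. Small orbits are thus confined by H; each of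
   them crosses both axes, the two reflections compose to a translation in time,
   and the orbit closes and fills its level curve.

   For the converse, let q = 1 + a03 y^2 + a05 y^4. As long as the obstructions
   vanish there is h = y^2 + x^4 + ..., polynomial in x and y, with
   h' = x^n (c + o(1)) along orbits, and a center forces the next obstruction c
   to vanish, for otherwise h would be strictly monotone on small periodic orbits.
   The coefficients of x^i in h are taken divisible by a high power of q, so that
   dividing by y q, as the recursion demands, keeps them polynomial. The
   obstructions are polynomials in the a_ij; the first four determine a30, a12,
   a32 and a14, the next two determine a23 and a05 if a50 is not 0, and then a
   power of a50 is a combination of the next four. *)
Require Import Defs.
From Stdlib Require Import ZArith.
From Stdlib Require Ring_polynom InitialRing Ring_theory BinList.
From mathcomp Require Import all_boot all_order all_algebra.
From mathcomp Require Import all_classical all_reals all_analysis.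
From mathcomp Require Import zify ring lra.
Set Implicit Arguments.
Unset Strict Implicit.
Unset Printing Implicit Defensive.
Import Order.TTheory GRing.Theory Num.Theory numFieldNormedType.Exports.
Local Open Scope classical_set_scope.
Local Open Scope ring_scope.

(** * Computing the obstructions *)

(** In the converse, [h] is truncated in [x] only and is exact in [y]. Its derivative along orbits
    must be [x^N] times a function that does not vanish at the origin: an error merely of higher
    order there would not be dominated by [x^N] near the [y]-axis, and the sign would be lost. This
    is why the coefficients of the [x^i] are whole polynomials in [y]. Each new one costs a factor
    [q]; the last obstruction used sits at [x^24], so [x^4] starts with [q^21] and [x^i] keeps
    [q^(25 - i)]. With [x] of weight 1 and [y] of weight 2 the leading field [(y, -2 x^3)] is
    quasi-homogeneous. An obstruction is a value at [y = 0], hence involves only Taylor coefficients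
    of bounded weight, and only these are computed. In the direct part the obstacle is that the
    field is not globally Lipschitz. It is cut off outside a square that small orbits never leave,
    which gives flows on the whole line, and the reflections act on these. *)

(* The elimination is carried out by vm_compute on the sparse normal forms of the
   ring tactic, with integer coefficients. *)
Definition zpol := Ring_polynom.Pol Z.
Definition padd : zpol -> zpol -> zpol := Ring_polynom.Padd Z0 Z.add Z.eqb.
Definition pmul : zpol -> zpol -> zpol :=
  Ring_polynom.Pmul Z0 (Zpos xH) Z.add Z.mul Z.eqb.
Definition pcst (z : Z) : zpol := Ring_polynom.Pc z.
Definition pvar (i : positive) : zpol := Ring_polynom.mk_X Z0 (Zpos xH) i.
Arguments padd : simpl never.
Arguments pmul : simpl never.
Arguments pcst : simpl never.
Arguments pvar : simpl never.
Declare Scope zpol_scope.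
Delimit Scope zpol_scope with P.
Bind Scope zpol_scope with zpol.
Local Delimit Scope Z_scope with coqZ.
Arguments pcst z%_coqZ.
Notation "p + q" := (padd p q) : zpol_scope.
Notation "p * q" := (pmul p q) : zpol_scope.
Notation "''x_' i" := (pvar i) (at level 8, i at level 2, format "''x_' i") : zpol_scope.
Definition ppow (p : zpol) (n : nat) : zpol := iter n (pmul p) (pcst 1).
Notation "p ^ n" := (ppow p n) : zpol_scope.
Arguments ppow : simpl never.

(** * Integer polynomials evaluated in a field *)

Section Evaluation.
Context {R : realFieldType}.
Implicit Types (l : seq R) (p q : zpol).

Definition zval : Z -> R := InitialRing.gen_phiZ 0 1 +%R *%R -%R.

Definition peval (l : seq R) (p : zpol) : R :=
  Ring_polynom.Pphi 0 +%R *%R zval l p.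

Let Rth : Ring_theory.ring_theory (0 : R) 1 +%R *%R (fun x y => x - y) -%R eq.
Proof.
split=> //.
- exact: add0r. - exact: addrC. - exact: addrA. - exact: mul1r. - exact: mulrC.
- exact: mulrA. - exact: mulrDl. - exact: subrr.
Qed.

Let Rext : Ring_theory.ring_eq_ext (+%R : R -> R -> R) *%R -%R eq.
Proof. by split=> [? ? -> ? ? ->|? ? -> ? ? ->|? ? ->]. Qed.

Let Rst : RelationClasses.Equivalence (@eq R).
Proof. exact: RelationClasses.eq_equivalence. Qed.

Let Rath := Ring_theory.Rth_ARth Rst Rext Rth.
Let morphZ := InitialRing.gen_phiZ_morph Rst Rext Rth.

Lemma pevalD l p q : peval l (p + q)%P = peval l p + peval l q.
Proof. exact: (Ring_polynom.Padd_ok Rst Rext Rath morphZ). Qed.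

Lemma pevalM l p q : peval l (p * q)%P = peval l p * peval l q.
Proof. exact: (Ring_polynom.Pmul_ok Rst Rext Rath morphZ). Qed.

Lemma pevalC l z : peval l (pcst z) = zval z. Proof. by []. Qed.

Lemma pevalX l i : peval l (pvar i) = BinList.nth 0 i l.
Proof. by rewrite (Ring_polynom.mkX_ok Rst Rext Rath morphZ). Qed.

Lemma pevalXn l p n : peval l (p ^ n)%P = peval l p ^+ n.
Proof. by elim: n => [|n IHn]; rewrite ?expr0 // exprS pevalM IHn. Qed.

Lemma pevalE l p q : Ring_polynom.Peq Z.eqb p q -> peval l p = peval l q.
Proof. by move/(Ring_polynom.Peq_ok Rst Rext morphZ); apply. Qed.

Lemma zval_nat n : zval (Z.of_nat n) = n%:R.
Proof.
elim: n => [|n IHn]; first exact: (Ring_theory.morph0 morphZ).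
rewrite Nat2Z.inj_succ -Z.add_1_r /zval (Ring_theory.morph_add morphZ) -/zval IHn.
by rewrite [zval _](Ring_theory.morph1 morphZ) natr1.
Qed.

Lemma zval_pos_neq0 d : zval (Zpos d) != 0.
Proof.
rewrite -positive_nat_Z zval_nat pnatr_eq0 -lt0n.
by apply/ssrnat.ltP; exact: Pos2Nat.is_pos.
Qed.

End Evaluation.
Arguments peval : simpl never.

(** This is multiplication by [y^s] on coefficient sequences. *)
Fixpoint shift_seq (R : nmodType) (s : nat) (k : nat -> R) (t : nat) : R :=
  match s, t with
  | 0, _ => k t
  | s'.+1, t'.+1 => shift_seq s' k t'
  | _, 0 => 0
  end.

Lemma shift_seqE (R : nmodType) s (k : nat -> R) t :
  shift_seq s k t = if (t < s)%N then 0 else k (t - s)%N.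
Proof.
by elim: s t => [|s IHs] [|t] //=; rewrite IHs ltnS subSS.
Qed.

Arguments shift_seq : simpl never.

(* The coefficient of x^(n+4) y^t in P h_x - 2 x^3 h_y, where h is the sum of
   the K i j x^i y^j and P is the first component of the vector field. *)
Definition first_integral_coef (R : pzRingType)
    (a30 a21 a12 a03 a50 a41 a32 a23 a14 a05 : R) (K : nat -> nat -> R) n t :=
  n.+4.+1%:R * (shift_seq 1 (K n.+4.+1) t + a03 * shift_seq 3 (K n.+4.+1) t
                + a05 * shift_seq 5 (K n.+4.+1) t)
  + n.+4%:R * (a12 * shift_seq 2 (K n.+4) t + a14 * shift_seq 4 (K n.+4) t)
  + n.+3%:R * (a21 * shift_seq 1 (K n.+3) t + a23 * shift_seq 3 (K n.+3) t)
  + n.+2%:R * (a30 * K n.+2 t + a32 * shift_seq 2 (K n.+2) t)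
  + n.+1%:R * (a41 * shift_seq 1 (K n.+1) t)
  + n%:R * (a50 * K n t) - 2 * t.+1%:R * K n.+1 t.+1.

(* The Taylor coefficients of (1 + d y^2 + f y^4)^21. Numerals are unary, whence
   the factor 3 * 1995. *)
Definition q21_coefs (R : pzRingType) (d f : R) : seq R :=
  [:: 1; 21 * d; 210 * d ^+ 2 + 21 * f; 1330 * d ^+ 3 + 420 * d * f;
      (3 * 1995) * d ^+ 4 + 3990 * d ^+ 2 * f + 210 * f ^+ 2].

(** * Tables of Taylor coefficients and certificates of ideal membership *)

Section Table.
Variables (A30 A21 A12 A03 A50 A41 A32 A23 A14 A05 : zpol).

Definition ptable := seq (nat * nat * zpol).

Definition pnat (n : nat) : zpol := pcst (Z.of_nat n).

(** Rows below 4 read as 0: rows 1 to 3 vanish, and row 0 never enters, since its [x]-derivative is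
    0 and its [y]-derivative reaches only [x^3]. Any other entry that is absent gives [None] and not
    0, so that an incomplete table cannot produce a false value. *)
Definition lookup (tab : ptable) (s n t : nat) : option zpol :=
  if (t < s)%N || (n < 4)%N then Some (pcst 0)
  else ohead [seq e.2 | e <- tab & e.1 == (n, t - s)%N].

Definition oadd_mul (tab : ptable) (acc : option zpol)
    (e : zpol * nat * nat * nat) : option zpol :=
  let: (c, s, n, t) := e in
  match acc, lookup tab s n t with
  | Some u, Some v => Some (u + c * v)%P
  | _, _ => None
  end.

(* An entry (i, j, p) says that i! K i j is the value of p. The factorials clear
   the denominators, so that integer coefficients suffice. *)
Definition residue (tab : ptable) (n t : nat) : option zpol :=
  if (20 < n)%N then None else
  (* The recursion is multiplied by [(n + 4)!], which turns [m K m] into [m (n + 4)! / m!] times the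
     stored [m! K m]. *)
  let c1 := pnat n.+4 in
  let c2 := (c1 * pnat n.+3)%P in
  let c3 := (c2 * pnat n.+2)%P in
  let c4 := (c3 * pnat n.+1)%P in
  let c5 := (c4 * pnat n)%P in
  foldl (oadd_mul tab) (Some (pcst 0))
    [:: (A03, 3, n.+4.+1, t); (A05, 5, n.+4.+1, t);
        (c1 * A12, 2, n.+4, t)%P; (c1 * A14, 4, n.+4, t)%P;
        (c2 * A21, 1, n.+3, t)%P; (c2 * A23, 3, n.+3, t)%P;
        (c3 * A30, 0, n.+2, t)%P; (c3 * A32, 2, n.+2, t)%P;
        (c4 * A41, 1, n.+1, t)%P; (c5 * A50, 0, n, t)%P;
        (pcst (-2) * pnat t.+1 * c3, 0, n.+1, t.+1)%P]%N.

(** The residue at [t + 1] is minus the one term left out, in which row [n + 5] carries a factor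
    [y]; its opposite is therefore the entry [(n + 5, t)]. *)
Definition step (tab : ptable) (e : nat * nat) : ptable :=
  if residue tab e.1 e.2.+1 is Some p then
    ((e.1.+4.+1, e.2), pcst (-1) * p)%P :: tab
  else tab.

Definition table0 : ptable :=
  let r := [:: pcst 1; pcst 21 * A03; pcst 210 * A03 ^ 2 + pcst 21 * A05;
      pcst 1330 * A03 ^ 3 + pcst 420 * A03 * A05;
      pcst 5985 * A03 ^ 4 + pcst 3990 * A03 ^ 2 * A05
        + pcst 210 * A05 ^ 2]%P in
  [seq (4%N, i.*2, pcst 24 * nth (pcst 0) r i)%P | i <- iota 0 5].

(** Beyond row 4 the entries [(i, t)] are those with [i + 2 t <= w]. To compute one of them, the
    leading terms [y h_x] and [x^3 h_y] involve entries of the same weight [i + 2 t] and all other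
    terms involve smaller weights, so that the truncated table is closed under the recursion. Only
    [i + t] even is kept, because [h] is invariant under [(x, y) -> (-x, -y)]. *)
Definition table (w : nat) : ptable :=
  foldl step table0
    [seq e <- [seq (n, t) | n <- iota 0 (w - 4), t <- iota 0 ((w - n - 5)./2).+1]
       | odd (e.1 + e.2)].

(** At [t = 0] the unknown row [n + 5] drops out, since it enters with a factor [y]. The default 0
    is harmless: it evaluates to 0, as a true obstruction does. *)
Definition obstruction (w n : nat) : zpol :=
  odflt (pcst 0) (residue (table w) n 0).

Section Soundness.
Context {R : realFieldType} (l : seq R) (K : nat -> nat -> R).
Let ev := peval l.

Variables a30 a21 a12 a03 a50 a41 a32 a23 a14 a05 : R.
Hypothesis evA : [seq ev p | p <- [:: A30; A21; A12; A03; A50; A41; A32; A23; A14; A05]]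
  = [:: a30; a21; a12; a03; a50; a41; a32; a23; a14; a05].
Hypothesis EK : forall n t, (n <= 20)%N ->
  first_integral_coef a30 a21 a12 a03 a50 a41 a32 a23 a14 a05 K n t = 0.
Hypothesis K_lt4 : forall n t, (n < 4)%N -> K n t = 0.
Hypothesis K4 : forall i, (i < 5)%N -> K 4%N i.*2 = nth 0 (q21_coefs a03 a05) i.

Definition sound (tab : ptable) :=
  all (fun e => (e.1.1)`!%:R * K e.1.1 e.1.2 == ev e.2) tab.

Lemma lookup_sound tab s n t p : sound tab -> lookup tab s n t = Some p ->
  ev p = n`!%:R * shift_seq s (K n) t.
Proof.
move=> stab; rewrite /lookup shift_seqE.
case: ltnP => [_ [<-]|st] /=; first by rewrite mulr0 /ev pevalC.
case: ltnP => [n4 [<-]|n4] /=; first by rewrite K_lt4 // mulr0.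
elim: tab stab => //= -[e q] tab IHtab /andP[/eqP /= eq stab].
by case: eqVneq => [e1 [<-]|_] /=; [rewrite -eq e1 | exact: IHtab].
Qed.

Lemma oadd_mul_sound tab s p : sound tab ->
  forall acc, foldl (oadd_mul tab) acc s = Some p ->
  exists2 u, acc = Some u & ev p = ev u + \sum_(e <- s)
    ev e.1.1.1 * (e.1.2`!%:R * shift_seq e.1.1.2 (K e.1.2) e.2).
Proof.
move=> stab; elim: s => [|[[[c i] n] t] s IHs] acc /=.
  by move=> ->; exists p => //; rewrite big_nil addr0.
move=> /IHs[u]; case: acc => [v|] //=; case E : lookup => [q|] //= [<-] ->.
exists v => //; rewrite big_cons /= /ev pevalD pevalM addrA.
by rewrite -!/(ev _) (lookup_sound stab E).
Qed.

Lemma residue_sound tab n t p : sound tab -> residue tab n t = Some p ->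
  ev p = - (n.+4.+1`!%:R * shift_seq 1 (K n.+4.+1) t).
Proof.
move=> stab; rewrite /residue; case: ltnP => // n20.
move=> /(oadd_mul_sound stab)[_ [<-] ->].
rewrite !big_cons big_nil /=.
have := EK t n20; rewrite /first_integral_coef.
case: evA => <- <- <- <- <- <- <- <- <- <-.
rewrite /ev /pnat !(pevalM, pevalC) !zval_nat -!/(ev _).
have -> : zval Z0 = 0 :> R by [].
have -> : zval (Zneg 2) = -2 :> R by rewrite /zval /=; ring.
rewrite !factS !natrM.
have -> : n.+4.+1%:R = n%:R + 5 :> R by rewrite -natr1 -addn4 natrD; ring.
have -> : n.+4%:R = n%:R + 4 :> R by rewrite -addn4 natrD.
have -> : n.+3%:R = n%:R + 3 :> R by rewrite -addn3 natrD.
have -> : n.+2%:R = n%:R + 2 :> R by rewrite -addn2 natrD.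
have -> : n.+1%:R = n%:R + 1 :> R by rewrite -addn1 natrD.
rewrite !(shift_seqE 0) !ltn0 !subn0 add0r addr0.
set f := n`!%:R; set m := n%:R => e.
(* The recursion, times [(n + 4)!] written as a product over [n!], is subtracted from the goal. *)
rewrite -[LHS]subr0 -(mulr0 ((m + 4) * (m + 3) * (m + 2) * (m + 1) * f)) -e.
ring.
Qed.

Lemma step_sound tab e : sound tab -> sound (step tab e).
Proof.
move=> stab; rewrite /step; case E : residue => [p|] //=.
rewrite stab andbT; apply/eqP; move: (residue_sound stab E) => /= ep.
rewrite /ev pevalM pevalC -!/(ev _) ep (_ : zval (Zneg 1) = -1 :> R) //.
by rewrite mulN1r opprK.
Qed.

Lemma table_sound w : sound (table w).
Proof.
have : sound table0.
  rewrite /sound /table0 all_map; apply/allP => i; rewrite mem_iota => /andP[_ i5] /=.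
  apply/eqP; rewrite K4 //; case: evA => _ _ _ <- _ _ _ _ _ <-.
  rewrite (_ : 4`! = 24)%N //.
  by case: i i5 => [|[|[|[|[|//]]]]] _;
    rewrite /= /ev !(pevalD, pevalM, pevalXn, pevalC) /zval /=; ring.
rewrite /table; move: table0 [seq e <- _ | _] => tab s.
by elim: s tab => //= e s IHs tab stab; apply: IHs; exact: step_sound.
Qed.

Lemma obstruction_eq0 w n : ev (obstruction w n) = 0.
Proof.
rewrite /obstruction; case E : residue => [p|] //=.
by rewrite (residue_sound (table_sound w) E) shift_seqE mulr0 oppr0.
Qed.

(* w is an arbitrary bound on the size of the table. *)
Lemma obstruction_ideal w (s : seq (zpol * nat)) (d : positive) (p : zpol) :
  Ring_polynom.Peq Z.eqb (pcst (Zpos d) * p)%P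
    (foldr (fun e => padd (e.1 * obstruction w e.2)%P) (pcst 0) s) ->
  ev p = 0.
Proof.
move=> /(pevalE l); rewrite pevalM pevalC => e; apply/eqP.
have : zval (Zpos d) * ev p == 0.
  rewrite e; elim: s {e} => //= e s /eqP IHs.
  by rewrite pevalD pevalM -!/(ev _) obstruction_eq0 mulr0 add0r; apply/eqP.
by rewrite mulf_eq0 (negbTE (zval_pos_neq0 _)).
Qed.
End Soundness.
End Table.

(** * Elimination of the coefficients *)

(** If [a_ij] is given the weight [i + 2 j - 2], obstruction [n] is quasi-homogeneous of weight
    [n - 1]. After the earlier substitutions, those with [n = 2, 4, 6, 8] are linear, with a
    constant leading coefficient, in the unknowns of weights 1, 3, 5, 7; those with [n = 10, 12]
    have [a50], of weight 3, as a factor, and the other factor is linear in the unknown of weight 6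
    or 8. *)
Lemma obstructions_vanish (R : realFieldType)
    (a30 a21 a12 a03 a50 a41 a32 a23 a14 a05 : R) (K : nat -> nat -> R) :
  (forall n t, (n <= 20)%N ->
    first_integral_coef a30 a21 a12 a03 a50 a41 a32 a23 a14 a05 K n t = 0) ->
  (forall n t, (n < 4)%N -> K n t = 0) ->
  (forall i, (i < 5)%N -> K 4%N i.*2 = nth 0 (q21_coefs a03 a05) i) ->
  [/\ a30 = 0, a12 = 0, a32 = 0, a14 = 0 & a50 = 0].
Proof.
move=> EK K0 K4.
have a30E : a30 = 0.
  pose l : seq R := [:: a30; a21; a12; a03; a50; a41; a32; a23; a14; a05].
  have evA : [seq peval l p | p <- [:: 'x_1; 'x_2; 'x_3; 'x_4; 'x_5; 'x_6; 'x_7; 'x_8; 'x_9; 'x_10]%P]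
      = [:: a30; a21; a12; a03; a50; a41; a32; a23; a14; a05].
    by rewrite /= !(pevalD, pevalM, pevalXn, pevalX, pevalC) /zval /=; do 10?[apply: (congr2 cons)] => //; field.
  have := obstruction_ideal evA EK K0 K4 (w := 4%N) (s := [:: (pcst 1, 2%N)]%P)
    (d := 2880%positive) (p := ('x_1)%P) (ltac:(by vm_compute)).
  rewrite !(pevalD, pevalM, pevalXn, pevalX, pevalC) /zval /l /=; lra.
subst a30.
have a12E : a12 = - 5 / 2 * a50.
  pose l : seq R := [:: 0; a21; a12; a03; a50; a41; a32; a23; a14; a05].
  have evA : [seq peval l p | p <- [:: pcst 0; 'x_2; 'x_3; 'x_4; 'x_5; 'x_6; 'x_7; 'x_8; 'x_9; 'x_10]%P]
      = [:: 0; a21; a12; a03; a50; a41; a32; a23; a14; a05].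
    by rewrite /= !(pevalD, pevalM, pevalXn, pevalX, pevalC) /zval /=; do 10?[apply: (congr2 cons)] => //; field.
  have := obstruction_ideal evA EK K0 K4 (w := 7%N) (s := [:: (pcst 1, 4%N)]%P)
    (d := 32256%positive) (p := ((pcst 2 * 'x_3 + pcst 5 * 'x_5))%P) (ltac:(by vm_compute)).
  rewrite !(pevalD, pevalM, pevalXn, pevalX, pevalC) /zval /l /=; lra.
subst a12.
have a32E : a32 = - 3 / 2 * a50 * a21.
  (* The first variable stands for [a50 / 2], so that the values substituted for [a12] and [a50]
     have integer coefficients; the denominators 12 and 60 below serve the same end. *)
  pose l : seq R := [:: a50 / 2; a21; a03; a41; a32; a23; a14; a05].
  have evA : [seq peval l p | p <- [:: pcst 0; 'x_2; pcst (-5) * 'x_1; 'x_3; pcst 2 * 'x_1; 'x_4; 'x_5; 'x_6; 'x_7; 'x_8]%P]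
      = [:: 0; a21; - 5 / 2 * a50; a03; a50; a41; a32; a23; a14; a05].
    by rewrite /= !(pevalD, pevalM, pevalXn, pevalX, pevalC) /zval /=; do 10?[apply: (congr2 cons)] => //; field.
  have := obstruction_ideal evA EK K0 K4 (w := 9%N) (s := [:: (pcst 1, 6%N)]%P)
    (d := 4147200%positive) (p := (('x_5 + pcst 3 * 'x_1 * 'x_2))%P) (ltac:(by vm_compute)).
  rewrite !(pevalD, pevalM, pevalXn, pevalX, pevalC) /zval /l /=; lra.
subst a32.
have a14E : a14 = - 5 / 12 * a50 * a41 - 5 / 2 * a50 * a03.
  pose l : seq R := [:: a50 / 12; a21; a03; a41; a23; a14; a05].
  have evA : [seq peval l p | p <- [:: pcst 0; 'x_2; pcst (-30) * 'x_1; 'x_3; pcst 12 * 'x_1; 'x_4; pcst (-18) * 'x_1 * 'x_2; 'x_5; 'x_6; 'x_7]%P]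
      = [:: 0; a21; - 5 / 2 * a50; a03; a50; a41; - 3 / 2 * a50 * a21; a23; a14; a05].
    by rewrite /= !(pevalD, pevalM, pevalXn, pevalX, pevalC) /zval /=; do 10?[apply: (congr2 cons)] => //; field.
  have := obstruction_ideal evA EK K0 K4 (w := 11%N) (s := [:: (pcst 1, 8%N)]%P)
    (d := 510935040%positive) (p := (('x_6 + pcst 5 * 'x_1 * 'x_4 + pcst 30 * 'x_1 * 'x_3))%P) (ltac:(by vm_compute)).
  rewrite !(pevalD, pevalM, pevalXn, pevalX, pevalC) /zval /l /=; lra.
subst a14.
have [a0|a0] := eqVneq a50 0; first by rewrite a0; split; ring.
have {}a0 : a50 / 60 != 0 by rewrite mulf_neq0 // invr_eq0 pnatr_eq0.
have a23E : a23 = (6 * 1000) * (a50 / 60) ^+ 2 - 10 * a21 * (a41 / 60).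
  pose l : seq R := [:: a50 / 60; a21; a41 / 60; a03; a23; a05].
  have evA : [seq peval l p | p <- [:: pcst 0; 'x_2; pcst (-150) * 'x_1; 'x_4; pcst 60 * 'x_1; pcst 60 * 'x_3; pcst (-90) * 'x_1 * 'x_2; 'x_5;
      pcst (-1500) * 'x_1 * 'x_3 + pcst (-150) * 'x_1 * 'x_4; 'x_6]%P]
      = [:: 0; a21; - 5 / 2 * a50; a03; a50; a41; - 3 / 2 * a50 * a21; a23;
      - 5 / 12 * a50 * a41 - 5 / 2 * a50 * a03; a05].
    by rewrite /= !(pevalD, pevalM, pevalXn, pevalX, pevalC) /zval /=; do 10?[apply: (congr2 cons)] => //; field.
  have := obstruction_ideal evA EK K0 K4 (w := 13%N) (s := [:: (pcst 1, 10%N)]%P)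
    (d := 4891041792000%positive) (p := (('x_1 * ('x_5 + pcst (-6000) * 'x_1 ^ 2 + pcst 10 * 'x_2 * 'x_3)))%P) (ltac:(by vm_compute)).
  rewrite !(pevalD, pevalM, pevalXn, pevalX, pevalC) /zval /l /=; move/eqP; rewrite mulf_eq0 (negbTE a0) /= => /eqP e15; lra.
subst a23.
have a05E : a05 = 180 * (a50 / 60) ^+ 2 * a21 - 60 * (a41 / 60) ^+ 2
    - 10 * (a41 / 60) * a03.
  pose l : seq R := [:: a50 / 60; a21; a41 / 60; a03; a05].
  have evA : [seq peval l p | p <- [:: pcst 0; 'x_2; pcst (-150) * 'x_1; 'x_4; pcst 60 * 'x_1; pcst 60 * 'x_3; pcst (-90) * 'x_1 * 'x_2; pcst 6000 * 'x_1 ^ 2 + pcst (-10) * 'x_2 * 'x_3;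
      pcst (-1500) * 'x_1 * 'x_3 + pcst (-150) * 'x_1 * 'x_4; 'x_5]%P]
      = [:: 0; a21; - 5 / 2 * a50; a03; a50; a41; - 3 / 2 * a50 * a21; (6 * 1000) * (a50 / 60) ^+ 2 - 10 * a21 * (a41 / 60);
      - 5 / 12 * a50 * a41 - 5 / 2 * a50 * a03; a05].
    by rewrite /= !(pevalD, pevalM, pevalXn, pevalX, pevalC) /zval /=; do 10?[apply: (congr2 cons)] => //; field.
  have := obstruction_ideal evA EK K0 K4 (w := 15%N) (s := [:: (pcst 1, 12%N)]%P)
    (d := 2575112601600000%positive) (p := (('x_1 * ('x_5 + pcst (-180) * 'x_1 ^ 2 * 'x_2 + pcst 60 * 'x_3 ^ 2 + pcst 10 * 'x_3 * 'x_4)))%P) (ltac:(by vm_compute)).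
  rewrite !(pevalD, pevalM, pevalXn, pevalX, pevalC) /zval /l /=; move/eqP; rewrite mulf_eq0 (negbTE a0) /= => /eqP e17; lra.
subst a05.
pose l : seq R := [:: a50 / 60; a21; a41 / 60; a03].
have evA : [seq peval l p | p <- [:: pcst 0; 'x_2; pcst (-150) * 'x_1; 'x_4; pcst 60 * 'x_1; pcst 60 * 'x_3; pcst (-90) * 'x_1 * 'x_2; pcst 6000 * 'x_1 ^ 2 + pcst (-10) * 'x_2 * 'x_3;
      pcst (-1500) * 'x_1 * 'x_3 + pcst (-150) * 'x_1 * 'x_4; pcst 180 * 'x_1 ^ 2 * 'x_2 + pcst (-60) * 'x_3 ^ 2 + pcst (-10) * 'x_3 * 'x_4]%P]
    = [:: 0; a21; - 5 / 2 * a50; a03; a50; a41; - 3 / 2 * a50 * a21; (6 * 1000) * (a50 / 60) ^+ 2 - 10 * a21 * (a41 / 60);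
      - 5 / 12 * a50 * a41 - 5 / 2 * a50 * a03; 180 * (a50 / 60) ^+ 2 * a21 - 60 * (a41 / 60) ^+ 2 - 10 * (a41 / 60) * a03].
  by rewrite /= !(pevalD, pevalM, pevalXn, pevalX, pevalC) /zval /=; do 10?[apply: (congr2 cons)] => //; field.
pose a := pvar 1; pose b := pvar 2; pose c := pvar 3; pose d := pvar 4.
(* The identity is quasi-homogeneous: [a^9] has weight 27, and the cofactors of obstructions 14, 16,
   18, 20 have weights 14, 12, 10, 8. Finding them is thus a finite linear problem; here they are
   only checked. *)
have := obstruction_ideal evA EK K0 K4 (w := 23%N) (p := (a ^ 9)%P)
  (d := 1806332775390999603245481984000000000000000000%positive)
  (s := [:: (pcst 49713750588902400000000 * a ^ 4 * b + pcst (-657388694394432000) * a ^ 2 * b ^ 4 +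
          pcst (-8381320915968000000) * a ^ 2 * b ^ 2 * c + pcst 5651089202880000000 * a ^ 2 * b ^
          2 * d + pcst (-139688681932800000000) * a ^ 2 * c ^ 2 + pcst 705095251660800000000 * a ^
          2 * c * d + pcst (-136695353034240000000) * a ^ 2 * d ^ 2 + pcst 48994343798400 * b ^ 7
          + pcst (-7207044036192000) * b ^ 5 * c + pcst (-8886257279275200) * b ^ 5 * d + pcst
          (-5099559155260416000) * b ^ 3 * c ^ 2 + pcst (-1380863519323200000) * b ^ 3 * c * d +
          pcst 125693603375894400 * b ^ 3 * d ^ 2 + pcst (-115266188201472000000) * b * c ^ 3 +
          pcst 4460358538944000000 * b * c ^ 2 * d + pcst 2790049744204800000 * b * c * d ^ 2 +
          pcst 115957382808960000 * b * d ^ 3, 14%N);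
       (pcst 47477920089600000000 * a ^ 4 + pcst (-712168801344000) * a ^ 2 * b ^ 3 + pcst
          48875655628800000 * a ^ 2 * b * d + pcst 207819227616 * b ^ 6 + pcst (-18243078934080) *
          b ^ 4 * c + pcst (-31769747675600) * b ^ 4 * d + pcst (-9426992082816000) * b ^ 2 * c ^
          2 + pcst (-2197237900352000) * b ^ 2 * c * d + pcst 84291961424000 * b ^ 2 * d ^ 2, 16%N);
       (pcst 35994816000000 * a ^ 2 * d + pcst 342632472 * b ^ 5 + pcst (-14697883200) * b ^ 3 *
          c + pcst (-48222110960) * b ^ 3 * d + pcst (-5809932480000) * b * c ^ 2 + pcst
          (-892179200000) * b * c * d + pcst (-30534064000) * b * d ^ 2, 18%N);
       (pcst 180999 * b ^ 4 + pcst (-24531000) * b ^ 2 * d, 20%N)]%P) (ltac:(by vm_compute)).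
by rewrite pevalXn pevalX => /eqP; rewrite expf_eq0 (negbTE a0).
Qed.

(** * A center makes the obstructions vanish *)

Section Derivatives.
Context {R : realType}.
Implicit Types f g : R -> R.

Lemma is_derive_continuous f (df : R -> R) :
  (forall t : R, is_derive t 1 f (df t)) -> continuous f.
Proof.
by move=> fd t; apply: differentiable_continuous; apply/derivable1_diffP; have [] := fd t.
Qed.

Lemma mean_value f (df : R -> R) (a b : R) : a <= b ->
  (forall t, t \in `[a, b] -> is_derive t 1 f (df t)) ->
  exists2 c, c \in `[a, b] & f b - f a = df c * (b - a).
Proof.
move=> ab fd.
have fd' (t : R) : t \in `]a, b[ -> is_derive t 1 f (df t).
  by move=> ?; apply: fd; exact: subset_itv_oo_cc.
have fc : {within `[a, b], continuous f}.
  by apply: derivable_within_continuous => x xab; have [] := fd x xab.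
have [c cab fE] := MVT_segment ab fd' fc.
by exists c.
Qed.

Lemma is_derive_fun_pair (g : R -> R * R) (t : R) (v : R * R) :
  is_derive t 1 g v <->
  is_derive t 1 (fun s => (g s).1) v.1 /\ is_derive t 1 (fun s => (g s).2) v.2.
Proof.
split.
- move=> [dg gv].
  have cv : h^-1 *: ((g \o shift t) (h *: (1:R)) - g t) @[h --> 0^'] --> v.
    by rewrite -gv; exact: dg.
  split.
  + have c1 : h^-1 *: (((fun s => (g s).1) \o shift t) (h *: (1:R)) - (g t).1)
       @[h --> 0^'] --> v.1.
      exact: (cvg_comp _ _ cv (@cvg_fst _ _ _ _ _)).
    by split; [apply/cvg_ex; exists v.1 | exact: cvg_lim].
  + have c1 : h^-1 *: (((fun s => (g s).2) \o shift t) (h *: (1:R)) - (g t).2)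
       @[h --> 0^'] --> v.2.
      exact: (cvg_comp _ _ cv (@cvg_snd _ _ _ _ _)).
    by split; [apply/cvg_ex; exists v.2 | exact: cvg_lim].
- move=> [[d1 v1] [d2 v2]].
  have cv : h^-1 *: ((g \o shift t) (h *: (1:R)) - g t) @[h --> 0^'] --> v.
    have c1 : h^-1 *: (((fun s => (g s).1) \o shift t) (h *: (1:R)) - (g t).1)
      @[h --> 0^'] --> v.1 by rewrite -v1; exact: d1.
    have c2 : h^-1 *: (((fun s => (g s).2) \o shift t) (h *: (1:R)) - (g t).2)
      @[h --> 0^'] --> v.2 by rewrite -v2; exact: d2.
    rewrite [v]surjective_pairing; exact: (cvg_pair c1 c2).
  by split; [apply/cvg_ex; exists v | exact: cvg_lim].
Qed.

Lemma is_derive_le0 f (df : R -> R) (a b : R) : a <= b ->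
  (forall t, t \in `[a, b] -> is_derive t 1 f (df t)) ->
  (forall t, t \in `[a, b] -> df t <= 0) -> f b <= f a.
Proof.
move=> ab fd df0; have [c cab e] := mean_value ab fd.
by rewrite -subr_le0 e mulr_le0_ge0 ?subr_ge0 ?df0.
Qed.

Lemma is_derive_cst_near f (df c t : R) :
  (\forall s \near t, f s = c) -> is_derive t 1 f df -> df = 0.
Proof.
move=> fc fd; have [_ <-] := near_eq_is_derive fc fd.
exact: derive_cst.
Qed.

Lemma is_derive_affine f (df a b t : R) : is_derive (a + b * t) 1 f df ->
  is_derive t 1 (fun s => f (a + b * s)) (b * df).
Proof.
move=> fd.
have gd : is_derive t 1 (fun s : R => a + b * s) b.
  have := is_deriveD (is_derive_cst a t 1) (is_deriveZ b (is_derive_id t (1 : R))).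
  by rewrite add0r [_ *: _]mulr1.
have := @is_derive1_comp _ f (fun s => a + b * s) _ _ _ fd gd.
by rewrite /GRing.scale /= mulrC.
Qed.

(** The time is the infimum of all [t >= 0] with [d <= m t]. By the intermediate value theorem a
    larger value at or before that time would give an earlier crossing. *)
Lemma first_hit (m : R -> R) (d t1 : R) : continuous m -> m 0 < d -> 0 <= t1 ->
  d <= m t1 ->
  exists t, [/\ 0 <= t, m t = d & forall s, 0 <= s <= t -> m s <= d].
Proof.
move=> mc m0 t10 dm1.
pose S := [set t : R | 0 <= t /\ d <= m t].
have S1 : S t1 by [].
have hS : has_inf S by split; [exists t1 | exists 0 => s []].
set t := inf S.
have t0 : 0 <= t by apply: lb_le_inf; [exists t1 | move=> s []].
have lbt s : S s -> t <= s by move=> Ss; apply: ge_inf => //; case: hS.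
have mtd : d <= m t.
  rewrite leNgt; apply/negP => mtd.
  have : \forall s \near t, m s < d by exact: (cvgr_lt (m t) (mc t)).
  move=> /nbhs_ballP[e /= e0 eb].
  have [s Ss st] := inf_adherent e0 hS.
  have : m s < d.
    apply: eb; rewrite /ball /= distrC ger0_norm ?subr_ge0 ?lbt //.
    by rewrite ltrBlDl.
  by case: Ss => _; rewrite leNgt => /negP.
have hd c : c \in `[0, t] -> m c = d -> c = t.
  rewrite in_itv /= => /andP[c0 ct] mc'; apply/le_anti; rewrite ct lbt //.
  by split => //; rewrite mc'.
have ivt s : 0 <= s -> d <= m s -> exists2 c, c \in `[0, s] & m c = d.
  move=> s0 ds; apply: IVT => //; first by move=> x; exact: continuous_subspaceT.
  by rewrite ge_min le_max (ltW m0) ds orbT.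
exists t; split => //.
  by have [c ct e] := ivt t t0 mtd; rewrite -(hd c).
move=> s /andP[s0 st]; rewrite leNgt; apply/negP => ds.
have [c cs e] := ivt s s0 (ltW ds).
have : c = t.
  by apply: hd => //; move: cs; rewrite !in_itv /= => /andP[-> /le_trans]; exact.
move=> ct; move: cs; rewrite in_itv /= ct => /andP[_ ts].
by move: ds; rewrite -(_ : c = s) ?e ?ltxx // ct; apply/le_anti; rewrite st ts.
Qed.

(** As long as [m <= d], [psi] does not increase, so at the first time with [m = d] it would still
    be below [mu], its minimum on the barrier. *)
Lemma barrier (m psi w : R -> R) (d mu : R) : continuous m ->
  (forall t : R, is_derive t 1 psi (w t)) ->
  (forall t, m t <= d -> w t <= 0) -> (forall t, m t = d -> mu <= psi t) ->
  m 0 < d -> psi 0 < mu -> forall t, 0 <= t -> m t < d.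
Proof.
move=> mc psid w0 psimu m0 psi0 t1 t10; rewrite ltNge; apply/negP => dm1.
have [t [t0 mt ms]] := first_hit mc m0 t10 dm1.
have : psi t <= psi 0.
  apply: (is_derive_le0 t0 (fun s _ => psid s)) => s.
  by rewrite in_itv /= => /ms /w0.
by apply/negP; rewrite -ltNge (lt_le_trans psi0) ?psimu.
Qed.
End Derivatives.

(** * Polynomials in two variables along curves *)

Section BivariatePolynomials.
Context {R : realType}.
Implicit Types (h : {poly {poly R}}) (x y : R -> R).

(** The outer variable is [x] and the inner one [y]: [deriv] is then the partial derivative in [x],
    and [map_poly deriv] the one in [y]. *)
Definition ev2 h (a b : R) : R := h.[a%:P].[b].

Lemma ev2MXaddC h (c : {poly R}) a b :
  ev2 (h * 'X + c%:P) a b = ev2 h a b * a + c.[b].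
Proof. by rewrite /ev2 hornerMXaddC !hornerE. Qed.

Lemma map_derivMXaddC h (c : {poly R}) :
  map_poly (@deriv R) (h * 'X + c%:P) = map_poly (@deriv R) h * 'X + (c^`())%:P.
Proof.
apply/polyP => i; rewrite coef_map /= !coefD !coefMX !coefC coef_map /=.
by case: i => [|i] /=; rewrite derivD ?deriv0.
Qed.

Lemma is_derive_ev2 h x y (t dx dy : R) :
  is_derive t 1 x dx -> is_derive t 1 y dy ->
  is_derive t 1 (fun s => ev2 h (x s) (y s))
    (ev2 h^`() (x t) (y t) * dx + ev2 (map_poly (@deriv R) h) (x t) (y t) * dy).
Proof.
move=> xd yd; elim/poly_ind: h => [|h c IHh].
  rewrite deriv0 map_poly0.
  have -> : (fun s => ev2 0 (x s) (y s)) = cst (0 : R).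
    by apply/funext => s; rewrite /ev2 !horner0.
  by rewrite /ev2 !horner0 !mul0r addr0; exact: is_derive_cst.
have -> : (fun s => ev2 (h * 'X + c%:P) (x s) (y s)) =
    (fun s => ev2 h (x s) (y s)) * x + (horner c \o y).
  by apply/funext => s; rewrite ev2MXaddC.
have cd : is_derive t 1 (horner c \o y) ((c^`()).[y t] * dy).
  exact: (@is_derive1_comp _ (horner c) y _ _ _ (is_derive_poly c (y t)) yd).
apply: is_derive_eq (is_deriveD (is_deriveM IHh xd) cd) _.
rewrite /GRing.scale /= derivMXaddC map_derivMXaddC !ev2MXaddC.
have -> : ev2 (h + h^`() * 'X) (x t) (y t) =
    ev2 h (x t) (y t) + ev2 h^`() (x t) (y t) * x t.
  by rewrite /ev2 hornerD hornerMX !hornerE.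
ring.
Qed.

Lemma continuous_ev2 h : continuous (fun p : R * R => ev2 h p.1 p.2).
Proof.
elim/poly_ind: h => [|h c IHh] p.
  rewrite (_ : (fun p : R * R => _) = cst (0 : R)); first exact: cvg_cst.
  by apply/funext => q; rewrite /ev2 !horner0.
rewrite (_ : (fun p : R * R => _) =
    fun p : R * R => ev2 h p.1 p.2 * p.1 + c.[p.2]).
  apply: cvgD; first by apply: cvgM; [exact: IHh | exact: cvg_fst].
  by apply: continuous_comp; [exact: cvg_snd | exact: continuous_horner].
by apply/funext => q; rewrite ev2MXaddC.
Qed.
End BivariatePolynomials.

Lemma nbhs00_box (R : realType) (U : set (R * R)) : nbhs ((0, 0) : R * R) U ->
  exists2 d : R, 0 < d & forall x y, `|x| < d -> `|y| < d -> U (x, y).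
Proof.
move=> /nbhs_ballP[d /= d0 dU]; exists d => // x y xd yd; apply: dU.
by split; rewrite /ball /= sub0r normrN.
Qed.

Lemma ev2_near00 (R : realType) (h : {poly {poly R}}) (c : R) : c < ev2 h 0 0 ->
  exists2 d : R, 0 < d & forall x y, `|x| < d -> `|y| < d -> c < ev2 h x y.
Proof.
move=> ch; apply: (@nbhs00_box _ [set p | c < ev2 h p.1 p.2]).
exact: (cvgr_gt _ (@continuous_ev2 R h (0, 0))).
Qed.

Lemma half_lt (R : realType) (a : R) : 0 < a -> a / 2 < a.
Proof. lra. Qed.

Section Ev2.
Context {R : realType}.
Implicit Types p q : {poly {poly R}}.

Lemma ev2D p q a b : ev2 (p + q) a b = ev2 p a b + ev2 q a b.
Proof. by rewrite /ev2 !hornerD. Qed.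

Lemma ev2N p a b : ev2 (- p) a b = - ev2 p a b.
Proof. by rewrite /ev2 !hornerN. Qed.

Lemma ev2M p q a b : ev2 (p * q) a b = ev2 p a b * ev2 q a b.
Proof. by rewrite /ev2 !hornerM. Qed.

Lemma ev2Xn n a b : ev2 ('X^n : {poly {poly R}}) a b = a ^+ n.
Proof. by rewrite /ev2 hornerXn horner_exp hornerC. Qed.

Lemma ev2C (c : {poly R}) a b : ev2 c%:P a b = c.[b].
Proof. by rewrite /ev2 hornerC. Qed.

Lemma ev2_nat n a b : ev2 (n%:R : {poly {poly R}}) a b = n%:R.
Proof. by rewrite -polyC_natr ev2C -polyC_natr hornerC. Qed.

Definition ev2E := (ev2Xn, ev2_nat, ev2C, ev2D, ev2N, ev2M).
End Ev2.

(** * A nonzero obstruction excludes a center *)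

Section NotCenter.
Context {R : realType}.
Variables (X : R * R -> R * R) (P h A B G : {poly {poly R}}) (e : nat) (r : R).
Hypothesis XE : forall p, X p = (ev2 P p.1 p.2, - 2 * p.1 ^+ 3).
Hypothesis hG :
  P * h^`() - 2%:R * 'X^3 * map_poly (@deriv R) h = 'X^e * G.
Hypothesis e_even : ~~ odd e.
Hypothesis G0 : ev2 G 0 0 != 0.
Hypothesis hE : h = ('X ^+ 2)%:P * A + 'X^4 * B.
Hypotheses (A0 : 0 < ev2 A 0 0) (B0 : 0 < ev2 B 0 0).
Hypotheses (r0 : 0 < r)
  (P_axis : forall y, `|y| < r -> ev2 P 0 y = 0 -> y = 0).

Lemma ev2_hE x y : ev2 h x y = y ^+ 2 * ev2 A x y + x ^+ 4 * ev2 B x y.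
Proof. by rewrite hE !ev2E hornerXn. Qed.

Lemma ev2_hG x y :
  ev2 P x y * ev2 h^`() x y - 2 * x ^+ 3 * ev2 (map_poly (@deriv R) h) x y
  = x ^+ e * ev2 G x y.
Proof.
have := congr1 (fun q => ev2 q x y) hG.
by rewrite !ev2E.
Qed.

(* Along orbits h' = x^e G has constant sign near 0 while h is positive definite,
   so that orbits starting near 0 stay there, forwards or backwards. On a
   periodic one h is then constant, x vanishes identically, and so does y. *)
Lemma not_center : ~ is_center X (0, 0).
Proof.
case=> _ [U [U0 Uper]].
pose sg : R := Num.sg (ev2 G 0 0).
have sgG : 0 < ev2 (sg%:P%:P * G) 0 0.
  by rewrite !ev2E hornerC -normrEsg normr_gt0.
have [dA dA0 Ad] := ev2_near00 (half_lt A0).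
have [dB dB0 Bd] := ev2_near00 (half_lt B0).
have [dG dG0 Gd] := ev2_near00 sgG.
pose al := Num.min (ev2 A 0 0 / 2) (ev2 B 0 0 / 2).
have al0 : 0 < al by rewrite lt_min !divr_gt0.
pose d := Num.min 1 (Num.min (r / 2) (Num.min (dA / 2) (Num.min (dB / 2) (dG / 2)))).
have d0 : 0 < d by rewrite !lt_min ltr01 !divr_gt0.
have dlt (x : R) : `|x| <= d -> [/\ `|x| <= 1, `|x| < r, `|x| < dA, `|x| < dB & `|x| < dG].
  have half a : 0 < a -> `|x| <= a / 2 -> `|x| < a.
    by move=> a0 /le_lt_trans; apply; exact: half_lt.
  by rewrite !le_min => /and5P[? /half ? /half ? /half ? /half ?]; split=> //; auto.
have d1 : d <= 1 by rewrite ge_min lexx.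
(* On the boundary of the square of half-side [d], [h >= al (y^2 + x^4) >= al d^4], since
   [d <= 1]. *)
clearbody d; pose mu : R := al * d ^+ 4.
have mu0 : 0 < mu by rewrite mulr_gt0 ?exprn_gt0.
have hmu (x y : R) : Num.max `|x| `|y| = d -> mu <= ev2 h x y.
  move=> xyd.
  have [xd yd] : `|x| <= d /\ `|y| <= d.
    by split; rewrite -xyd le_max lexx ?orbT.
  have [x1 xr xA xB xG] := dlt _ xd; have [y1 yr yA yB yG] := dlt _ yd.
  have alA : al <= ev2 A x y by rewrite (le_trans _ (ltW (Ad _ _ xA yA))) // ge_min lexx.
  have alB : al <= ev2 B x y.
    by rewrite (le_trans _ (ltW (Bd _ _ xB yB))) // ge_min lexx orbT.
  rewrite ev2_hE.
  have le1 : al * y ^+ 2 <= y ^+ 2 * ev2 A x y by rewrite mulrC ler_wpM2l ?sqr_ge0.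
  have le2 : al * x ^+ 4 <= x ^+ 4 * ev2 B x y.
    by rewrite mulrC ler_wpM2l // -[4%N]/(2 * 2)%N exprM sqr_ge0.
  apply: le_trans (lerD le1 le2); rewrite -mulrDr ler_pM2l //.
  have [xy|xy] := leP `|x| `|y|.
    move: xyd; rewrite (max_r xy) => yE.
    have : d ^+ 4 <= y ^+ 2.
      rewrite -[y ^+ 2]real_normK ?num_real // yE.
      by rewrite ler_wiXn2l // ltW.
    by move/le_trans; apply; rewrite lerDl -[4%N]/(2 * 2)%N exprM sqr_ge0.
  move: xyd; rewrite (max_l (ltW xy)) => xE.
  have : d ^+ 4 <= x ^+ 4.
    by rewrite -xE -[4%N]/(2 * 2)%N !exprM real_normK ?num_real.
  by move/le_trans; apply; rewrite lerDr sqr_ge0.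
have [rU rU0 UrU] := nbhs00_box U0.
have hmu0 : ev2 (- h + mu%:P%:P) 0 0 > 0.
  by rewrite !ev2E hornerC ev2_hE !expr0n /= !mul0r add0r oppr0 add0r.
have [dm dm0 dmd] := ev2_near00 hmu0.
pose y0 := Num.min rU (Num.min dm d) / 2.
have y00 : 0 < y0 by rewrite divr_gt0 // !lt_min rU0 dm0 d0.
have [y0U y0m y0d] : [/\ y0 < rU, y0 < dm & y0 < d].
  have : y0 < Num.min rU (Num.min dm d).
    have : 0 < Num.min rU (Num.min dm d) by rewrite !lt_min rU0 dm0 d0.
    exact: half_lt.
  by rewrite !lt_min => /and3P.
have ny0 : `|y0| = y0 by rewrite gtr0_norm.
have hy0 : ev2 h 0 y0 < mu.
  have := dmd 0 y0; rewrite normr0 ny0 !ev2E hornerC => /(_ dm0 y0m); lra.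
have Uy0 : U (0, y0) by apply: UrU; rewrite ?normr0 ?ny0.
have [|O [[g [T [gsol T0 gT _ OE]]] Oq _ _]] := Uper _ Uy0.
  by move=> [/eqP]; rewrite gt_eqF.
move: Oq; rewrite OE => -[t0 _ gt0].
have gx (t : R) : is_derive t 1 (fun s => (g s).1) (ev2 P (g t).1 (g t).2).
  by have /is_derive_fun_pair[+ _] := gsol t I; rewrite XE.
have gy (t : R) : is_derive t 1 (fun s => (g s).2) (- 2 * (g t).1 ^+ 3).
  by have /is_derive_fun_pair[_ +] := gsol t I; rewrite XE.
(* Time runs in the direction [- sg], so that [psi] below is nonincreasing while the orbit is in the
   square. *)
pose x (s : R) := (g (t0 + - sg * s)).1; pose y (s : R) := (g (t0 + - sg * s)).2.
have xd (s : R) : is_derive s 1 x (- sg * ev2 P (x s) (y s)).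
  exact: is_derive_affine (gx _).
have yd (s : R) : is_derive s 1 y (- sg * (- 2 * x s ^+ 3)).
  exact: is_derive_affine (gy _).
have x0 : x 0 = 0 by rewrite /x mulr0 addr0 gt0.
have y0E : y 0 = y0 by rewrite /y mulr0 addr0 gt0.
pose psi (s : R) := ev2 h (x s) (y s).
have psid (s : R) : is_derive s 1 psi (- (x s ^+ e * ev2 (sg%:P%:P * G) (x s) (y s))).
  apply: is_derive_eq (is_derive_ev2 h (xd s) (yd s)) _.
  rewrite !ev2E hornerC.
  transitivity (- sg * (x s ^+ e * ev2 G (x s) (y s))); last by ring.
  by rewrite -ev2_hG; ring.
have sg2 : sg * sg = 1 by rewrite -expr2 sqr_sg G0.
have xe (s : R) : 0 <= x s ^+ e by rewrite exprn_even_ge0.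
have psi_le0 (s : R) : Num.max `|x s| `|y s| <= d ->
    - (x s ^+ e * ev2 (sg%:P%:P * G) (x s) (y s)) <= 0.
  rewrite ge_max => /andP[/dlt[_ _ _ _ ?] /dlt[_ _ _ _ ?]].
  by rewrite oppr_le0 mulr_ge0 // ltW // Gd.
have xc : continuous x := is_derive_continuous xd.
have yc : continuous y := is_derive_continuous yd.
have mc : continuous (fun s => Num.max `|x s| `|y s|).
  move=> s; apply: (@continuous_max R R (fun s => `|x s|) (fun s => `|y s|)).
    exact: cvg_norm (xc s).
  exact: cvg_norm (yc s).
have box : forall s, 0 <= s -> Num.max `|x s| `|y s| < d.
  apply: (barrier mc psid psi_le0 (mu := mu)).
  - by move=> s; exact: hmu.
  - by rewrite x0 y0E normr0 ny0 (max_r (ltW y00)).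
  - by rewrite /psi x0 y0E.
have gTn (t : R) : g (t - T) = g t by rewrite -[in RHS](subrK T t) gT.
have psiT : psi T = psi 0.
  rewrite /psi /x /y mulr0 addr0.
  have : sg = 1 \/ sg = -1.
    by move/eqP: sg2; rewrite -expr2 sqrf_eq1 => /orP[] /eqP; tauto.
  by move=> [] ->; rewrite ?opprK ?mulN1r ?mul1r ?gTn ?gT.
have psi_dec (s t : R) : 0 <= s -> s <= t -> psi t <= psi s.
  move=> s0 st; apply: (is_derive_le0 st (fun t _ => psid t)) => u.
  rewrite in_itv /= => /andP[su _]; apply: psi_le0; apply: ltW; apply: box.
  exact: le_trans su.
have psi_cst (s : R) : 0 <= s <= T -> psi s = psi 0.
  by move=> /andP[s0 sT]; apply/le_anti; rewrite -{2}psiT !psi_dec.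
have inT (s : R) : 0 < s < T -> \forall u \near s, 0 < u < T.
  move=> sT; have : s \in `]0, T[ by rewrite in_itv.
  by move=> /near_in_itvoo; apply: filterS => u; rewrite in_itv.
have x_eq0 (s : R) : 0 < s < T -> x s = 0.
  move=> sT.
  have c0 : \forall u \near s, psi u = psi 0.
    apply: filterS (inT _ sT) => u /andP[u0 uT]; apply: psi_cst.
    by rewrite !ltW.
  have := is_derive_cst_near c0 (psid s).
  move/eqP; rewrite oppr_eq0 mulf_eq0 expf_eq0 => /orP[/andP[_ /eqP //]|].
  have : Num.max `|x s| `|y s| < d by apply: box; case/andP: sT => /ltW.
  rewrite gt_max => /andP[/ltW/dlt[_ _ _ _ ?] /ltW/dlt[_ _ _ _ ?]].
  by rewrite gt_eqF // Gd.
have y_eq0 (s : R) : 0 < s < T -> y s = 0.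
  move=> sT.
  have c0 : \forall u \near s, x u = 0.
    by apply: filterS (inT _ sT) => u /x_eq0.
  have := is_derive_cst_near c0 (xd s).
  move/eqP; rewrite mulf_eq0 oppr_eq0 => /orP[/eqP sg0|/eqP].
    by move/eqP: sg2; rewrite sg0 mul0r eq_sym oner_eq0.
  rewrite x_eq0 //; apply: P_axis.
  have : Num.max `|x s| `|y s| < d by apply: box; case/andP: sT => /ltW.
  by rewrite gt_max => /andP[_ /ltW/dlt[]].
(* As [y' = -2 x^3], [y] is constant on [[0, T / 2]]; at time 0 this uses that the orbit starts on
   the [y]-axis. Yet [y] would fall from [y0 > 0] to 0. *)
have T20 : 0 <= T / 2 by rewrite divr_ge0 // ltW.
have [c cT] := mean_value T20 (fun s _ => yd s).
rewrite y_eq0; last by rewrite divr_gt0 //=; lra.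
have -> : x c = 0.
  move: cT; rewrite in_itv /= => /andP[c0 cT].
  have [->//|cn0] := eqVneq c 0; apply: x_eq0.
  by rewrite lt_neqAle eq_sym cn0 c0 /=; lra.
by rewrite y0E expr0n /= !mulr0 mul0r; lra.
Qed.
End NotCenter.

(** * Primitives, parity and divisibility of polynomials *)

Section PolynomialFacts.
Context {R : realType}.
Implicit Types p q : {poly R}.

Definition primitive_poly p : {poly R} :=
  \poly_(i < (size p).+1) (p`_i.-1 / i%:R).

Lemma deriv_primitive_poly p : (primitive_poly p)^`() = p.
Proof.
apply/polyP => i; rewrite coef_deriv coef_poly ltnS.
case: ltnP => [_|pi]; last by rewrite mul0rn nth_default.
by rewrite /= -[LHS]mulr_natr divfK // pnatr_eq0.
Qed.

Lemma primitive_poly0 p : (primitive_poly p)`_0 = 0.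
Proof. by rewrite coef_poly /= invr0 mulr0. Qed.

(* b = true for even polynomials, b = false for odd ones. *)
Definition has_parity (b : bool) p := p \Po (- 'X) = (if b then p else - p).

Lemma has_parityM b c p q : has_parity b p -> has_parity c q ->
  has_parity (b == c) (p * q).
Proof.
by rewrite /has_parity comp_polyM => -> ->; case: b; case: c => /=;
  rewrite ?mulrNN ?mulrN ?mulNr.
Qed.

Lemma has_parityD b p q : has_parity b p -> has_parity b q -> has_parity b (p + q).
Proof. by rewrite /has_parity comp_polyD => -> ->; case: b; rewrite ?opprD. Qed.

Lemma has_parityZ b a p : has_parity b p -> has_parity b (a *: p).
Proof. by rewrite /has_parity comp_polyZ => ->; case: b; rewrite ?scalerN. Qed.

Lemma has_parity_deriv b p : has_parity b p -> has_parity (~~ b) p^`().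
Proof.
rewrite /has_parity => pE; have := congr1 (@deriv R) pE.
rewrite deriv_comp derivN derivX mulrN1; case: b {pE} => /= pE.
  by rewrite -{2}pE opprK.
by apply: oppr_inj; rewrite pE derivN.
Qed.

Lemma has_parityXn n : has_parity (~~ odd n) ('X^n : {poly R}).
Proof.
rewrite /has_parity comp_Xn_poly exprNn -signr_odd.
by case: odd; rewrite ?mul1r // mulN1r.
Qed.

Lemma has_parity1 a : has_parity true (a%:P : {poly R}).
Proof. by rewrite /has_parity comp_polyC. Qed.

Lemma has_parity_exp p n : has_parity true p -> has_parity true (p ^+ n).
Proof.
move=> pp; elim: n => [|n IHn]; first exact: has_parity1.
by rewrite exprS; have := has_parityM pp IHn.
Qed.

Lemma odd_poly_at0 p : has_parity false p -> p.[0] = 0.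
Proof.
rewrite /has_parity => /(congr1 (horner^~ 0)).
rewrite horner_comp !hornerE oppr0 => e; lra.
Qed.

Lemma dvdp_exp_deriv q n p : q ^+ n.+1 %| p -> q ^+ n %| p^`().
Proof.
move=> /dvdpP[r ->]; rewrite derivM deriv_exp dvdp_add //=.
  by rewrite exprS !dvdp_mull.
by rewrite dvdp_mull // -mulr_natl dvdp_mull // dvdp_mull.
Qed.

Lemma has_parityMn b n p : has_parity b p -> has_parity b (p *+ n).
Proof. by move=> pp; rewrite -scaler_nat; exact: has_parityZ. Qed.

Lemma has_parityN b p : has_parity b p -> has_parity b (- p).
Proof. by move=> pp; rewrite -scaleN1r; exact: has_parityZ. Qed.

Lemma has_parity_cancel b c p q : p != 0 -> has_parity b p ->
  has_parity c (p * q) -> has_parity (b == c) q.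
Proof.
rewrite /has_parity comp_polyM => p0 -> e; apply: (mulfI p0).
case: b e => /=; case: c => /= e; rewrite ?mulrN //; apply: oppr_inj.
  by rewrite opprK -e mulNr.
by rewrite -e mulNr.
Qed.
End PolynomialFacts.

(** * The recursion for the coefficients of [h] *)

Section Construction.
Context {R : realType}.
Variables a30 a21 a12 a03 a50 a41 a32 a23 a14 a05 : R.
Let X := cubic_quintic_field a30 a21 a12 a03 a50 a41 a32 a23 a14 a05.

Definition qpoly : {poly R} := 1%:P + a03 *: 'X^2 + a05 *: 'X^4.

Definition Pcoef (j : nat) : {poly R} :=
  nth 0 [:: 'X * qpoly; a12 *: 'X^2 + a14 *: 'X^4; a21 *: 'X + a23 *: 'X^3;
            a30%:P + a32 *: 'X^2; a41 *: 'X; a50%:P] j.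

Definition Ppoly : {poly {poly R}} := \sum_(j < 6) 'X^j * (Pcoef j)%:P.

Lemma XE p : X p = (ev2 Ppoly p.1 p.2, - 2 * p.1 ^+ 3).
Proof.
rewrite /X /cubic_quintic_field; congr pair.
rewrite /Ppoly !big_ord_recl big_ord0 /Pcoef /= !ev2E /qpoly.
rewrite !(hornerD, hornerM, hornerZ, hornerXn, hornerX, hornerC) /=.
ring.
Qed.

(** The coefficient of [x^3] in [h'] is [4 y q K_4 - 2 phi']; with [K_4 = q^21] it vanishes for this
    choice, and [phi] begins with [y^2] because [q(0) = 1]. *)
Definition phi : {poly R} := primitive_poly (2 *: ('X * qpoly ^+ 22)).

Definition hpoly (K : nat -> {poly R}) (N : nat) : {poly {poly R}} :=
  \poly_(i < N.+1) K i.

Definition defect (h : {poly {poly R}}) : {poly {poly R}} :=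
  Ppoly * h^`() - 2%:R * 'X^3 * map_poly (@deriv R) h.

(** This is the coefficient of [x^(n+4)] in [h'] without the contribution of row [n + 5], the one to
    be determined. *)
Definition lower_terms (K : nat -> {poly R}) (n : nat) : {poly R} :=
  \sum_(j < 5) (Pcoef j.+1 * K (n + 4 - j)%N) *+ (n + 4 - j) - 2 *: (K n.+1)^`().

Definition top_terms (K : nat -> {poly R}) (n : nat) : {poly R} :=
  (Pcoef 0 * K (n + 5)%N) *+ (n + 5) + lower_terms K n.

Lemma coef_defect h k : (defect h)`_k =
  \sum_(j < 6) (if (k < j)%N then 0 else (Pcoef j * h`_(k - j).+1) *+ (k - j).+1)
  - (if (k < 3)%N then 0 else 2 *: (h`_(k - 3))^`()).
Proof.
rewrite /defect coefB /Ppoly mulr_suml coef_sum; congr (_ - _).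
  apply: eq_bigr => j _; rewrite -mulrA coefXnM; case: ifP => // _.
  by rewrite coefCM coef_deriv mulrnAr.
rewrite -mulrA -polyC_natr coefCM coefXnM; case: ifP => _; first by rewrite mulr0.
by rewrite coef_map /= mulr_natl scaler_nat.
Qed.

Lemma coef_hpoly K N i : (hpoly K N)`_i = if (i <= N)%N then K i else 0.
Proof. by rewrite coef_poly ltnS. Qed.

(** The divisibility reserves one factor [q] for each step up to [N = 25]; row 0 is exempt, as [phi]
    need not be divisible by [q]. The parity reflects the symmetry of the field under
    [(x, y) -> (-x, -y)]. *)
Definition solves_to (N : nat) (K : nat -> {poly R}) :=
  [/\ K 0%N = phi, forall i, (0 < i < 4)%N -> K i = 0, K 4%N = qpoly ^+ 21,
      forall n, (n + 5 <= N)%N -> top_terms K n = 0 &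
      forall i, (0 < i <= N)%N ->
        qpoly ^+ (25 - i) %| K i /\ has_parity (~~ odd i) (K i)].

Lemma defect_low N K k : solves_to N K -> (4 <= N)%N -> (k < N)%N ->
  (defect (hpoly K N))`_k = 0.
Proof.
move=> [K0 Klt4 K4 Ktop _] N4 kN; rewrite coef_defect.
have hK i : (i <= N)%N -> (hpoly K N)`_i = K i by rewrite coef_hpoly => ->.
have [k4|k4] := ltnP k 4.
  rewrite big_ord_recl /= subn0 hK // big1 ?addr0; last first.
    move=> j _; case: ifP => // /negbT; rewrite -leqNgt => jk.
    rewrite hK ?Klt4 ?mulr0 ?mul0rn //; first by rewrite /= /bump /= in jk *; lia.
    by rewrite /= /bump /= in jk *; lia.
  case: ltnP => [k3|k3].
    by rewrite Klt4 ?mulr0 ?mul0rn ?subr0.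
  have -> : k = 3%N by lia.
  rewrite subnn hK // K0 K4 /phi deriv_primitive_poly /Pcoef /=.
  by rewrite -mulrA -exprS -scaler_nat scalerA -natrM subrr.
have kE : k = (k - 4 + 4)%N by lia.
set n := (k - 4)%N in kE.
transitivity (top_terms K n); last by apply: Ktop; lia.
rewrite kE /top_terms /lower_terms addrA.
rewrite ltnNge (_ : 3 <= n + 4)%N /=; last by lia.
congr (_ - 2 *: _^`()); last first.
  by rewrite (_ : (n + 4 - 3)%N = n.+1) ?hK //; lia.
rewrite big_ord_recl /= subn0 hK; last by lia.
congr (_ + _); first by rewrite -addnS.
apply: eq_bigr => j _; rewrite /bump /= add1n.
have j5 := ltn_ord j.
case: ltnP => [nj|nj].
  have -> : (n + 4 - j = 0)%N by lia.
  by rewrite mulr0n.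
rewrite hK; last by lia.
by rewrite (_ : (n + 4 - j.+1).+1 = n + 4 - j)%N //; lia.
Qed.

(** Truncation at [N] removes exactly the term of row [N + 1], which was to cancel [lower_terms]. *)
Lemma defect_top N K n : solves_to N K -> N = (n + 4)%N ->
  (defect (hpoly K N))`_N = lower_terms K n.
Proof.
move=> _ NE; rewrite coef_defect NE.
have hK i : (i <= N)%N -> (hpoly K N)`_i = K i by rewrite coef_hpoly => ->.
rewrite big_ord_recl /= subn0 [(hpoly K (n + 4))`_(n + 4).+1]coef_hpoly.
rewrite ltnn mulr0 mul0rn add0r.
rewrite ltnNge (_ : 3 <= n + 4)%N /=; last by lia.
congr (_ - 2 *: _^`()); last first.
  by rewrite (_ : (n + 4 - 3)%N = n.+1) -?NE ?hK //; lia.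
apply: eq_bigr => j _; rewrite /bump /= add1n.
have j5 := ltn_ord j.
case: ltnP => [nj|nj].
  have -> : (n + 4 - j = 0)%N by lia.
  by rewrite mulr0n.
rewrite -NE hK; last by lia.
by rewrite NE (_ : (n + 4 - j.+1).+1 = n + 4 - j)%N //; lia.
Qed.

Lemma has_parity_qpoly : has_parity true qpoly.
Proof.
rewrite /qpoly; apply: has_parityD; first apply: has_parityD.
- exact: has_parity1.
- by apply: has_parityZ; exact: (has_parityXn 2).
- by apply: has_parityZ; exact: (has_parityXn 4).
Qed.

Lemma has_parityX : has_parity false ('X : {poly R}).
Proof. by rewrite /has_parity comp_polyX. Qed.

Lemma has_parity_Pcoef j : (j < 6)%N -> has_parity (odd j) (Pcoef j).
Proof.
have X2 := has_parityXn (R := R) 2; have X3 := has_parityXn (R := R) 3.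
have X4 := has_parityXn (R := R) 4; have X1 := has_parityX.
move: j => [|[|[|[|[|[|//]]]]]] _; rewrite /Pcoef /=.
- exact: (has_parityM X1 has_parity_qpoly).
- by apply: has_parityD; exact: has_parityZ.
- by apply: has_parityD; exact: has_parityZ.
- by apply: has_parityD; [exact: has_parity1 | exact: has_parityZ].
- exact: has_parityZ.
- exact: has_parity1.
Qed.

Lemma has_parity_lower_terms N K n : solves_to N K -> N = (n + 4)%N ->
  has_parity (odd n.+1) (lower_terms K n).
Proof.
move=> [K0 Klt4 K4 _ Kd] NE.
have h0 b : has_parity b (0 : {poly R}).
  by rewrite /has_parity comp_poly0; case: b; rewrite ?oppr0.
apply: has_parityD; last first.
  apply/has_parityN/has_parityZ; have := @Kd n.+1.
  rewrite NE; case=> [|_ /has_parity_deriv]; first by lia.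
  by rewrite /= !negbK.
apply: (big_ind (has_parity (odd n.+1))) => [//|p q|j _]; first exact: has_parityD.
have j5 := ltn_ord j.
have [->|nj] := posnP (n + 4 - j)%N; first by rewrite mulr0n.
apply: has_parityMn.
have [|_ pK] := Kd (n + 4 - j)%N; first by lia.
have := has_parityM (@has_parity_Pcoef j.+1 _) pK.
rewrite ltnS j5 oddB; last by lia.
rewrite oddD /= addbF => /(_ isT).
by case: odd; case: odd.
Qed.

(** Differentiating row [n + 1] costs one factor [q], but this row lies three below [N] and has
    factors to spare. *)
Lemma dvdp_lower_terms N K n : solves_to N K -> N = (n + 4)%N -> (N < 25)%N ->
  qpoly ^+ (25 - N) %| lower_terms K n.
Proof.
move=> [K0 Klt4 K4 _ Kd] NE N25.
have Kdvd i : (0 < i <= N)%N -> qpoly ^+ (25 - N) %| K i.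
  move=> /[dup] /andP[_ iN] /Kd[+ _]; apply: dvdp_trans.
  by apply: dvdp_exp2l; lia.
apply: dvdp_sub; last first.
  rewrite dvdpZr ?pnatr_eq0 //; apply: dvdp_exp_deriv.
  case: (@Kd n.+1) => [|+ _]; first by lia.
  by apply: dvdp_trans; apply: dvdp_exp2l; lia.
apply: (big_ind (fun p => qpoly ^+ (25 - N) %| p)) => [|p q|j _].
- exact: dvdp0.
- exact: dvdp_add.
have j5 := ltn_ord j.
have [->|nj] := posnP (n + 4 - j)%N; first by rewrite mulr0n dvdp0.
by rewrite -scaler_nat dvdpZr ?pnatr_eq0 -?lt0n // dvdp_mull // Kdvd //; lia.
Qed.

Lemma qpoly_at0 : qpoly.[0] = 1.
Proof.
rewrite /qpoly !(hornerD, hornerZ, hornerXn, hornerC) !expr0n /=.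
by rewrite !mulr0 !addr0.
Qed.

Lemma Ppoly_axis y : ev2 Ppoly 0 y = y * qpoly.[y].
Proof.
rewrite /Ppoly !big_ord_recl big_ord0 /Pcoef /= !ev2E hornerM hornerX !expr0n /=.
by rewrite horner0 !mul0r !addr0 mul1r.
Qed.

(** For odd [n] parity suffices. For even [n] this value is [G(0, 0)] in [h' = x^N G], with [N] even
    and [h = y^2 phi2 + x^4 B], where [phi2] and [B] are 1 at the origin; [not_center] applies
    unless it vanishes. *)
Lemma lower_terms_at0 N K n : is_center X (0, 0) -> solves_to N K ->
  N = (n + 4)%N -> (lower_terms K n).[0] = 0.
Proof.
move=> Xc sK NE.
have [on|en] := boolP (odd n).
  by apply: odd_poly_at0; have := has_parity_lower_terms sK NE; rewrite /= on.
apply/eqP/negPn/negP => t0.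
have [K0 Klt4 K4 _ Kd] := sK.
pose h := hpoly K N.
pose phi2 : {poly R} := drop_poly 2 phi.
have phi0 : phi`_0 = 0 by exact: primitive_poly0.
have dphi i : phi`_i.+1 *+ i.+1 = (2 *: ('X * qpoly ^+ 22))`_i.
  by rewrite -coef_deriv /phi deriv_primitive_poly.
have phi1 : phi`_1 = 0.
  by have := dphi 0%N; rewrite mulr1n coefZ coefXM /= mulr0.
have phi2E : phi`_2 = 1.
  have := dphi 1%N; rewrite coefZ coefXM /= -horner_coef0 horner_exp qpoly_at0.
  by rewrite expr1n; lra.
have phiE : phi = 'X^2 * phi2.
  apply/polyP => i; rewrite coefXnM; case: ltnP => [|i2].
    by case: i => [|[|]].
  by rewrite coef_drop_poly subnK.
pose B : {poly {poly R}} := \poly_(i < n.+1) K (i + 4)%N.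
have hE : h = ('X ^+ 2)%:P * phi2%:P + 'X^4 * B.
  rewrite -polyCM -phiE; apply/polyP => i.
  rewrite coefD coefC coefXnM coef_hpoly coef_poly.
  case: ltnP => [i4|i4].
    case: i i4 => [|i] i4; first by rewrite K0 addr0.
    by rewrite Klt4 ?addr0 ?if_same.
  rewrite gtn_eqF ?add0r; last by lia.
  rewrite subnK // NE; congr (if _ then _ else _); lia.
have hG : defect h = 'X^N * drop_poly N (defect h).
  apply/polyP => i; rewrite coefXnM; case: ltnP => iN.
    by rewrite (defect_low sK) // NE; lia.
  by rewrite coef_drop_poly subnK.
have G0 : ev2 (drop_poly N (defect h)) 0 0 != 0.
  by rewrite /ev2 polyC0 (horner_coef0 (drop_poly _ _)) coef_drop_poly add0n (defect_top sK NE).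
have [r r0 rq] : exists2 r : R, 0 < r & forall x y, `|x| < r -> `|y| < r ->
    0 < ev2 qpoly%:P x y.
  by apply: ev2_near00; rewrite ev2C qpoly_at0.
apply: (not_center XE hG _ G0 hE _ _ r0 _ Xc).
- by rewrite NE oddD addbF.
- by rewrite ev2C horner_coef0 coef_drop_poly add0n phi2E.
- by rewrite /ev2 polyC0 (horner_coef0 B) coef_poly /= K4 horner_exp qpoly_at0 expr1n.
- move=> y yr /eqP; rewrite Ppoly_axis mulf_eq0 => /orP[/eqP //|].
  have := rq 0 y; rewrite normr0 ev2C => /(_ r0 yr) qy.
  by rewrite gt_eqF.
Qed.

Lemma lower_terms_ext K K' n : (forall i, (i <= n + 4)%N -> K' i = K i) ->
  lower_terms K' n = lower_terms K n.
Proof.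
move=> KK; rewrite /lower_terms KK; last by lia.
by congr (_ - _); apply: eq_bigr => j _; rewrite KK //; lia.
Qed.

(** [lower_terms] is divisible by [q^(25 - N)] and, vanishing at 0, by [y]. Since [q(0) = 1] the
    factor [y] falls on the cofactor, and division by [y q] leaves [q^(24 - N)]. *)
Lemma solves_to_step N K : is_center X (0, 0) -> (4 <= N < 25)%N ->
  solves_to N K -> exists K', solves_to N.+1 K'.
Proof.
move=> Xc /andP[N4 N25] sK; have [K0 Klt4 K4 Ktop Kd] := sK.
pose n := (N - 4)%N; have NE : N = (n + 4)%N by rewrite /n; lia.
have /dvdpP[V VE] := dvdp_lower_terms sK NE N25.
have /factor_theorem[U UE] : root V 0.
  have := lower_terms_at0 Xc sK NE; rewrite VE hornerM horner_exp qpoly_at0.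
  by rewrite expr1n mulr1 /root => ->.
rewrite subr0 in UE.
pose L := - (n + 5)%:R^-1 *: (U * qpoly ^+ (24 - N)).
pose K' i := if i == N.+1 then L else K i.
have K'K i : (i <= N)%N -> K' i = K i by rewrite /K' => iN; rewrite ltn_eqF.
have qL : 'X * qpoly * L = - (n + 5)%:R^-1 *: lower_terms K n.
  rewrite VE UE /L -scalerAr (_ : 25 - N = (24 - N).+1)%N; last by lia.
  by rewrite exprS; congr (_ *: _); ring.
have q0 : 'X * qpoly != 0 :> {poly R}.
  rewrite mulf_neq0 ?polyX_eq0 //; apply/eqP => /(congr1 (horner^~ 0)).
  by rewrite qpoly_at0 horner0 => /eqP; rewrite oner_eq0.
exists K'; split.
- by rewrite K'K.
- by move=> i i4; rewrite K'K ?Klt4 //; lia.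
- by rewrite K'K.
- move=> m mN; have [mE|mE] := eqVneq (m + 5)%N N.+1.
    have -> : m = n by lia.
    rewrite /top_terms (@lower_terms_ext K); last by move=> i; rewrite -NE; exact: K'K.
    rewrite /K' (_ : (n + 5)%N = N.+1) ?eqxx; last by lia.
    rewrite /Pcoef /= qL scaleNr -scaler_nat scalerN scalerA.
    rewrite (_ : (n + 5)%N = N.+1); last by lia.
    by rewrite divff ?pnatr_eq0 // scale1r addNr.
  rewrite /top_terms (@lower_terms_ext K); last by move=> i im; apply: K'K; lia.
  by rewrite K'K; [apply: Ktop; lia | lia].
- move=> i /andP[i0 iN]; have [->|iE] := eqVneq i N.+1; last first.
    rewrite K'K; last by lia.
    have [|dK pK] := Kd i; first by lia.
    by split.
  rewrite /K' eqxx; split.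
    by rewrite subSS /L dvdpZr ?dvdp_mulIr // oppr_eq0 invr_eq0 pnatr_eq0; lia.
  have pq : has_parity false ('X * qpoly : {poly R}).
    exact: (has_parityM has_parityX has_parity_qpoly).
  have := has_parity_cancel q0 pq (c := odd n.+1) (q := L).
  rewrite qL => /(_ (has_parityZ _ (has_parity_lower_terms sK NE))).
  by rewrite NE /= oddD /= addbF negbK; case: odd.
Qed.

Lemma solves_to4 : solves_to 4 (fun i => if i == 0%N then phi else
  if i == 4%N then qpoly ^+ 21 else 0).
Proof.
split=> //.
- by move=> [|[|[|[|]]]].
- by move=> n; lia.
- have h0 b : has_parity b (0 : {poly R}).
    by rewrite /has_parity comp_poly0; case: b; rewrite ?oppr0.
  case=> [|[|[|[|[|//]]]]] //= _; split;
    by [exact: dvdp0 | exact: h0 | exact: dvdpp | exact: has_parity_exp has_parity_qpoly].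
Qed.

Lemma center_solves : is_center X (0, 0) -> exists K, solves_to 25 K.
Proof.
move=> Xc; suff H i : (i <= 21)%N -> exists K, solves_to (i + 4) K by exact: (H 21%N).
elim: i => [_|i IHi i21]; first by exists (fun i => if i == 0%N then phi else
  if i == 4%N then qpoly ^+ 21 else 0); exact: solves_to4.
by have [K sK] := IHi (ltnW i21); apply: (solves_to_step Xc _ sK); lia.
Qed.

(* The coefficients of r = q^21 are read off q r' = 21 q' r. *)
Lemma coef_qpoly_exp i : (i < 5)%N ->
  (qpoly ^+ 21)`_i.*2 = nth 0 (q21_coefs a03 a05) i.
Proof.
set r := qpoly ^+ 21.
have qr : qpoly * r^`() = 21%:R *: (qpoly^`() * r).
  by rewrite /r deriv_exp -scaler_nat -scalerAr /= [in RHS]exprS mulrCA.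
have qM (p : {poly R}) t : (qpoly * p)`_t = p`_t
    + a03 * (if (t < 2)%N then 0 else p`_(t - 2))
    + a05 * (if (t < 4)%N then 0 else p`_(t - 4)).
  by rewrite /qpoly !mulrDl !coefD mul1r -!scalerAl !coefZ !coefXnM.
have qE : qpoly^`() = (2 * a03) *: 'X^1 + (4 * a05) *: 'X^3.
  rewrite /qpoly !derivD !derivZ !derivXn derivC add0r.
  by rewrite -!scalerMnr !scalerMnl !mulr_natl.
have rt t : r`_t.+1 *+ t.+1
    + a03 * (if (t < 2)%N then 0 else r`_(t - 2).+1 *+ (t - 2).+1)
    + a05 * (if (t < 4)%N then 0 else r`_(t - 4).+1 *+ (t - 4).+1)
    = 21 * (2 * a03 * (if (t < 1)%N then 0 else r`_(t - 1))
            + 4 * a05 * (if (t < 3)%N then 0 else r`_(t - 3))).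
  have := congr1 (fun p : {poly R} => p`_t) qr.
  rewrite qM qE mulrDl -!scalerAl coefZ coefD !coefZ !coefXnM !coef_deriv => ->.
  by rewrite /GRing.scale /= !mulrA.
have r0 : r`_0 = 1.
  by rewrite -horner_coef0 /r horner_exp qpoly_at0 expr1n.
have r2 := rt 1%N; have r4 := rt 3%N; have r6 := rt 5%N; have r8 := rt 7%N.
have r2E : r`_2 = 21 * a03 by move: r2; rewrite /= !subSS !subn0 r0 => r2; lra.
have r4E : r`_4 = 210 * a03 ^+ 2 + 21 * a05.
  by move: r4; rewrite /= !subSS !subn0 r0 r2E => r4; lra.
have r6E : r`_6 = 1330 * a03 ^+ 3 + 420 * a03 * a05.
  by move: r6; rewrite /= !subSS !subn0 r4E r2E => r6; lra.
have r8E : r`_8 = (3 * 1995) * a03 ^+ 4 + 3990 * a03 ^+ 2 * a05 + 210 * a05 ^+ 2.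
  by move: r8; rewrite /= !subSS !subn0 r6E r4E => r8; lra.
by case: i => [|[|[|[|[|//]]]]].
Qed.

Lemma center_coefs : is_center X (0, 0) ->
  [/\ a30 = 0, a12 = 0, a32 = 0, a14 = 0 & a50 = 0].
Proof.
move=> /center_solves[K [K0 Klt4 K4 Ktop _]].
(* Row 0 is replaced by 0, as the table expects; it enters the recursion only with the factor
   [n = 0]. *)
pose k n t := if (n < 4)%N then 0 else (K n)`_t.
have kE n t : (0 < n)%N -> k n t = (K n)`_t.
  rewrite /k => n0; case: ltnP => // n4.
  by rewrite (_ : K n = 0) ?coef0 //; apply: Klt4; rewrite n0.
pose sh s (p : {poly R}) t := ('X^s * p)`_t.
have shE s m t : (0 < m)%N -> sh s (K m) t = shift_seq s (k m) t.
  by move=> m0; rewrite /sh coefXnM shift_seqE; case: ifP => // _; rewrite kE.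
have P0 p t : (Pcoef 0 * p)`_t = sh 1%N p t + a03 * sh 3%N p t + a05 * sh 5%N p t.
  rewrite /Pcoef /= /qpoly !mulrDr mulr1 -!scalerAr -!exprS !mulrDl -!scalerAl.
  by rewrite !coefD !coefZ.
have P1 p t : (Pcoef 1 * p)`_t = a12 * sh 2%N p t + a14 * sh 4%N p t.
  by rewrite /Pcoef /= !mulrDl -!scalerAl !coefD !coefZ.
have P2 p t : (Pcoef 2 * p)`_t = a21 * sh 1%N p t + a23 * sh 3%N p t.
  by rewrite /Pcoef /= !mulrDl -!scalerAl !coefD !coefZ.
have P3 p t : (Pcoef 3 * p)`_t = a30 * p`_t + a32 * sh 2%N p t.
  by rewrite /Pcoef /= !mulrDl -!scalerAl !coefD coefCM !coefZ.
have P4 p t : (Pcoef 4 * p)`_t = a41 * sh 1%N p t.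
  by rewrite /Pcoef /= -!scalerAl !coefZ.
have P5 p t : (Pcoef 5 * p)`_t = a50 * p`_t by rewrite /Pcoef /= coefCM.
apply: (@obstructions_vanish _ a30 a21 a12 a03 a50 a41 a32 a23 a14 a05 k).
- move=> n t n20.
  have n25 : (n + 5 <= 25)%N by lia.
  have := congr1 (fun p : {poly R} => p`_t) (Ktop n n25).
  rewrite coef0 => e; rewrite -[RHS]e {e} /top_terms /lower_terms.
  rewrite !big_ord_recl big_ord0 /= /bump /= !add1n addr0.
  rewrite (_ : n + 5 = n.+4.+1)%N; last by lia.
  rewrite (_ : n + 4 - 0 = n.+4)%N; last by lia.
  rewrite (_ : n + 4 - 1 = n.+3)%N; last by lia.
  rewrite (_ : n + 4 - 2 = n.+2)%N; last by lia.
  rewrite (_ : n + 4 - 3 = n.+1)%N; last by lia.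
  rewrite (_ : n + 4 - 4 = n)%N; last by lia.
  have cMn (p : {poly R}) m i : (p *+ m)`_i = m%:R * p`_i by rewrite coefMn mulr_natl.
  have cderiv (p : {poly R}) i : (p^`())`_i = i.+1%:R * p`_i.+1.
    by rewrite coef_deriv mulr_natl.
  rewrite !(cMn, coefN, coefZ, cderiv, coefD) P0 P1 P2 P3 P4 P5.
  rewrite !shE // /first_integral_coef (kE n.+2) // (kE n.+1) //.
  have -> : n%:R * (a50 * k n t) = n%:R * (a50 * (K n)`_t).
    by case: n {n20 n25} => [|n]; rewrite ?mul0r // kE.
  ring.
- by move=> n t n4; rewrite /k n4.
- by move=> i i5; rewrite kE // K4 coef_qpoly_exp.
Qed.
End Construction.

(** * Double power series *)

Section GeometricSequences.
Context {R : realType}.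
Implicit Types (u : nat -> R) (C : R).

Lemma half_pow_gt0 n : 0 < 2^-1 ^+ n :> R.
Proof. by rewrite exprn_gt0 // invr_gt0. Qed.

Lemma half_powS n : 2^-1 ^+ n.+1 = 2^-1 ^+ n / 2 :> R.
Proof. by rewrite exprSr. Qed.

Lemma sum_half_pow N : \sum_(i < N) 2^-1 ^+ i <= 2 :> R.
Proof.
suff : \sum_(i < N) 2^-1 ^+ i = 2 - 2 * 2^-1 ^+ N :> R.
  by move=> ->; have := half_pow_gt0 N; lra.
elim: N => [|N IHN]; first by rewrite big_ord0 expr0; ring.
by rewrite big_ord_recr /= IHN half_powS; field.
Qed.

Lemma cvg_half_pow C : C * 2^-1 ^+ n @[n --> \oo] --> 0.
Proof.
rewrite -(mulr0 C); apply: cvgMr; apply: cvg_expr.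
by rewrite ger0_norm ?invr_ge0 // invf_lt1 // ltr1n.
Qed.

Lemma cvg_half_bound u l C : (forall n, `|u n - l| <= C * 2^-1 ^+ n) ->
  u @ \oo --> l.
Proof.
move=> uC.
have hl : l - C * 2^-1 ^+ n @[n --> \oo] --> l.
  by rewrite -[X in _ --> X]subr0; exact: cvgB (cvg_cst l) (cvg_half_pow C).
have hr : l + C * 2^-1 ^+ n @[n --> \oo] --> l.
  by rewrite -[X in _ --> X]addr0; exact: cvgD (cvg_cst l) (cvg_half_pow C).
apply: (squeeze_cvgr _ hl hr); apply: nearW => n.
by have := uC n; rewrite ler_norml => /andP[? ?]; apply/andP; split; lra.
Qed.

(** The sequences [u n + 2 C 2^-n] and [u n - 2 C 2^-n] are monotone in opposite directions and
    enclose the limit. *)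
Lemma geometric_cvg u C : (forall n, `|u n.+1 - u n| <= C * 2^-1 ^+ n) ->
  exists l, forall n, `|u n - l| <= 2 * C * 2^-1 ^+ n.
Proof.
move=> uC.
have h0 := half_pow_gt0.
pose v n := u n + 2 * C * 2^-1 ^+ n; pose w n := u n - 2 * C * 2^-1 ^+ n.
have vd n : v n.+1 <= v n.
  by have := uC n; rewrite ler_norml /v half_powS => /andP[_ ?]; lra.
have wi n : w n <= w n.+1.
  by have := uC n; rewrite ler_norml /w half_powS => /andP[? _]; lra.
have C0 : 0 <= C.
  by have := le_trans (normr_ge0 _) (uC 0%N); rewrite expr0 mulr1.
have wv n : w n <= v n by rewrite /w /v; have := mulr_ge0 C0 (ltW (h0 n)); lra.
have vdec : nonincreasing_seq v by apply/nonincreasing_seqP.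
have winc : nondecreasing_seq w by apply/nondecreasing_seqP.
have vcvg : cvgn v.
  apply: nonincreasing_is_cvgn => //; exists (w 0%N) => _ [n _ <-].
  by apply: le_trans (wv n); exact: winc.
exists (limn v) => n.
have lv : limn v <= v n by exact: nonincreasing_cvgn_ge.
have lw : w n <= limn v.
  apply: limr_ge => //; near=> m; apply: le_trans (wv m); apply: winc.
  by near: m; exact: nbhs_infty_ge.
by rewrite ler_norml; move: lv lw; rewrite /v /w => ? ?; apply/andP; split; lra.
Unshelve. all: by end_near.
Qed.
End GeometricSequences.

(** * Double series with a geometric bound *)

Section DoubleSeries.
Context {R : realType}.
Implicit Types (a b : nat -> nat -> R) (C : R).

Definition dsum a (N : nat) : R := \sum_(i < N) \sum_(j < N) a i j.

Definition dlim a : R := limn (dsum a).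

(** With the ratio fixed at [1/2] in both indices, all estimates on sums and remainders concern the
    constant [C] alone. *)
Definition dgeometric a C := forall i j, `|a i j| <= C * 2^-1 ^+ (i + j).

Lemma sum_row_half C i N (f : nat -> R) :
  (forall j, `|f j| <= C * 2^-1 ^+ (i + j)) -> `|\sum_(j < N) f j| <= 2 * C * 2^-1 ^+ i.
Proof.
move=> fC; have C0 : 0 <= C * 2^-1 ^+ i.
  by have := le_trans (normr_ge0 _) (fC 0%N); rewrite addn0.
apply: le_trans (ler_norm_sum _ _ _) _.
apply: (@le_trans _ _ (\sum_(j < N) C * 2^-1 ^+ i * 2^-1 ^+ j)).
  by apply: ler_sum => j _; rewrite -mulrA -exprD.
rewrite -mulr_sumr.
by apply: le_trans (ler_wpM2l C0 (sum_half_pow N)) _; lra.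
Qed.

Lemma dgeometric_ge0 a C : dgeometric a C -> 0 <= C.
Proof.
by move=> /(_ 0 0)%N /(le_trans (normr_ge0 _)); rewrite expr0 mulr1.
Qed.

Lemma dsum_le a C N : dgeometric a C -> `|dsum a N| <= 4 * C.
Proof.
move=> aC; have := @sum_row_half (2 * C) 0 N (fun i => \sum_(j < N) a i j).
rewrite expr0 mulr1 mulrA -natrM; apply => i; rewrite add0n.
exact: sum_row_half (aC i).
Qed.

Lemma dsumS a N : dsum a N.+1 =
  dsum a N + \sum_(i < N.+1) a i N + \sum_(j < N) a N j.
Proof.
rewrite /dsum big_ord_recr /= !big_ord_recr /=.
under eq_bigr do rewrite big_ord_recr /=.
by rewrite big_split /=; ring.
Qed.

(** The next square adds two edges, each of sum at most [2 C 2^-n]. *)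
Lemma dsum_dlim a C N : dgeometric a C -> `|dsum a N - dlim a| <= 8 * C * 2^-1 ^+ N.
Proof.
move=> aC.
have [n|l lE] := @geometric_cvg R (dsum a) (4 * C).
  have -> : dsum a n.+1 - dsum a n = \sum_(i < n.+1) a i n + \sum_(j < n) a n j.
    by rewrite dsumS; ring.
  have r1 : `|\sum_(i < n.+1) a i n| <= 2 * C * 2^-1 ^+ n.
    by apply: (@sum_row_half C n n.+1 (fun i => a i n)) => i; rewrite addnC.
  have r2 : `|\sum_(j < n) a n j| <= 2 * C * 2^-1 ^+ n by exact: sum_row_half.
  by apply: le_trans (ler_normD _ _) _; lra.
have -> : dlim a = l by apply: cvg_lim => //; exact: cvg_half_bound lE.
by have := lE N; rewrite !mulrA -natrM.
Qed.

Lemma dsum_cvg a C : dgeometric a C -> dsum a @ \oo --> dlim a.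
Proof. by move=> aC; apply: cvg_half_bound => n; exact: dsum_dlim. Qed.

Lemma dlim_le a C : dgeometric a C -> `|dlim a| <= 4 * C.
Proof.
move=> aC; have ac := cvgP _ (dsum_cvg aC).
rewrite ler_norml; apply/andP; split.
  by apply: limr_ge => //; apply: nearW => n; have := dsum_le n aC; rewrite ler_norml => /andP[].
by apply: limr_le => //; apply: nearW => n; have := dsum_le n aC; rewrite ler_norml => /andP[].
Qed.

Lemma dlim_unique a l C : (forall N, `|dsum a N - l| <= C * 2^-1 ^+ N) -> dlim a = l.
Proof. by move=> h; apply: cvg_lim => //; exact: cvg_half_bound h. Qed.

Lemma dlimD a b C C' : dgeometric a C -> dgeometric b C' ->
  dlim (fun i j => a i j + b i j) = dlim a + dlim b.
Proof.
move=> aC bC; apply: cvg_lim => //.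
rewrite (_ : dsum _ = (fun n => dsum a n + dsum b n)).
  exact: cvgD (dsum_cvg aC) (dsum_cvg bC).
apply/funext => n; rewrite /dsum -big_split; apply: eq_bigr => i _.
by rewrite -big_split.
Qed.

Lemma dlimZ a C k : dgeometric a C -> dlim (fun i j => k * a i j) = k * dlim a.
Proof.
move=> aC; apply: cvg_lim => //.
rewrite (_ : dsum _ = (fun n => k * dsum a n)).
  exact: cvgMr (dsum_cvg aC).
apply/funext => n; rewrite /dsum mulr_sumr; apply: eq_bigr => i _.
by rewrite mulr_sumr.
Qed.

Lemma dgeometricD a b C C' : dgeometric a C -> dgeometric b C' ->
  dgeometric (fun i j => a i j + b i j) (C + C').
Proof.
by move=> aC bC i j; rewrite mulrDl; apply: le_trans (ler_normD _ _) _; rewrite lerD.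
Qed.

Lemma dgeometricZ a C k : dgeometric a C -> dgeometric (fun i j => k * a i j) (`|k| * C).
Proof. by move=> aC i j; rewrite normrM -mulrA ler_wpM2l. Qed.

(** On the terms of a power series, multiplication by a variable is this shift up to a scalar
    factor; the shifts keep the sum. *)
Definition dshift1 a i j := if i is i'.+1 then a i' j else 0.
Definition dshift2 a i j := if j is j'.+1 then a i j' else 0.

Lemma dgeometric_shift1 a C : dgeometric a C -> dgeometric (dshift1 a) (2 * C).
Proof.
move=> aC [|i] j /=.
  by rewrite normr0 mulr_ge0 ?(ltW (half_pow_gt0 _)) // mulr_ge0 // (dgeometric_ge0 aC).
by have := aC i j; rewrite addSn half_powS; lra.
Qed.

Lemma dgeometric_shift2 a C : dgeometric a C -> dgeometric (dshift2 a) (2 * C).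
Proof.
move=> aC i [|j] /=.
  by rewrite normr0 mulr_ge0 ?(ltW (half_pow_gt0 _)) // mulr_ge0 // (dgeometric_ge0 aC).
by have := aC i j; rewrite addnS half_powS; lra.
Qed.

Lemma dlim_tr a C : dgeometric a C -> dlim (fun i j => a j i) = dlim a.
Proof.
move=> aC; apply: (@dlim_unique _ _ (8 * C)) => N.
by rewrite /dsum exchange_big; exact: dsum_dlim.
Qed.

(** The partial sums differ by a single row, which tends to 0. *)
Lemma dlim_shift1 a C : dgeometric a C -> dlim (dshift1 a) = dlim a.
Proof.
move=> aC; apply: (@dlim_unique _ _ (20 * C)) => N.
have h0 := half_pow_gt0 (R := R) N; have C0 := dgeometric_ge0 aC.
have Ch := mulr_ge0 C0 (ltW h0).
case: N h0 Ch => [|N] h0 Ch.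
  rewrite /dsum big_ord0 sub0r normrN expr0 mulr1.
  by have := dlim_le aC; lra.
have -> : dsum (dshift1 a) N.+1 = dsum a N.+1 - \sum_(j < N.+1) a N j.
  rewrite /dsum big_ord_recl big1 ?add0r //.
  by rewrite [X in _ = X - _]big_ord_recr /= addrK.
have r2 : `|\sum_(j < N.+1) a N j| <= 2 * C * 2^-1 ^+ N by exact: sum_row_half.
have := dsum_dlim N.+1 aC; move: r2; rewrite half_powS in h0 Ch *.
rewrite !ler_norml => /andP[? ?] /andP[? ?].
by apply/andP; split; lra.
Qed.

Lemma dlim_shift2 a C : dgeometric a C -> dlim (dshift2 a) = dlim a.
Proof.
move=> aC; have aC' : dgeometric (fun i j => a j i) C by move=> i j; rewrite addnC.
rewrite -(dlim_tr aC) -(dlim_shift1 aC') -(dlim_tr (dgeometric_shift1 aC')).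
by congr (limn (dsum _)); apply/funext => i; apply/funext => -[|j].
Qed.

Lemma nneseries_le_bound (f : nat -> R) (B : R) : (forall i, 0 <= f i) ->
  (forall n, \sum_(i < n) f i <= B) -> (\sum_(i <oo) (f i)%:E <= B%:E)%E.
Proof.
move=> f0 fB; apply: lime_le.
  by apply: is_cvg_nneseries => n _ _; rewrite lee_fin.
by apply: nearW => n; rewrite sumEFin lee_fin big_mkord.
Qed.

Lemma dgeometric_summable a C : dgeometric a C ->
  summable [set: nat * nat] (fun k => (a k.1 k.2)%:E).
Proof.
move=> aC; have C0 := dgeometric_ge0 aC.
rewrite /summable.
have -> : [set: nat * nat] = [set: nat] `*`` (fun=> [set: nat]).
  by apply/seteqP; split=> -[i j].
rewrite -(@esum_esum _ _ _ _ _ (fun i j => `|(a i j)%:E|%E)) //.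
rewrite -nneseries_esumT; last by move=> i; exact: esum_ge0.
apply: (@le_lt_trans _ _ (\sum_(i <oo) (2 * C * 2^-1 ^+ i)%:E)%E).
  apply: lee_nneseries => [i _ _|i _]; first exact: esum_ge0.
  rewrite -nneseries_esumT //; apply: nneseries_le_bound => // n.
  have := @sum_row_half C i n (fun j => `|a i j|).
  rewrite ger0_norm ?sumr_ge0 //; apply => j.
  by rewrite normr_id.
apply: (@le_lt_trans _ _ (4 * C)%:E); last exact: ltry.
have h0 i := ltW (half_pow_gt0 (R := R) i).
apply: nneseries_le_bound => [i|n]; first by rewrite !mulr_ge0.
rewrite -mulr_sumr; have := @sum_half_pow R n.
by move=> /(ler_wpM2l (mulr_ge0 (ler0n R 2) C0)); lra.
Qed.
End DoubleSeries.

(** * Re-expansion of a double power series at a nearby point *)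

Section Reexpansion.
Context {R : realType}.
Variables (c : nat -> nat -> R) (rho r0 : R).
Hypothesis rho0 : 0 < rho.
Hypothesis c_le : forall k l, `|c k l| <= rho ^+ (k + l).
Hypothesis r0_gt0 : 0 < r0.
Hypothesis r0_small : 4 * rho * r0 <= 1.

Definition double_sum (x y : R) : R := dlim (fun k l => c k l * x ^+ k * y ^+ l).

(* The coefficient of x^m in (p + x)^k. *)
Definition binom_coef (k m : nat) (p : R) : R := 'C(k, m)%:R * p ^+ (k - m).

Definition shifted_terms (p q : R) (m n : nat) : nat -> nat -> R :=
  fun k l => c k l * binom_coef k m p * binom_coef l n q.

(** These are the Taylor coefficients at [(p, q)]; the indices [(1, 0)] and [(0, 1)] give the
    partial derivatives. *)
Definition shifted_coef (p q : R) (m n : nat) : R := dlim (shifted_terms p q m n).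

Lemma half_pow_bound (t : R) n : 0 <= t -> 2 * t <= 1 -> t ^+ n <= 2^-1 ^+ n.
Proof. by move=> t0 t1; apply: lerXn2r; rewrite ?nnegrE ?invr_ge0 //; lra. Qed.

Lemma double_sum_geometric x y : `|x| <= 2 * r0 -> `|y| <= 2 * r0 ->
  dgeometric (fun k l => c k l * x ^+ k * y ^+ l) 1.
Proof.
move=> xr yr k l; rewrite mul1r !normrM !normrX.
apply: (@le_trans _ _ (rho ^+ (k + l) * (2 * r0) ^+ k * (2 * r0) ^+ l)).
  have r2 : 0 <= 2 * r0 by rewrite mulr_ge0 // ltW.
  apply: ler_pM; rewrite ?mulr_ge0 ?exprn_ge0 //; last first.
    by apply: lerXn2r; rewrite ?nnegrE.
  apply: ler_pM; rewrite ?exprn_ge0 //.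
  by apply: lerXn2r; rewrite ?nnegrE.
rewrite -mulrA -exprD -exprMn; apply: half_pow_bound.
  by rewrite !mulr_ge0 // ltW.
by move: r0_small; lra.
Qed.

Lemma bin_le_exp2 k m : ('C(k, m) <= 2 ^ k)%N.
Proof.
elim: k m => [|k IHk] [|m] //; first by rewrite bin0 expn_gt0.
by rewrite binS expnS mul2n -addnn leq_add.
Qed.

(** Bounding the binomial coefficient by [2^k] leaves a factor [2 r0] per degree, which
    [4 rho r0 <= 1] turns into the ratio [1/2] against the growth of [c]. *)
Lemma binom_coef_bound k m p : `|p| <= r0 ->
  `|binom_coef k m p| <= (2 * r0) ^+ k / r0 ^+ m.
Proof.
move=> pr; rewrite /binom_coef; have [mk|km] := leqP m k; last first.
  by rewrite bin_small // mul0r normr0 divr_ge0 ?exprn_ge0 ?mulr_ge0 // ltW.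
rewrite normrM normrX ger0_norm // exprMn -mulrA.
have -> : r0 ^+ k / r0 ^+ m = r0 ^+ (k - m).
  by rewrite -{1}(subnK mk) exprD mulfK // expf_neq0 ?gt_eqF.
apply: ler_pM => //; rewrite ?exprn_ge0 //.
  by rewrite -natrX ler_nat bin_le_exp2.
by apply: lerXn2r; rewrite ?nnegrE // ltW.
Qed.

Lemma shifted_terms_geometric p q m n : `|p| <= r0 -> `|q| <= r0 ->
  dgeometric (shifted_terms p q m n) (r0 ^+ (m + n))^-1.
Proof.
move=> pr qr k l; rewrite /shifted_terms 2!normrM.
apply: (@le_trans _ _ (rho ^+ (k + l) * ((2 * r0) ^+ k / r0 ^+ m) * ((2 * r0) ^+ l / r0 ^+ n))).
  have b1 := binom_coef_bound k m pr; have b2 := binom_coef_bound l n qr.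
  apply: (ler_pM _ _ _ b2) => //.
  exact: (ler_pM _ _ (c_le k l) b1).
have -> : rho ^+ (k + l) * ((2 * r0) ^+ k / r0 ^+ m) * ((2 * r0) ^+ l / r0 ^+ n) =
    (r0 ^+ (m + n))^-1 * (rho * (2 * r0)) ^+ (k + l).
  by rewrite !exprD invfM !exprMn; ring.
rewrite ler_pM2l ?invr_gt0 ?exprn_gt0 //; apply: half_pow_bound.
  by rewrite !mulr_ge0 // ltW.
by move: r0_small; lra.
Qed.

Lemma shifted_coef_le p q m n : `|p| <= r0 -> `|q| <= r0 ->
  `|shifted_coef p q m n| <= 4 / r0 ^+ (m + n).
Proof. by move=> pr qr; exact: dlim_le (shifted_terms_geometric m n pr qr). Qed.

Lemma shifted_coef_geometric p q x y : `|p| <= r0 -> `|q| <= r0 ->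
  2 * `|x| <= r0 -> 2 * `|y| <= r0 ->
  dgeometric (fun m n => shifted_coef p q m n * x ^+ m * y ^+ n) 4.
Proof.
move=> pr qr xr yr m n; rewrite !normrM !normrX.
have r0n : r0 != 0 by rewrite gt_eqF.
have hr z i : 2 * `|z| <= r0 -> `|z| ^+ i <= r0 ^+ i * 2^-1 ^+ i.
  move=> zr; rewrite -exprMn; apply: lerXn2r; rewrite ?nnegrE //.
    by rewrite mulr_ge0 ?invr_ge0 // ltW.
  by lra.
apply: (@le_trans _ _ (4 / r0 ^+ (m + n) * (r0 ^+ m * 2^-1 ^+ m) * (r0 ^+ n * 2^-1 ^+ n))).
  apply: ler_pM; rewrite ?mulr_ge0 ?exprn_ge0 //; last exact: hr.
  by apply: ler_pM; rewrite ?exprn_ge0 //; [exact: shifted_coef_le | exact: hr].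
rewrite le_eqVlt; apply/orP; left; apply/eqP; rewrite !exprD.
by field; rewrite !expf_neq0.
Qed.

Lemma binomial_expansion k N p x : (k < N)%N ->
  (p + x) ^+ k = \sum_(m < N) binom_coef k m p * x ^+ m.
Proof.
move=> kN; rewrite exprDn (big_ord_widen N (fun m => p ^+ (k - m) * x ^+ m *+ 'C(k, m))) //.
rewrite big_mkcond; apply: eq_bigr => m _; rewrite /binom_coef ltnS.
case: leqP => [mk|km]; last by rewrite bin_small // !mul0r.
by rewrite -mulr_natl mulrA.
Qed.

(** Infinite sums are not interchanged: a square partial sum of the original series is a finite sum
    of binomial terms, and replacing all its inner partial sums by their limits costs at most
    [32 * 2^-N]. *)
Lemma reexpansion p q x y : `|p| <= r0 -> `|q| <= r0 ->
  2 * `|x| <= r0 -> 2 * `|y| <= r0 ->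
  double_sum (p + x) (q + y) = dlim (fun m n => shifted_coef p q m n * x ^+ m * y ^+ n).
Proof.
move=> pr qr xr yr.
have r0n : r0 != 0 by rewrite gt_eqF.
have pxr : `|p + x| <= 2 * r0.
  by apply: le_trans (ler_normD _ _) _; have := normr_ge0 x; lra.
have qyr : `|q + y| <= 2 * r0.
  by apply: le_trans (ler_normD _ _) _; have := normr_ge0 y; lra.
have g1 := double_sum_geometric pxr qyr.
apply/esym/(@dlim_unique _ _ _ 64) => N.
have h0 := half_pow_gt0 (R := R) N.
pose S := dsum (fun k l => c k l * (p + x) ^+ k * (q + y) ^+ l) N.
have SE : S = \sum_(m < N) \sum_(n < N)
    dsum (shifted_terms p q m n) N * x ^+ m * y ^+ n.
  rewrite /S /dsum.
  transitivity (\sum_(k < N) \sum_(l < N) \sum_(m < N) \sum_(n < N)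
      shifted_terms p q m n k l * x ^+ m * y ^+ n).
    apply: eq_bigr => k _; apply: eq_bigr => l _.
    rewrite (binomial_expansion p x (ltn_ord k)) (binomial_expansion q y (ltn_ord l)).
    rewrite -mulrA mulr_suml mulr_sumr; apply: eq_bigr => m _.
    rewrite mulr_sumr mulr_sumr; apply: eq_bigr => n _.
    by rewrite /shifted_terms; ring.
  under eq_bigr => k _ do rewrite exchange_big.
  rewrite exchange_big; apply: eq_bigr => m _.
  under eq_bigr => k _ do rewrite exchange_big.
  rewrite exchange_big; apply: eq_bigr => n _.
  rewrite !mulr_suml; apply: eq_bigr => k _.
  by rewrite !mulr_suml.
have d1 : `|S - double_sum (p + x) (q + y)| <= 8 * 2^-1 ^+ N.
  by have := dsum_dlim N g1; rewrite mulr1.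
have d2 : `|dsum (fun m n => shifted_coef p q m n * x ^+ m * y ^+ n) N - S|
    <= 32 * 2^-1 ^+ N.
  rewrite SE /dsum -sumrB.
  under eq_bigr do rewrite -sumrB.
  pose b m n := (shifted_coef p q m n - dsum (shifted_terms p q m n) N) * x ^+ m * y ^+ n.
  have bg : dgeometric b (8 * 2^-1 ^+ N).
    move=> m n; rewrite /b !normrM !normrX.
    have hr z i : 2 * `|z| <= r0 -> `|z| ^+ i <= r0 ^+ i * 2^-1 ^+ i.
      move=> zr; rewrite -exprMn; apply: lerXn2r; rewrite ?nnegrE //.
        by rewrite mulr_ge0 ?invr_ge0 // ltW.
      by lra.
    apply: (@le_trans _ _ (8 * (r0 ^+ (m + n))^-1 * 2^-1 ^+ N
        * (r0 ^+ m * 2^-1 ^+ m) * (r0 ^+ n * 2^-1 ^+ n))).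
      apply: ler_pM; rewrite ?mulr_ge0 ?exprn_ge0 //; last exact: hr.
      apply: ler_pM; rewrite ?exprn_ge0 //; last exact: hr.
      by rewrite distrC; exact: dsum_dlim (shifted_terms_geometric m n pr qr).
    rewrite le_eqVlt; apply/orP; left; apply/eqP; rewrite !exprD.
    by field; rewrite !expf_neq0.
  have := dsum_le N bg.
  rewrite (_ : dsum b N = \sum_(i < N) \sum_(j < N) (shifted_coef p q i j * x ^+ i * y ^+ j -
      dsum (shifted_terms p q i j) N * x ^+ i * y ^+ j)).
    by move/le_trans; apply; lra.
  by apply: eq_bigr => m _; apply: eq_bigr => n _; rewrite /b; ring.
rewrite -(subrK S (dsum _ N)) -addrA.
by apply: le_trans (ler_normD _ _) _; lra.
Qed.

Lemma double_sum_analytic p q : `|p| < r0 -> `|q| < r0 ->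
  analytic_at (fun z : R * R => double_sum z.1 z.2) (p, q).
Proof.
move=> pr qr; exists (shifted_coef p q), (r0 / 2); split; first by rewrite divr_gt0.
move=> x y xr yr.
have x2 : 2 * `|x| <= r0 by lra.
have y2 : 2 * `|y| <= r0 by lra.
have g := shifted_coef_geometric (ltW pr) (ltW qr) x2 y2.
split; first exact: dgeometric_summable g.
rewrite /= (reexpansion (ltW pr) (ltW qr) x2 y2).
exact: dsum_cvg g.
Qed.

(** Every term with [m + n >= 2] contains the factor [(s / r0)^2], and what remains is still
    geometric. This quadratic remainder yields both the chain rule and continuity. *)
Lemma double_sum_taylor p q x y s : `|p| <= r0 -> `|q| <= r0 ->
  `|x| <= s -> `|y| <= s -> 4 * s <= r0 ->
  `|double_sum (p + x) (q + y) - double_sum p q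
    - shifted_coef p q 1 0 * x - shifted_coef p q 0 1 * y| <= 256 * (s / r0) ^+ 2.
Proof.
move=> pr qr xs ys sr.
have r0n : r0 != 0 by rewrite gt_eqF.
have s0 : 0 <= s := le_trans (normr_ge0 _) xs.
have x2 : 2 * `|x| <= r0 by lra.
have y2 : 2 * `|y| <= r0 by lra.
pose t := s / r0; have t0 : 0 <= t by rewrite divr_ge0 // ltW.
have t4 : 4 * t <= 1 by rewrite mulrA ler_pdivrMr // mul1r.
pose a m n := shifted_coef p q m n * x ^+ m * y ^+ n.
have ag : dgeometric a 4 := shifted_coef_geometric pr qr x2 y2.
pose e m n := if (m + n < 2)%N then a m n else 0.
pose b m n := if (m + n < 2)%N then 0 else a m n.
have eg : dgeometric e 4.
  move=> m n; rewrite /e; case: ifP => // _.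
  by rewrite normr0 mulr_ge0 // ltW // half_pow_gt0.
have bg : dgeometric b (64 * t ^+ 2).
  move=> m n; rewrite /b; case: ltnP => [_|mn].
    by rewrite normr0 mulr_ge0 ?(ltW (half_pow_gt0 _)) // mulr_ge0 // exprn_ge0.
  rewrite /a 2!normrM !normrX.
  apply: (@le_trans _ _ (4 / r0 ^+ (m + n) * s ^+ m * s ^+ n)).
    have hx : `|x| ^+ m <= s ^+ m by apply: lerXn2r; rewrite ?nnegrE.
    have hy : `|y| ^+ n <= s ^+ n by apply: lerXn2r; rewrite ?nnegrE.
    apply: (ler_pM _ _ _ hy); rewrite ?mulr_ge0 ?exprn_ge0 //.
    apply: (ler_pM _ _ _ hx); rewrite ?exprn_ge0 //.
    exact: shifted_coef_le.
  rewrite -mulrA -exprD -mulrA [_^-1 * _]mulrC -expr_div_n -/t.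
  rewrite -(subnK mn) !exprD -mulrA.
  have tq : t ^+ (m + n - 2) <= 2^-1 ^+ (m + n - 2) by apply: half_pow_bound => //; lra.
  have h0 := half_pow_gt0 (R := R) (m + n - 2).
  have t2 : 0 <= t ^+ 2 by rewrite exprn_ge0.
  rewrite [t ^+ _ * _]mulrC.
  have : t ^+ 2 * t ^+ (m + n - 2) <= t ^+ 2 * 2^-1 ^+ (m + n - 2) by rewrite ler_wpM2l.
  have : 0 <= t ^+ 2 * 2^-1 ^+ (m + n - 2) by rewrite mulr_ge0 // ltW.
  set u := t ^+ 2 * _; set v := t ^+ 2 * _ => u0 uv.
  rewrite (_ : 64 * _ = 16 * u); first by lra.
  by rewrite /u; field.
have aE : double_sum (p + x) (q + y) = dlim b + dlim e.
  rewrite (reexpansion pr qr x2 y2) -(dlimD bg eg); congr dlim.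
  by apply/funext => m; apply/funext => n; rewrite /b /e -/(a m n);
    case: ifP; rewrite ?add0r ?addr0.
have eE : dlim e = double_sum p q + shifted_coef p q 1 0 * x + shifted_coef p q 0 1 * y.
  apply: cvg_lim => //; rewrite -(cvg_shiftn 2).
  rewrite (_ : [sequence _]_n = cst (double_sum p q + shifted_coef p q 1 0 * x
      + shifted_coef p q 0 1 * y)); first exact: cvg_cst.
  apply/funext => n /=; rewrite addn2 /dsum.
  have row0 : \sum_(j < n.+2) e 0%N j = a 0%N 0%N + a 0%N 1%N.
    by rewrite !big_ord_recl big1 ?addr0.
  have row1 : \sum_(j < n.+2) e 1%N j = a 1%N 0%N.
    by rewrite big_ord_recl big1 ?addr0.
  rewrite 2!big_ord_recl row0 row1 big1 ?addr0; last first.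
    by move=> i _; apply: big1 => j _.
  rewrite /a !expr0 !expr1 !mulr1.
  have -> : shifted_coef p q 0 0 = double_sum p q.
    congr dlim; apply/funext => k; apply/funext => l.
    by rewrite /shifted_terms /binom_coef !bin0 !subn0 !mul1r.
  by ring.
rewrite aE eE (_ : _ - _ - _ - _ = dlim b); last by ring.
by apply: le_trans (dlim_le bg) _; rewrite mulrA -natrM.
Qed.

Lemma is_derive_double_sum (x y : R -> R) (t dx dy : R) :
  is_derive t 1 x dx -> is_derive t 1 y dy -> `|x t| <= r0 -> `|y t| <= r0 ->
  is_derive t 1 (fun s => double_sum (x s) (y s))
    (shifted_coef (x t) (y t) 1 0 * dx + shifted_coef (x t) (y t) 0 1 * dy).
Proof.
move=> [xd xE] [yd yE] xr yr.
set A := shifted_coef _ _ 1 0; set B := shifted_coef _ _ 0 1.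
pose Dx (h : R) := x (h + t) - x t; pose Dy (h : R) := y (h + t) - y t.
have cx : h^-1 * Dx h @[h --> 0^'] --> dx.
  rewrite -xE; have := xd; rewrite /derivable /derive.
  rewrite (_ : (fun h => h^-1 *: _) = (fun h : R => h^-1 * Dx h)) //.
  by apply/funext => h; rewrite /Dx /= [h *: 1]mulr1.
have cy : h^-1 * Dy h @[h --> 0^'] --> dy.
  rewrite -yE; have := yd; rewrite /derivable /derive.
  rewrite (_ : (fun h => h^-1 *: _) = (fun h : R => h^-1 * Dy h)) //.
  by apply/funext => h; rewrite /Dy /= [h *: 1]mulr1.
have ch : (h : R) @[h --> (0 : R)^'] --> (0 : R) by exact: nbhs_dnbhs.
have nD (f : R -> R) (l : R) : h^-1 * f h @[h --> (0 : R)^'] --> l -> f h @[h --> (0 : R)^'] --> (0 : R).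
  move=> fl; have fl0 : h * (h^-1 * f h) @[h --> (0 : R)^'] --> (0 : R).
    by rewrite -[X in _ --> X](mul0r l); exact: (cvgM ch fl).
  suff e : \forall h \near (0 : R)^', h * (h^-1 * f h) = f h.
    exact: (cvg_trans (near_eq_cvg e) fl0).
  near=> h; have h0 : h != 0 by near: h; exact: nbhs_dnbhs_neq.
  by rewrite mulVKf.
have cDx := nD _ _ cx; have cDy := nD _ _ cy.
pose S (h : R) := `|Dx h| + `|Dy h|.
have cS : S h @[h --> (0 : R)^'] --> (0 : R).
  have e0 : (0 : R) = `|0 : R| + `|0 : R| by rewrite normr0 addr0.
  by rewrite [X in _ --> X]e0; apply: cvgD; exact: cvg_norm.
(* The quadratic remainder divided by [|h|]: one factor [S] tends to 0, and the other one over [|h|]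
   converges. *)
pose err (h : R) := 256 / r0 ^+ 2 * (S h * (`|h^-1 * Dx h| + `|h^-1 * Dy h|)).
have cerr : err h @[h --> (0 : R)^'] --> (0 : R).
  rewrite -[X in _ --> X](mulr0 (256 / r0 ^+ 2)); apply: cvgMr.
  rewrite -[X in _ --> X](mul0r (`|dx| + `|dy|)); apply: cvgM => //.
  by apply: cvgD; exact: cvg_norm.
pose q (h : R) := h^-1 * (double_sum (x (h + t)) (y (h + t)) - double_sum (x t) (y t)).
pose E (h : R) := q h - A * (h^-1 * Dx h) - B * (h^-1 * Dy h).
have cE : E h @[h --> (0 : R)^'] --> (0 : R).
  have cNerr : - err h @[h --> (0 : R)^'] --> (0 : R).
    by rewrite -[X in _ --> X]oppr0; exact: cvgN.
  apply: (squeeze_cvgr _ cNerr cerr); near=> h.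
  have h0 : h != 0 by near: h; exact: nbhs_dnbhs_neq.
  have Sr : 4 * S h <= r0.
    rewrite -ler_pdivlMl //; near: h; apply: (cvgr_le _ cS).
    by rewrite mulr_gt0 ?invr_gt0.
  have DxS : `|Dx h| <= S h by rewrite lerDl.
  have DyS : `|Dy h| <= S h by rewrite lerDr.
  have := double_sum_taylor xr yr DxS DyS Sr.
  rewrite (_ : x t + Dx h = x (h + t)); last by rewrite /Dx addrC subrK.
  rewrite (_ : y t + Dy h = y (h + t)); last by rewrite /Dy addrC subrK.
  rewrite -ler_norml => le.
  have -> : E h = h^-1 * (double_sum (x (h + t)) (y (h + t)) - double_sum (x t) (y t)
      - A * Dx h - B * Dy h) by rewrite /E /q; ring.
  rewrite normrM; apply: (le_trans (ler_wpM2l (normr_ge0 _) le)).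
  rewrite /err !normrM -mulrDr -/(S h) le_eqVlt; apply/orP; left; apply/eqP.
  have r0n : r0 != 0 by rewrite gt_eqF.
  by rewrite exprMn; field.
have cq : q h @[h --> (0 : R)^'] --> A * dx + B * dy.
  have -> : q = (fun h => E h + (A * (h^-1 * Dx h) + B * (h^-1 * Dy h))).
    by apply/funext => h; rewrite /E; ring.
  rewrite -[X in _ --> X]add0r; apply: (cvgD cE); apply: cvgD; exact: cvgMr.
have qE : (fun h => h^-1 *: (((fun s => double_sum (x s) (y s)) \o shift t) (h *: (1:R))
    - double_sum (x t) (y t))) = q.
  by apply/funext => h; rewrite /q /= [h *: 1]mulr1.
split; first by rewrite /derivable qE; apply/cvg_ex; eexists; exact: cq.
by rewrite /derive qE; exact: cvg_lim cq.
Unshelve. all: by end_near.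
Qed.
End Reexpansion.

(** * The formal first integral and its growth *)

Section FirstIntegral.
Context {R : realType}.
Variables f10 f01 f20 f11 f02 : R.

Definition Ffun (u v : R) : R :=
  1 + f10 * u + f01 * v + f20 * u ^+ 2 + f11 * u * v + f02 * v ^+ 2.

Section NextRow.
Variables (i : nat) (r r' : nat -> R).

(** With [r] and [r'] the rows [i] and [i - 1], this collects the known rows in the coefficient of
    [u^i v^j] of [F h_u = 2 u h_v], solved for row [i + 1]. *)
Definition int_row_base (j : nat) : R :=
  (2 * j.+1%:R * r' j.+1 - f10 * i%:R * r j - f20 * i.-1%:R * r' j
   - f11 * i%:R * (if j is j'.+1 then r j' else 0)) / i.+1%:R.

(** The terms in [f01] and [f02] refer one and two places back in the row under construction;
    carrying the previous value makes the recursion structural. *)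
Fixpoint next_row2 (j : nat) : R * R :=
  if j is j'.+1 then
    (int_row_base j - f01 * (next_row2 j').1 - f02 * (next_row2 j').2, (next_row2 j').1)
  else (int_row_base 0, 0).

Definition next_row j := (next_row2 j).1.

Lemma next_rowE j : next_row j = int_row_base j
  - f01 * (if j is j1.+1 then next_row j1 else 0)
  - f02 * (if j is j2.+2 then next_row j2 else 0).
Proof. by case: j => [|[|j]]; rewrite /next_row /= ?mulr0 ?subr0. Qed.
End NextRow.

Fixpoint int_rows (i : nat) : (nat -> R) * (nat -> R) :=
  if i is i'.+1 then
    (next_row i' (int_rows i').1 (int_rows i').2, (int_rows i').1)
  else (fun j => (j == 1%N)%:R, fun=> 0).

(* The power series h with h(0, v) = v and F h_u = 2 u h_v. *)
Definition int_coef (i j : nat) : R := (int_rows i).1 j.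

Definition int_coef_u (i j : nat) : R := i.+1%:R * int_coef i.+1 j.
Definition int_coef_v (i j : nat) : R := j.+1%:R * int_coef i j.+1.

Lemma int_coef_rec i j :
  int_coef_u i j + f10 * dshift1 int_coef_u i j + f01 * dshift2 int_coef_u i j
  + f20 * dshift1 (dshift1 int_coef_u) i j + f11 * dshift1 (dshift2 int_coef_u) i j
  + f02 * dshift2 (dshift2 int_coef_u) i j = 2 * dshift1 int_coef_v i j.
Proof.
have i1 k : k.+1%:R != 0 :> R by rewrite pnatr_eq0.
rewrite {1}/int_coef_u {1}/int_coef /= next_rowE -/(int_coef _).
have -> : (int_rows i).2 = (if i is i'.+1 then int_coef i' else fun=> 0) by case: i.
rewrite /int_row_base !mulrBr mulrC divfK //.
have -> : i.+1%:R * (f01 * (if j is j1.+1 then next_row i (int_rows i).1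
    (if i is i'.+1 then int_coef i' else fun=> 0) j1 else 0)) =
    f01 * dshift2 int_coef_u i j.
  case: j => [|j] /=; first by rewrite !mulr0.
  by rewrite /int_coef_u /int_coef /= mulrCA; case: i.
have -> : i.+1%:R * (f02 * (if j is j2.+2 then next_row i (int_rows i).1
    (if i is i'.+1 then int_coef i' else fun=> 0) j2 else 0)) =
    f02 * dshift2 (dshift2 int_coef_u) i j.
  case: j => [|[|j]] /=; rewrite ?mulr0 //.
  by rewrite /int_coef_u /int_coef /= mulrCA; case: i.
case: i => [|i] /=; first by case: j => [|[|j]] /=; ring.
rewrite -/(int_coef i.+1) /int_coef_u /int_coef_v.
by case: i => [|i]; case: j => [|[|j]] /=; ring.
Qed.

Definition int_base : R := 2 + `|f10| + `|f01| + `|f20| + `|f11| + `|f02|.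
Let S := int_base.

Lemma int_base_ge2 : 2 <= S.
Proof.
rewrite /S /int_base; move: (normr_ge0 f10) (normr_ge0 f01) (normr_ge0 f20).
by move: (normr_ge0 f11) (normr_ge0 f02); lra.
Qed.

(** These are the coefficients of the majorant [1 / (1 - S (u + v))]. A purely geometric bound would
    not absorb the factor [j + 1] coming from [h_v]; the binomial turns it into a factor in the
    first index, which the division by [i + 1] cancels. *)
Definition int_bound (i j : nat) : R := 'C(i + j, i)%:R * S ^+ (i + j).

Let S0 : 0 < S. Proof. by have := int_base_ge2; lra. Qed.
Let S1 : 1 <= S. Proof. by have := int_base_ge2; lra. Qed.

Lemma int_bound_ge0 i j : 0 <= int_bound i j.
Proof. by rewrite mulr_ge0 ?exprn_ge0 // ltW. Qed.

Lemma int_boundS1 i j : S * int_bound i j <= int_bound i.+1 j.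
Proof.
rewrite /int_bound mulrCA addSn exprS; apply: ler_wpM2r.
  by rewrite mulr_ge0 ?exprn_ge0 // ltW.
by rewrite ler_nat binS leq_addl.
Qed.

Lemma int_boundS2 i j : S * int_bound i j <= int_bound i j.+1.
Proof.
rewrite /int_bound mulrCA addnS exprS; apply: ler_wpM2r.
  by rewrite mulr_ge0 ?exprn_ge0 // ltW.
by rewrite ler_nat; case: i => [|i]; rewrite ?bin0 // binS leq_addr.
Qed.

Lemma int_bound_exchange i j : j.+1%:R * int_bound i j.+1 = i.+1%:R * int_bound i.+1 j.
Proof.
rewrite /int_bound addSnnS !mulrA -!natrM; congr (_%:R * _).
have := mul_bin_left (i + j.+1) i.
by rewrite addKn => <-.
Qed.

(** Each term of the recursion is at most [M = int_bound i.+1 j / S] times the absolute value of its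
    constant, and [S] is the sum of these: 2 and the five [|f|]. *)
Lemma int_coef_bound i j : `|int_coef i j| <= int_bound i j.
Proof.
suff H i0 : (forall j, `|int_coef i0 j| <= int_bound i0 j) /\
    (forall j, `|(int_rows i0).2 j| <= if i0 is i'.+1 then int_bound i' j else 0).
  by have [] := H i.
elim: i0 {i j} => [|i [IH1 IH2]].
  split=> j /=; last by rewrite normr0.
  rewrite /int_coef /= /int_bound add0n bin0 mul1r.
  case: eqP => _; last by rewrite normr0 exprn_ge0 // ltW.
  by rewrite normr1; elim: j => [|j IHj]; rewrite ?expr0 // exprS; apply: mulr_ege1.
split; last exact: IH1.
pose r := (int_rows i).1; pose r' := (int_rows i).2.
have i1 : 0 < i.+1%:R :> R by rewrite ltr0n.
have bS x i' j' : S * x <= int_bound i' j' -> 0 <= x -> x <= int_bound i' j'.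
  by move=> h x0; apply: le_trans h; rewrite ler_peMl.
elim/ltn_ind => j IHj; rewrite -[X in `|X|]/(next_row i r r' j).
pose M := int_bound i.+1 j / S.
have SM : S * M = int_bound i.+1 j by rewrite /M mulrC divfK // gt_eqF.
have leM x : S * x <= int_bound i.+1 j -> x <= M by rewrite -SM ler_pM2l.
have M0 : 0 <= M by rewrite divr_ge0 ?int_bound_ge0 // ltW.
have rM : int_bound i j <= M by apply: leM; exact: int_boundS1.
have iM : 0 <= i%:R * M by rewrite mulr_ge0.
have iS : i.+1%:R = i%:R + 1 :> R by rewrite natr1.
have t1 : `|2 * j.+1%:R * r' j.+1| <= 2 * (i.+1%:R * M).
  rewrite -mulrA normrM ger0_norm // ler_pM2l // normrM ger0_norm //.
  apply: le_trans (ler_wpM2l (ler0n _ _) (IH2 _)) _.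
  case: (i) iM rM iS => [|i'] iM rM iS; first by rewrite mulr0 mulr_ge0.
  rewrite int_bound_exchange; apply: (@le_trans _ _ (i'.+1%:R * M)).
    by rewrite ler_wpM2l.
  by rewrite iS mulrDl; lra.
have t2 : `|f10 * i%:R * r j| <= `|f10| * (i.+1%:R * M).
  rewrite -mulrA normrM ler_wpM2l // normrM ger0_norm //.
  have : i%:R * `|r j| <= i%:R * M by rewrite ler_wpM2l // (le_trans (IH1 j)).
  by rewrite iS mulrDl; lra.
have t3 : `|f20 * i.-1%:R * r' j| <= `|f20| * (i.+1%:R * M).
  rewrite -mulrA normrM ler_wpM2l // normrM ger0_norm //.
  have r'M : `|r' j| <= M.
    apply: le_trans (IH2 j) _; case: (i) rM => [|i'] rM //.
    by apply: le_trans rM; apply: bS (int_boundS1 _ _) (int_bound_ge0 _ _).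
  apply: (@le_trans _ _ (i.-1%:R * M)); first by rewrite ler_wpM2l.
  by rewrite ler_wpM2r // ler_nat; lia.
have t4 : `|f11 * i%:R * (if j is j'.+1 then r j' else 0)| <= `|f11| * (i.+1%:R * M).
  rewrite -mulrA normrM ler_wpM2l // normrM ger0_norm //.
  have r'M : `|if j is j'.+1 then r j' else 0| <= M.
    case: (j) rM => [|j'] rM; first by rewrite normr0.
    apply: le_trans (IH1 j') _; apply: le_trans rM.
    by apply: bS (int_boundS2 _ _) (int_bound_ge0 _ _).
  have : i%:R * `|if j is j'.+1 then r j' else 0| <= i%:R * M by rewrite ler_wpM2l.
  by rewrite iS mulrDl; lra.
have tb : `|int_row_base i r r' j| <= (2 + `|f10| + `|f20| + `|f11|) * M.
  rewrite /int_row_base normrM normfV (ger0_norm (ltW i1)) ler_pdivrMr //.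
  rewrite (_ : _ * M * _ = (2 + `|f10| + `|f20| + `|f11|) * (i.+1%:R * M)); last by ring.
  move: t1 t2 t3 t4; rewrite !ler_norml => /andP[? ?] /andP[? ?] /andP[? ?] /andP[? ?].
  by apply/andP; split; lra.
have t5 : `|if j is j1.+1 then next_row i r r' j1 else 0| <= M.
  case: (j) leM M0 IHj => [|j1] leM M0 IHj; first by rewrite normr0.
  by apply: le_trans (IHj j1 _) _ => //; apply: leM; exact: int_boundS2.
have t6 : `|if j is j2.+2 then next_row i r r' j2 else 0| <= M.
  case: (j) leM M0 IHj => [|[|j2]] leM M0 IHj; rewrite ?normr0 //.
  apply: le_trans (IHj j2 _) _ => //; apply: leM.
  apply: le_trans (int_boundS2 _ _); rewrite ler_pM2l //.
  by apply: bS (int_boundS2 _ _) (int_bound_ge0 _ _).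
rewrite next_rowE -SM /S /int_base.
have u5 : `|f01 * (if j is j1.+1 then next_row i r r' j1 else 0)| <= `|f01| * M.
  by rewrite normrM ler_wpM2l.
have u6 : `|f02 * (if j is j2.+2 then next_row i r r' j2 else 0)| <= `|f02| * M.
  by rewrite normrM ler_wpM2l.
move: tb u5 u6; rewrite !ler_norml => /andP[? ?] /andP[? ?] /andP[? ?].
by apply/andP; split; lra.
Qed.

Lemma int_coef_le i j : `|int_coef i j| <= (2 * S) ^+ (i + j).
Proof.
apply: le_trans (int_coef_bound i j) _; rewrite exprMn; apply: ler_wpM2r.
  by rewrite exprn_ge0 // ltW.
by rewrite -natrX ler_nat bin_le_exp2.
Qed.
End FirstIntegral.

(** * The analytic first integral *)

Section FirstIntegralSum.
Context {R : realType}.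
Variables f10 f01 f20 f11 f02 : R.
Let F := Ffun f10 f01 f20 f11 f02.
Let h := int_coef f10 f01 f20 f11 f02.
Let S := int_base f10 f01 f20 f11 f02.

Definition int_rate : R := 2 * S.
Let rho := int_rate.
Definition int_radius : R := (4 * int_rate)^-1.
Let r0 := int_radius.

Lemma int_rate_ge4 : 4 <= rho.
Proof. by have := int_base_ge2 f10 f01 f20 f11 f02; rewrite /rho /int_rate -/S; lra. Qed.

Lemma int_rate_gt0 : 0 < rho. Proof. by have := int_rate_ge4; lra. Qed.
Let rho0 := int_rate_gt0.

Lemma int_radius_gt0 : 0 < r0.
Proof. by rewrite /r0 /int_radius invr_gt0 mulr_gt0. Qed.
Let r00 := int_radius_gt0.

Lemma int_radius_small : 4 * rho * r0 <= 1.
Proof. by rewrite /r0 /int_radius divff // gt_eqF // mulr_gt0. Qed.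

Lemma int_radius_le : 16 * r0 <= 1.
Proof.
apply: le_trans int_radius_small; rewrite ler_pM2r //.
by have := int_rate_ge4; lra.
Qed.

Let h_le k l : `|h k l| <= rho ^+ (k + l). Proof. exact: int_coef_le. Qed.

Lemma dgeometric_unshift1 (a : nat -> nat -> R) C : dgeometric (dshift1 a) C -> dgeometric a C.
Proof.
move=> aC i j; have C0 := dgeometric_ge0 aC.
apply: le_trans (aC i.+1 j) _; rewrite ler_wpM2l // addSn half_powS.
by have := half_pow_gt0 (R := R) (i + j); lra.
Qed.

Lemma dgeometric_unshift2 (a : nat -> nat -> R) C : dgeometric (dshift2 a) C -> dgeometric a C.
Proof.
move=> aC i j; have C0 := dgeometric_ge0 aC.
apply: le_trans (aC i j.+1) _; rewrite ler_wpM2l // addnS half_powS.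
by have := half_pow_gt0 (R := R) (i + j); lra.
Qed.

(** This is the recursion summed over all indices: multiplication by [u] or [v] becomes a shift,
    under which [dlim] is invariant. *)
Lemma first_integral_pde u v : `|u| <= r0 -> `|v| <= r0 ->
  F u v * shifted_coef h u v 1 0 = 2 * u * shifted_coef h u v 0 1.
Proof.
move=> ur vr.
pose A i j := int_coef_u f10 f01 f20 f11 f02 i j * u ^+ i * v ^+ j.
pose B i j := int_coef_v f10 f01 f20 f11 f02 i j * u ^+ i * v ^+ j.
have AE : shifted_terms h u v 1 0 = dshift1 A.
  apply/funext => -[|i]; apply/funext => j; rewrite /shifted_terms /binom_coef.
    by rewrite bin0n mul0r mulr0 mul0r.
  rewrite bin1 bin0 subn0 mul1r subSS subn0 /A /int_coef_u -/(h _ _) /=.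
  by rewrite /h; ring.
have BE : shifted_terms h u v 0 1 = dshift2 B.
  apply/funext => i; apply/funext => -[|j]; rewrite /shifted_terms /binom_coef.
    by rewrite bin0n mul0r mulr0.
  by rewrite bin1 bin0 subn0 mul1r subSS subn0 /B /int_coef_v /= /h; ring.
have gA' := shifted_terms_geometric rho0 h_le r00 int_radius_small 1 0 ur vr.
have gB' := shifted_terms_geometric rho0 h_le r00 int_radius_small 0 1 ur vr.
rewrite AE in gA'; rewrite BE in gB'.
have gA := dgeometric_unshift1 gA'; have gB := dgeometric_unshift2 gB'.
rewrite /shifted_coef AE BE (dlim_shift1 gA) (dlim_shift2 gB).
have gA1 := dgeometric_shift1 gA; have gA2 := dgeometric_shift2 gA.
have gA11 := dgeometric_shift1 gA1; have gA12 := dgeometric_shift1 gA2.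
have gA22 := dgeometric_shift2 gA2; have gB1 := dgeometric_shift1 gB.
have z1 := dgeometricZ (f10 * u) gA1; have z2 := dgeometricZ (f01 * v) gA2.
have z3 := dgeometricZ (f20 * u ^+ 2) gA11; have z4 := dgeometricZ (f11 * u * v) gA12.
have z5 := dgeometricZ (f02 * v ^+ 2) gA22.
have e1 := dlimD gA z1; have s1 := dgeometricD gA z1.
have e2 := dlimD s1 z2; have s2 := dgeometricD s1 z2.
have e3 := dlimD s2 z3; have s3 := dgeometricD s2 z3.
have e4 := dlimD s3 z4; have s4 := dgeometricD s3 z4.
have e5 := dlimD s4 z5.
have -> : F u v * dlim A = dlim (fun i j => 2 * u * dshift1 B i j).
  transitivity (dlim (fun i j => A i j + f10 * u * dshift1 A i j + f01 * v * dshift2 A i j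
      + f20 * u ^+ 2 * dshift1 (dshift1 A) i j + f11 * u * v * dshift1 (dshift2 A) i j
      + f02 * v ^+ 2 * dshift2 (dshift2 A) i j)).
    rewrite e5 e4 e3 e2 e1 (dlimZ _ gA1) (dlimZ _ gA2) (dlimZ _ gA11) (dlimZ _ gA12).
    rewrite (dlimZ _ gA22) (dlim_shift1 gA1) (dlim_shift1 gA2) (dlim_shift2 gA2).
    by rewrite (dlim_shift1 gA) (dlim_shift2 gA) /F /Ffun; ring.
  congr dlim; apply/funext => i; apply/funext => j.
  have := congr1 (fun x => x * u ^+ i * v ^+ j) (int_coef_rec f10 f01 f20 f11 f02 i j).
  rewrite /A /B.
  by case: i => [|[|i]]; case: j => [|[|j]] /= e; rewrite ?exprS;
     move: e; rewrite ?exprS => e; lra.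
by rewrite (dlimZ _ gB1) (dlim_shift1 gB).
Qed.

(** The remainder in [first_integral_bound] is at most [4 * 8 u^2 rho^2 (rho e0)], which equals
    [u^2 / 2] for this radius. *)
Definition bound_radius : R := (64 * rho ^+ 3)^-1.
Let e0 := bound_radius.

Lemma bound_radius_gt0 : 0 < e0.
Proof. by rewrite /e0 /bound_radius invr_gt0 mulr_gt0 // exprn_gt0. Qed.

Lemma bound_radius_rate : 64 * rho ^+ 2 * (rho * e0) = 1.
Proof.
rewrite mulrA -[_ * rho]mulrA -exprSr /e0 /bound_radius divff //.
by rewrite gt_eqF // mulr_gt0 // exprn_gt0.
Qed.

Lemma rate_radius : 4 * (rho * r0) = 1.
Proof. by rewrite mulrA /r0 /int_radius divff // gt_eqF // mulr_gt0. Qed.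

Lemma rate_bound_radius : 1024 * (rho * e0) <= 1.
Proof.
rewrite -[X in _ <= X]bound_radius_rate; apply: ler_wpM2r.
  by rewrite mulr_ge0 // ltW // bound_radius_gt0.
have r4 := int_rate_ge4; have : 4 * 4 <= rho * rho by rewrite ler_pM.
by rewrite expr2; lra.
Qed.

Lemma bound_radius_le : 256 * e0 <= r0.
Proof.
rewrite -(ler_pM2l rho0); have := rate_radius; have := rate_bound_radius; lra.
Qed.

Lemma int_coef_0 j : h 0 j = (j == 1%N)%:R. Proof. by []. Qed.

(** At [u = 0] the equation [F h_u = 2 u h_v] gives [h_u(0, v) = 0]. *)
Lemma int_coef_1 j : h 1 j = 0.
Proof.
rewrite /h /int_coef /=; elim/ltn_ind: j => j IHj; rewrite next_rowE.
have -> : int_row_base f10 f20 f11 0 (fun j => (j == 1%N)%:R) (fun=> 0) j = 0.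
  by rewrite /int_row_base (_ : _ - _ = 0) ?mul0r //=; ring.
case: j IHj => [|j1] IHj; first by rewrite !mulr0 !subr0.
rewrite IHj // mulr0 subr0 sub0r; case: j1 IHj => [|j2] IHj; first by rewrite mulr0 oppr0.
by rewrite IHj // mulr0 oppr0.
Qed.

Lemma int_coef_20 : h 2 0 = 1.
Proof.
have := int_coef_rec f10 f01 f20 f11 f02 1 0.
rewrite /dshift1 /dshift2 /int_coef_u /int_coef_v.
have i1 : int_coef f10 f01 f20 f11 f02 1 0 = 0 := int_coef_1 0.
have i0 : int_coef f10 f01 f20 f11 f02 0 1 = 1 := int_coef_0 1.
by rewrite i1 i0 /h; lra.
Qed.

(* h(u, v) - v - u^2 is divisible by u^2, hence the shape of the bound. *)
Lemma first_integral_bound u v : `|u| <= e0 -> `|v| <= e0 ->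
  `|double_sum h u v - v - u ^+ 2| <= u ^+ 2 / 2.
Proof.
move=> ur vr; have ep := bound_radius_gt0; have br := bound_radius_rate.
pose t := rho * e0.
have t0 : 0 <= t by rewrite mulr_ge0 ?ltW.
have t2 : 2 * t <= 1 by have := rate_bound_radius; rewrite -/t; lra.
have rt (z : R) n : `|z| <= e0 -> rho ^+ n * `|z| ^+ n <= t ^+ n.
  move=> zr; rewrite -exprMn; apply: lerXn2r; rewrite ?nnegrE //.
    by rewrite mulr_ge0 // ltW.
  by rewrite ler_pM2l.
pose a i j := h i j * u ^+ i * v ^+ j.
have ler (z : R) : `|z| <= e0 -> `|z| <= 2 * r0.
  by have := bound_radius_le; lra.
have ag : dgeometric a 1 := double_sum_geometric rho0 h_le r00 int_radius_small (ler _ ur) (ler _ vr).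
(* Outside rows 0 and 1 and the term [u^2], every term has [i >= 2] and [i + j >= 3]: a factor [u^2]
   and at least one further small factor. *)
pose special i j := (i == 0%N) || (i == 1%N) || ((i == 2%N) && (j == 0%N)).
pose e i j := if special i j then a i j else 0.
pose b i j := if special i j then 0 else a i j.
have eg : dgeometric e 1.
  move=> i j; rewrite /e; case: ifP => // _.
  by rewrite normr0 mulr_ge0 // ltW // half_pow_gt0.
have bg : dgeometric b (8 * u ^+ 2 * rho ^+ 2 * t).
  move=> i j; rewrite /b; case: ifP => [_|].
    have c0 : 0 <= 8 * u ^+ 2 * rho ^+ 2 * t.
      exact: mulr_ge0 (mulr_ge0 (mulr_ge0 (ler0n R 8) (sqr_ge0 u)) (sqr_ge0 rho)) t0.
    by rewrite normr0; apply: mulr_ge0 => //; exact: ltW (half_pow_gt0 _).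
  move=> /negbT; rewrite /special !negb_or => sp.
  have i2 : (2 <= i)%N by case: i sp => [|[|]].
  have ij : (3 <= i + j)%N.
    by case: i i2 sp => [|[|[|i]]] // _; case: j => [|j].
  pose k := (i - 2)%N; have iE : i = (k + 2)%N by rewrite subnK.
  rewrite /a 2!normrM !normrX.
  apply: (@le_trans _ _ (rho ^+ (i + j) * `|u| ^+ i * `|v| ^+ j)).
    by rewrite -!mulrA ler_wpM2r // mulr_ge0 // exprn_ge0.
  have uE : `|u| ^+ i = `|u| ^+ k * u ^+ 2 by rewrite iE exprD real_normK ?num_real.
  rewrite uE {1}iE -addnA [(2 + j)%N]addnC addnA !exprD.
  have hk := rt u k ur; have hj := rt v j vr.
  have u2 := sqr_ge0 u; have rho2 : 0 <= rho ^+ 2 by rewrite sqr_ge0.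
  have pk : 0 <= rho ^+ k * `|u| ^+ k by rewrite mulr_ge0 ?exprn_ge0 // ltW.
  have pj : 0 <= rho ^+ j * `|v| ^+ j by rewrite mulr_ge0 ?exprn_ge0 // ltW.
  have hkj : (rho ^+ k * `|u| ^+ k) * (rho ^+ j * `|v| ^+ j) <= t ^+ k * t ^+ j.
    by rewrite ler_pM.
  have tkj : t ^+ k * t ^+ j <= t * (8 * 2^-1 ^+ (i + j)).
    have kj : (0 < k + j)%N by move: ij; rewrite iE addnAC addn2 !ltnS.
    rewrite -exprD iE addnAC -(prednK kj) exprS ler_wpM2l //.
    rewrite addn2 !half_powS (_ : 8 * _ = 2^-1 ^+ (k + j).-1); last by field.
    exact: half_pow_bound.
  have := ler_wpM2l (mulr_ge0 u2 rho2) (le_trans hkj tkj).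
  by rewrite (exprD 2^-1 i j); set X := 2^-1 ^+ i; set Y := 2^-1 ^+ j; lra.
have aE : double_sum h u v = dlim b + dlim e.
  rewrite -(dlimD bg eg); congr dlim.
  by apply/funext => m; apply/funext => n; rewrite /b /e;
    case: ifP; rewrite ?add0r ?addr0.
have eE : dlim e = v + u ^+ 2.
  apply: cvg_lim => //; rewrite -(cvg_shiftn 3).
  rewrite (_ : [sequence _]_n = cst (v + u ^+ 2)); first exact: cvg_cst.
  apply/funext => n /=; rewrite addn3 /dsum.
  have row0 : \sum_(j < n.+3) e 0%N j = v.
    rewrite !big_ord_recl big1 ?addr0; last first.
      by move=> j _; rewrite /e /= /a int_coef_0 /= !mul0r.
    by rewrite /e /= /a !int_coef_0 /=; ring.
  have row1 : \sum_(j < n.+3) e 1%N j = 0.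
    by apply: big1 => j _; rewrite /e /= /a int_coef_1 !mul0r.
  have row2 : \sum_(j < n.+3) e 2%N j = u ^+ 2.
    by rewrite big_ord_recl big1 ?addr0 // /e /= /a int_coef_20 mul1r mulr1.
  rewrite 3!big_ord_recl row0 row1 row2 big1 ?addr0 ?add0r //.
  by move=> i _; apply: big1 => j _.
rewrite aE eE (_ : _ - _ - _ = dlim b); last by ring.
apply: le_trans (dlim_le bg) _.
rewrite le_eqVlt; apply/orP; left; apply/eqP.
transitivity (u ^+ 2 / 2 * (64 * rho ^+ 2 * (rho * e0))); last by rewrite br mulr1.
by rewrite /t; field.
Qed.

(** These are the coefficients of [h(x^2, y^2)] in [x] and [y] themselves, which reduces its
    analyticity to the re-expansion of one double series. *)
Definition even_coef (a : nat -> nat -> R) (k l : nat) : R :=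
  if odd k || odd l then 0 else a k./2 l./2.

Lemma leq_half_self n : (n./2 <= n)%N.
Proof. by rewrite -{2}(odd_double_half n) -addnn addnA leq_addl. Qed.

Lemma even_coef_le k l : `|even_coef h k l| <= rho ^+ (k + l).
Proof.
rewrite /even_coef; case: ifP => _; first by rewrite normr0 exprn_ge0 // ltW.
apply: le_trans (h_le _ _) _; apply: ler_weXn2l.
  by have := int_rate_ge4; lra.
by rewrite leq_add // leq_half_self.
Qed.

Lemma sum_double (g : nat -> R) n :
  \sum_(i < n.*2) g i = \sum_(i < n) (g i.*2 + g i.*2.+1).
Proof.
elim: n => [|n IHn]; first by rewrite !big_ord0.
by rewrite doubleS !big_ord_recr /= IHn addrA.
Qed.

Lemma double_sum_even x y : `|x| <= 2 * r0 -> `|y| <= 2 * r0 ->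
  double_sum h (x ^+ 2) (y ^+ 2) = double_sum (even_coef h) x y.
Proof.
move=> xr yr.
have cg := double_sum_geometric rho0 even_coef_le r00 int_radius_small xr yr.
apply: (@dlim_unique _ _ _ 8) => N.
have := dsum_dlim N.*2 cg; rewrite mulr1.
have -> : dsum (fun k l => even_coef h k l * x ^+ k * y ^+ l) N.*2 =
    dsum (fun i j => h i j * (x ^+ 2) ^+ i * (y ^+ 2) ^+ j) N.
  rewrite /dsum (sum_double (fun i => \sum_(j < N.*2) even_coef h i j * x ^+ i * y ^+ j)).
  apply: eq_bigr => i _.
  rewrite [X in _ + X]big1 ?addr0; last first.
    by move=> j _; rewrite /even_coef /= odd_double /= !mul0r.
  rewrite (sum_double (fun j => even_coef h i.*2 j * x ^+ i.*2 * y ^+ j)).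
  apply: eq_bigr => j _; rewrite /even_coef /= !odd_double /= !mul0r addr0 !doubleK.
  by rewrite -!exprM !mul2n.
move/le_trans; apply; rewrite ler_pM2l //.
rewrite -addnn exprD ler_piMl ?(ltW (half_pow_gt0 _)) //.
by apply: exprn_ile1; rewrite ?invr_ge0 // invf_le1 // ler1n.
Qed.

Definition first_integral (z : R * R) : R := double_sum h (z.1 ^+ 2) (z.2 ^+ 2).

Lemma first_integral_analytic p q : `|p| < r0 -> `|q| < r0 ->
  analytic_at first_integral (p, q).
Proof.
move=> pr qr.
have [c [r [rp cH]]] := double_sum_analytic rho0 even_coef_le r00 int_radius_small pr qr.
exists c, (Num.min r r0); split; first by rewrite lt_min rp.
move=> x y; rewrite !lt_min => /andP[xr xr0] /andP[yr yr0].
have [sc lc] := cH x y xr yr; split => //.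
rewrite /first_integral /= double_sum_even //.
  by apply: le_trans (ler_normD _ _) _; lra.
by apply: le_trans (ler_normD _ _) _; lra.
Qed.

Lemma is_derive_first_integral (x y : R -> R) (t : R) :
  is_derive t 1 x (y t * F (x t ^+ 2) (y t ^+ 2)) ->
  is_derive t 1 y (- 2 * x t ^+ 3) -> `|x t| <= r0 -> `|y t| <= r0 ->
  is_derive t 1 (fun s => first_integral (x s, y s)) 0.
Proof.
move=> xd yd xr yr.
have sq (z : R) : `|z| <= r0 -> `|z ^+ 2| <= r0.
  move=> zr; rewrite normrX expr2; apply: (le_trans _ (zr)); rewrite ler_piMl //.
  by apply: le_trans zr _; have := int_radius_le; lra.
have x2 : is_derive t 1 (fun s => x s ^+ 2) (2 * x t * (y t * F (x t ^+ 2) (y t ^+ 2))).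
  apply: is_derive_eq (is_deriveX 2 xd) _.
  by rewrite /GRing.scale /= expr1; ring.
have y2 : is_derive t 1 (fun s => y s ^+ 2) (2 * y t * (- 2 * x t ^+ 3)).
  apply: is_derive_eq (is_deriveX 2 yd) _.
  by rewrite /GRing.scale /= expr1; ring.
have := is_derive_double_sum rho0 h_le r00 int_radius_small x2 y2 (sq _ xr) (sq _ yr).
move=> /is_derive_eq; apply.
have pde := first_integral_pde (sq _ xr) (sq _ yr).
rewrite (_ : _ + _ = 2 * x t * y t * (F (x t ^+ 2) (y t ^+ 2) *
    shifted_coef h (x t ^+ 2) (y t ^+ 2) 1 0 -
    2 * x t ^+ 2 * shifted_coef h (x t ^+ 2) (y t ^+ 2) 0 1)); last by ring.
by rewrite pde subrr mulr0.
Qed.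
End FirstIntegralSum.

(** * Global flows of bounded Lipschitz fields *)

Section Antiderivatives.
Context {R : realType}.

Lemma derivative_unique (f g df : R -> R) (a b : R) : a <= b -> 
  (forall t, t \in `[a, b] -> is_derive t 1 f (df t)) ->
  (forall t, t \in `[a, b] -> is_derive t 1 g (df t)) ->
  f b - f a = g b - g a.
Proof.
move=> ab fd gd.
have dd (t : R) : t \in `[a, b] -> is_derive t 1 (fun s => f s - g s) (cst 0 t).
  by move=> tab; apply: is_derive_eq (is_deriveB (fd t tab) (gd t tab)) _; rewrite subrr.
have [c _] := mean_value ab dd; rewrite mul0r; lra.
Qed.

Lemma local_antiderivative (phi : R -> R) (n : nat) : continuous phi ->
  exists2 P : R -> R, P 0 = 0 & forall t : R, `|t| < n%:R -> is_derive t 1 P (phi t).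
Proof.
move=> phic; pose a : R := - n%:R; pose b : R := n%:R.
pose G (x : R) := (\int[lebesgue_measure]_(t in [set` `[a, x]]) phi t)%R.
exists (fun t => G t - G 0); first by rewrite subrr.
move=> t; rewrite ltr_norml => /andP[at_ tb].
have intg : lebesgue_measure.-integrable `[a, b] (EFin \o phi).
  apply: continuous_compact_integrable; first exact: segment_compact.
  exact: continuous_subspaceT.
have [dG GE] := continuous_FTC1_closed tb intg at_ (phic t).
have Gd : is_derive t 1 G (phi t).
  by split; [exact: dG | rewrite -derive1E].
by apply: is_derive_eq (is_deriveB Gd (is_derive_cst (G 0) t 1)) _; rewrite subr0.
Qed.

(** The antiderivatives on the intervals []-n, n[], all 0 at 0, agree where they overlap and can be
    glued. *)
Lemma antiderivative (phi : R -> R) : continuous phi ->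
  exists2 P : R -> R, P 0 = 0 & forall t : R, is_derive t 1 P (phi t).
Proof.
move=> phic.
have /choice[P PP] (n : nat) : exists Q : R -> R, Q 0 = 0 /\
    forall t : R, `|t| < n%:R -> is_derive t 1 Q (phi t).
  by have [Q Q0 Qd] := local_antiderivative n phic; exists Q.
have P0 n : P n 0 = 0 by have [] := PP n.
have Pd n (t : R) : `|t| < n%:R -> is_derive t 1 (P n) (phi t) by have [_] := PP n; apply.
have agree m n (t : R) : `|t| < m%:R -> `|t| < n%:R -> P m t = P n t.
  move=> tm tn; have [t0|t0] := leP 0 t.
  - have := @derivative_unique (P m) (P n) phi 0 t t0; rewrite !P0 !subr0; apply.
    + move=> s; rewrite in_itv /= => /andP[s0 st]; apply: Pd; apply: le_lt_trans tm.
      by rewrite !ger0_norm.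
    + move=> s; rewrite in_itv /= => /andP[s0 st]; apply: Pd; apply: le_lt_trans tn.
      by rewrite !ger0_norm.
  - have := @derivative_unique (P m) (P n) phi t 0 (ltW t0); rewrite !P0 !sub0r.
    move=> h; apply: oppr_inj; apply: h.
    + move=> s; rewrite in_itv /= => /andP[s0 st]; apply: Pd; apply: le_lt_trans tm.
      by rewrite !ler0_norm ?lerN2 // ltW.
    + move=> s; rewrite in_itv /= => /andP[s0 st]; apply: Pd; apply: le_lt_trans tn.
      by rewrite !ler0_norm ?lerN2 // ltW.
pose N (t : R) := (Num.truncn `|t|).+1.
have NP (t : R) : `|t| < (N t)%:R by rewrite /N truncnS_gt.
exists (fun t => P (N t) t); first exact: P0.
move=> t; have tn := NP t.
apply: near_eq_is_derive (Pd (N t) t tn).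
near=> s; apply: agree; last exact: NP.
near: s; apply: (cvgr_lt (`|t| : R)) => //; exact: norm_continuous.
Unshelve. all: by end_near. Qed.
End Antiderivatives.

(** * Picard iteration on the whole line *)

Section Picard.
Context {R : realType}.

Lemma le_half_pow (a b C : R) : (forall n, a <= b + C * 2^-1 ^+ n) -> a <= b.
Proof.
move=> h.
have c : b + C * 2^-1 ^+ n @[n --> \oo] --> b.
  rewrite -[X in _ --> X]addr0; apply: cvgD; first exact: cvg_cst.
  exact: cvg_half_pow.
apply: (cvgr_to_ge c).
by apply: nearW.
Qed.

Lemma exp_comparison (F dF : R -> R) (K c t : R) : 0 <= K -> 0 <= t -> F 0 = 0 ->
  (forall s : R, is_derive s 1 F (dF s)) ->
  (forall s, 0 <= s -> dF s <= K * c * expR (c * s)) -> F t <= K * expR (c * t).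
Proof.
move=> K0 t0 F0 Fd dFle.
have ed (s : R) : is_derive s 1 (fun r => F r - K * expR (c * r))
    (dF s - K * c * expR (c * s)).
  have e1 := is_derive_affine (a := 0) (b := c) (is_derive_expR (0 + c * s)).
  have e2 : is_derive s 1 (fun r => expR (c * r)) (c * expR (c * s)).
    by move: e1; rewrite add0r; under eq_fun do rewrite add0r.
  apply: is_derive_eq (is_deriveB (Fd s) (is_deriveZ K e2)) _.
  by rewrite /GRing.scale /= mulrA.
have := is_derive_le0 t0 (fun s _ => ed s).
rewrite F0 mulr0 expR0 mulr1 sub0r => h.
have : F t - K * expR (c * t) <= - K.
  apply: h => s; rewrite in_itv /= => /andP[s0 _].
  by rewrite subr_le0 dFle.
by move=> h'; rewrite -subr_le0 (le_trans h') // oppr_le0.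
Qed.

Lemma exp_comparison_norm (F dF : R -> R) (K c : R) : 0 <= K -> F 0 = 0 ->
  (forall s : R, is_derive s 1 F (dF s)) ->
  (forall s, `|dF s| <= K * c * expR (c * `|s|)) ->
  forall t, `|F t| <= K * expR (c * `|t|).
Proof.
move=> K0 F0 Fd dFle t.
have key (e d : R) (s : R) : `|e| = 1 -> `|d| = 1 -> 0 <= s ->
    e * F (0 + d * s) <= K * expR (c * s).
  move=> e1 d1 s0.
  have gd (r : R) : is_derive r 1 (fun r => e * F (0 + d * r)) (e * (d * dF (0 + d * r))).
    exact: (is_deriveZ e (is_derive_affine (Fd (0 + d * r)))).
  apply: (exp_comparison K0 s0 _ gd); first by rewrite mulr0 addr0 F0 mulr0.
  move=> r r0; apply: le_trans (ler_norm _) _.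
  rewrite 2!normrM e1 d1 2!mul1r; apply: le_trans (dFle _) _.
  by rewrite add0r normrM d1 mul1r (ger0_norm r0).
have n1 : `|1 : R| = 1 by rewrite normr1.
have nN1 : `|-1 : R| = 1 by rewrite normrN1.
rewrite ler_norml; have [t0|t0] := leP 0 t.
- have h1 := key 1 1 t n1 n1 t0; have h2 := key (-1) 1 t nN1 n1 t0.
  rewrite (ger0_norm t0); move: h1 h2; rewrite add0r !mul1r; lra.
- have t0' : 0 <= - t by rewrite oppr_ge0 ltW.
  have h1 := key 1 (-1) (-t) n1 nN1 t0'; have h2 := key (-1) (-1) (-t) nN1 nN1 t0'.
  rewrite (ltr0_norm t0); move: h1 h2; rewrite add0r mulN1r opprK !mul1r; lra.
Qed.

Lemma lipschitz_continuous (x : R -> R) (B : R) :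
  (forall s t, `|x s - x t| <= B * `|s - t|) -> continuous x.
Proof.
move=> xl t; apply/cvgrPdist_lt => /= e e0.
have B1 : 0 < `|B| + 1 by rewrite ltr_pwDr.
near=> s.
apply: le_lt_trans (xl t s) _.
have st : `|t - s| < e / (`|B| + 1).
  near: s; apply: (nbhsx_ballx t (e / (`|B| + 1))); exact: divr_gt0.
apply: le_lt_trans (_ : (`|B| + 1) * `|t - s| < _).
  by rewrite ler_wpM2r // (le_trans (ler_norm _)) // lerDl.
by rewrite mulrC -ltr_pdivlMr.
Unshelve. all: by end_near. Qed.

Lemma bounded_derive_lipschitz (x dx : R -> R) (B : R) :
  (forall t : R, is_derive t 1 x (dx t)) -> (forall t, `|dx t| <= B) ->
  forall s t, `|x s - x t| <= B * `|s - t|.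
Proof.
move=> xd dxB s t; wlog st : s t / t <= s.
  by move=> h; have [/h//|/ltW/h] := leP t s; rewrite distrC [`|t - s|]distrC.
have [c _ ->] := mean_value st (fun r _ => xd r).
by rewrite normrM ler_wpM2r.
Qed.

Variables (f g : R -> R -> R) (B L : R).
Hypotheses (L0 : 0 < L) (fB : forall x y, `|f x y| <= B) (gB : forall x y, `|g x y| <= B).
Hypothesis fL : forall x y x' y', `|f x y - f x' y'| <= L * (`|x - x'| + `|y - y'|).
Hypothesis gL : forall x y x' y', `|g x y - g x' y'| <= L * (`|x - x'| + `|y - y'|).

Let B0 : 0 <= B. Proof. exact: le_trans (fB 0 0). Qed.

Definition flow (x y : R -> R) :=
  (forall t : R, is_derive t 1 x (f (x t) (y t))) /\
  (forall t : R, is_derive t 1 y (g (x t) (y t))).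

Let E (t : R) : R := expR (4 * L * `|t|).

Let E1 t : 1 <= E t.
Proof. by rewrite /E -expR0 ler_expR; rewrite !mulr_ge0 // ltW. Qed.

Let E0 t : 0 <= E t. Proof. by rewrite expR_ge0. Qed.

Let sub_fun0 (u v : R -> R) c : u 0 = c -> v 0 = c -> (u - v) 0 = 0.
Proof. move=> uc vc; have -> : (u - v) 0 = u 0 - v 0 by [].
by rewrite uc vc subrr. Qed.

(** In the norm weighted by [exp(4 L |t|)], Bielecki's device, the Picard operator contracts by
    [1/2] on the whole line at once, so that no local solutions have to be continued. *)
Lemma picard_contraction (K : R) (u v du dv : R -> R) : 0 <= K -> u 0 = 0 -> v 0 = 0 ->
  (forall t : R, is_derive t 1 u (du t)) -> (forall t : R, is_derive t 1 v (dv t)) ->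
  (forall t, `|du t| <= L * (K * E t)) -> (forall t, `|dv t| <= L * (K * E t)) ->
  forall t, `|u t| + `|v t| <= K / 2 * E t.
Proof.
move=> K0 u0 v0 ud vd duK dvK t.
have K4 : 0 <= K / 4 by rewrite divr_ge0.
have KE s : K / 4 * (4 * L) * expR (4 * L * `|s|) = L * (K * E s).
  by rewrite /E; field.
have h1 := @exp_comparison_norm u du (K / 4) (4 * L) K4 u0 ud.
have h2 := @exp_comparison_norm v dv (K / 4) (4 * L) K4 v0 vd.
have {}h1 : `|u t| <= K / 4 * E t by apply: h1 => s; rewrite KE.
have {}h2 : `|v t| <= K / 4 * E t by apply: h2 => s; rewrite KE.
lra.
Qed.

(** Boundedness of the field gives a first estimate of the difference in the weighted norm, and each
    contraction halves it. *)
Lemma flow_unique0 x y x' y' : flow x y -> flow x' y' -> x 0 = x' 0 -> y 0 = y' 0 ->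
  forall t, x t = x' t /\ y t = y' t.
Proof.
move=> [xd yd] [xd' yd'] x0 y0.
pose K := 2 * B / L.
have K0 : 0 <= K by rewrite divr_ge0 ?mulr_ge0 // ltW.
have ud t := is_deriveB (xd t) (xd' t); have vd t := is_deriveB (yd t) (yd' t).
have u0 : (x - x') 0 = 0 by exact: (sub_fun0 x0 erefl).
have v0 : (y - y') 0 = 0 by exact: (sub_fun0 y0 erefl).
have bnd n t : `|(x - x') t| + `|(y - y') t| <= K * 2^-1 ^+ n / 2 * E t.
  elim: n t => [|n IHn] t.
    apply: (picard_contraction _ u0 v0 ud vd) => [|s|s]; first by rewrite mulr1.
    - apply: (le_trans (ler_normB _ _)); rewrite mulr1.
      apply: le_trans (lerD (fB _ _) (fB _ _)) _.
      rewrite mulrA /K mulrCA divff ?gt_eqF // mulr1.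
      by rewrite ?(mulr_natl B 2) ?mulr2n ler_peMr ?addr_ge0.
    - apply: (le_trans (ler_normB _ _)); rewrite mulr1.
      apply: le_trans (lerD (gB _ _) (gB _ _)) _.
      rewrite mulrA /K mulrCA divff ?gt_eqF // mulr1.
      by rewrite ?(mulr_natl B 2) ?mulr2n ler_peMr ?addr_ge0.
  rewrite half_powS.
  apply: (picard_contraction _ u0 v0 ud vd) => [|s|s].
  - by rewrite mulr_ge0 // divr_ge0 // ltW // half_pow_gt0.
  - apply: le_trans (fL _ _ _ _) _; rewrite ler_pM2l //.
    by rewrite mulrA; exact: IHn.
  - apply: le_trans (gL _ _ _ _) _; rewrite ler_pM2l //.
    by rewrite mulrA; exact: IHn.
move=> t.
have : `|(x - x') t| + `|(y - y') t| <= 0.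
  apply: (@le_half_pow _ _ (K / 2 * E t)) => n; rewrite add0r.
  by apply: le_trans (bnd n t) _; rewrite le_eqVlt; apply/orP; left; apply/eqP; ring.
move=> h.
have hx : `|(x - x') t| <= 0 by have := normr_ge0 ((y - y') t); lra.
have hy : `|(y - y') t| <= 0 by have := normr_ge0 ((x - x') t); lra.
by split; apply/eqP; rewrite -subr_eq0 -normr_le0.
Qed.

Lemma flow_exists (p q : R) : exists x y, [/\ flow x y, x 0 = p & y 0 = q].
Proof.
have /choice[AD ADP] (phi : R -> R) : exists P : R -> R, continuous phi ->
    P 0 = 0 /\ forall t : R, is_derive t 1 P (phi t).
  have [phic|phic] := pselect (continuous phi).
    by have [P P0 Pd] := antiderivative phic; exists P.
  by exists (cst 0).
pose step (z : (R -> R) * (R -> R)) : (R -> R) * (R -> R) :=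
  (fun t => p + AD (fun s => f (z.1 s) (z.2 s)) t,
   fun t => q + AD (fun s => g (z.1 s) (z.2 s)) t).
have fc (x y : R -> R) : continuous x -> continuous y ->
    continuous (fun s => f (x s) (y s)) /\ continuous (fun s => g (x s) (y s)).
  move=> xc yc.
  have key (k : R -> R -> R) :
      (forall x y x' y', `|k x y - k x' y'| <= L * (`|x - x'| + `|y - y'|)) ->
      continuous (fun s => k (x s) (y s)).
    move=> kL t; apply/cvgrPdist_lt => /= e e0.
    have e1 : 0 < e / (2 * L) by rewrite divr_gt0 // mulr_gt0.
    near=> s.
    have h1 : `|x t - x s| < e / (2 * L).
      by near: s; have /cvgrPdist_lt := xc t; exact.
    have h2 : `|y t - y s| < e / (2 * L).
      by near: s; have /cvgrPdist_lt := yc t; exact.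
    apply: le_lt_trans (kL _ _ _ _) _.
    have -> : e = L * (e / (2 * L) + e / (2 * L)) by field; rewrite gt_eqF.
    by rewrite ltr_pM2l // ltrD.
  by split; exact: key.
have stepd (z : (R -> R) * (R -> R)) : continuous z.1 -> continuous z.2 ->
    [/\ (step z).1 0 = p, (step z).2 0 = q,
        forall t : R, is_derive t 1 (step z).1 (f (z.1 t) (z.2 t))
      & forall t : R, is_derive t 1 (step z).2 (g (z.1 t) (z.2 t))].
  move=> z1c z2c; have [c1 c2] := fc _ _ z1c z2c.
  have [P0 Pd] := ADP _ c1; have [Q0 Qd] := ADP _ c2.
  split => [||t|t]; rewrite /step /= ?P0 ?Q0 ?addr0 //.
  - by apply: is_derive_eq (is_deriveD (is_derive_cst p t 1) (Pd t)) _; rewrite add0r.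
  - by apply: is_derive_eq (is_deriveD (is_derive_cst q t 1) (Qd t)) _; rewrite add0r.
pose z n := iter n step (cst p, cst q).
have zc n : continuous (z n).1 /\ continuous (z n).2.
  elim: n => [|n [IH1 IH2]]; first by split; exact: cst_continuous.
  by have [_ _ d1 d2] := stepd _ IH1 IH2; split; apply: is_derive_continuous; eassumption.
have zd n : [/\ (z n.+1).1 0 = p, (z n.+1).2 0 = q,
    forall t : R, is_derive t 1 (z n.+1).1 (f ((z n).1 t) ((z n).2 t))
    & forall t : R, is_derive t 1 (z n.+1).2 (g ((z n).1 t) ((z n).2 t))].
  by have [c1 c2] := zc n; exact: stepd.
pose K := B / L.
have K0 : 0 <= K by rewrite divr_ge0 // ltW.
have BE s : B <= L * (K * E s).
  rewrite mulrA /K mulrCA divff ?gt_eqF // mulr1.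
  by rewrite ?(mulr_natl B 2) ?mulr2n ler_peMr ?addr_ge0.
have zB n t : `|(z n.+1).1 t - (z n).1 t| + `|(z n.+1).2 t - (z n).2 t| <=
    K * 2^-1 ^+ n / 2 * E t.
  elim: n t => [|n IHn] t.
    have [p0 q0 d1 d2] := zd 0%N.
    have ud s := is_deriveB (d1 s) (is_derive_cst p s 1).
    have vd s := is_deriveB (d2 s) (is_derive_cst q s 1).
    apply: (picard_contraction _ _ _ ud vd) => [|||s|s].
    - by rewrite mulr1.
    - exact: (sub_fun0 p0 erefl).
    - exact: (sub_fun0 q0 erefl).
    - by rewrite subr0 mulr1; apply: le_trans (fB _ _) _.
    - by rewrite subr0 mulr1; apply: le_trans (gB _ _) _.
  have [p0 q0 d1 d2] := zd n; have [p0' q0' d1' d2'] := zd n.+1.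
  have ud s := is_deriveB (d1' s) (d1 s).
  have vd s := is_deriveB (d2' s) (d2 s).
  rewrite half_powS.
  apply: (picard_contraction _ _ _ ud vd) => [|||s|s].
  - by rewrite mulr_ge0 // divr_ge0 // ltW // half_pow_gt0.
  - exact: (sub_fun0 p0' p0).
  - exact: (sub_fun0 q0' q0).
  - by apply: le_trans (fL _ _ _ _) _; rewrite ler_pM2l // mulrA; exact: IHn.
  - by apply: le_trans (gL _ _ _ _) _; rewrite ler_pM2l // mulrA; exact: IHn.
have zB' n t : K * 2^-1 ^+ n / 2 * E t = K / 2 * E t * 2^-1 ^+ n by ring.
have /choice[x xP] (t : R) : exists l, forall n,
    `|(z n).1 t - l| <= 2 * (K / 2 * E t) * 2^-1 ^+ n.
  apply: geometric_cvg => n; rewrite -zB'; apply: le_trans (zB n t).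
  by rewrite lerDl.
have /choice[y yP] (t : R) : exists l, forall n,
    `|(z n).2 t - l| <= 2 * (K / 2 * E t) * 2^-1 ^+ n.
  apply: geometric_cvg => n; rewrite -zB'; apply: le_trans (zB n t).
  by rewrite lerDr.
(* The limit is continuous because the iterates after the initial one share the Lipschitz constant
   [B]. *)
have lipc (w : nat -> R -> R) (l : R -> R) :
    (forall t n, `|w n t - l t| <= 2 * (K / 2 * E t) * 2^-1 ^+ n) ->
    (forall n s t, `|w n.+1 s - w n.+1 t| <= B * `|s - t|) -> continuous l.
  move=> wl wB; apply: (@lipschitz_continuous _ B) => s t.
  apply: (@le_half_pow _ _ (K * E s + K * E t)) => n.
  have h1 := wl s n.+1; have h2 := wl t n.+1; have h3 := wB n s t.
  have -> : l s - l t = (w n.+1 s - w n.+1 t) - (w n.+1 s - l s) + (w n.+1 t - l t) by ring.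
  apply: le_trans (ler_normD _ _) _.
  have h4 := ler_normB (w n.+1 s - w n.+1 t) (w n.+1 s - l s).
  move: h1 h2; rewrite half_powS; have := half_pow_gt0 (R := R) n; set h := 2^-1 ^+ n.
  move=> h0 h1 h2.
  have a1 : 0 <= K * E s * h by apply: mulr_ge0 (ltW h0); exact: mulr_ge0.
  have a2 : 0 <= K * E t * h by apply: mulr_ge0 (ltW h0); exact: mulr_ge0.
  lra.
have xc : continuous x.
  apply: lipc xP _ => n; have [_ _ d1 _] := zd n.
  exact: (bounded_derive_lipschitz d1).
have yc : continuous y.
  apply: lipc yP _ => n; have [_ _ _ d2] := zd n.
  exact: (bounded_derive_lipschitz d2).
have [p0 q0 d1 d2] := stepd (x, y) xc yc.
have near_lim n t : `|x t - (z n).1 t| + `|y t - (z n).2 t| <= 4 * K * 2^-1 ^+ n / 2 * E t.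
  have := xP t n; have := yP t n; rewrite distrC [`|(z n).1 t - _|]distrC; lra.
have lim_step n t : `|(step (x, y)).1 t - (z n.+1).1 t| + `|(step (x, y)).2 t - (z n.+1).2 t|
    <= 4 * K * 2^-1 ^+ n.+1 / 2 * E t.
  have [p0' q0' d1' d2'] := zd n.
  have ud s := is_deriveB (d1 s) (d1' s).
  have vd s := is_deriveB (d2 s) (d2' s).
  rewrite half_powS mulrA.
  apply: (picard_contraction _ _ _ ud vd) => [|||s|s].
  - by rewrite divr_ge0 // mulr_ge0 ?(ltW (half_pow_gt0 _)) // mulr_ge0.
  - exact: (sub_fun0 p0 p0').
  - exact: (sub_fun0 q0 q0').
  - by apply: le_trans (fL _ _ _ _) _; rewrite ler_pM2l //; exact: near_lim.
  - by apply: le_trans (gL _ _ _ _) _; rewrite ler_pM2l //; exact: near_lim.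
have fixed t : (step (x, y)).1 t = x t /\ (step (x, y)).2 t = y t.
  have : `|(step (x, y)).1 t - x t| + `|(step (x, y)).2 t - y t| <= 0.
    apply: (@le_half_pow _ _ (2 * K * E t)) => n; rewrite add0r.
    have := lim_step n t; have := near_lim n.+1 t.
    rewrite half_powS distrC [`|y t - _|]distrC => h1 h2.
    have h3 := ler_distD ((z n.+1).1 t) ((step (x, y)).1 t) (x t).
    have h4 := ler_distD ((z n.+1).2 t) ((step (x, y)).2 t) (y t).
    lra.
  move=> h.
  have hx : `|(step (x, y)).1 t - x t| <= 0 by have := normr_ge0 ((step (x, y)).2 t - y t); lra.
  have hy : `|(step (x, y)).2 t - y t| <= 0 by have := normr_ge0 ((step (x, y)).1 t - x t); lra.
  by split; apply/eqP; rewrite -subr_eq0 -normr_le0.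
have e1 : (step (x, y)).1 = x by apply/funext => t; have [] := fixed t.
have e2 : (step (x, y)).2 = y by apply/funext => t; have [] := fixed t.
by exists x, y; rewrite e1 in p0 d1; rewrite e2 in q0 d2.
Unshelve. all: by end_near. Qed.

Lemma is_derive_translate (h : R -> R) (a t dh : R) : is_derive (a + t) 1 h dh ->
  is_derive t 1 (fun s => h (a + s)) dh.
Proof.
move=> hd; have hd' : is_derive (a + 1 * t) 1 h dh by rewrite mul1r.
have := is_derive_affine hd'; rewrite mul1r.
by congr (is_derive _ _ _ _); apply/funext => s; rewrite mul1r.
Qed.

Lemma is_derive_reflect (h : R -> R) (t dh : R) : is_derive (- t) 1 h dh ->
  is_derive t 1 (fun s => h (- s)) (- dh).
Proof.
move=> hd; have hd' : is_derive (0 + -1 * t) 1 h dh by rewrite add0r mulN1r.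
have := is_derive_affine hd'; rewrite mulN1r.
by congr (is_derive _ _ _ _); apply/funext => s; rewrite add0r mulN1r.
Qed.

Lemma flow_shift x y (t0 : R) : flow x y -> flow (fun t => x (t0 + t)) (fun t => y (t0 + t)).
Proof. by move=> [xd yd]; split=> t; exact: is_derive_translate. Qed.

Lemma flow_unique x y x' y' (s t : R) : flow x y -> flow x' y' -> x s = x' t -> y s = y' t ->
  forall r, x (s + r) = x' (t + r) /\ y (s + r) = y' (t + r).
Proof.
move=> z z' xs ys r; apply: (flow_unique0 (flow_shift s z) (flow_shift t z')) => /=.
- by rewrite !addr0.
- by rewrite !addr0.
Qed.
End Picard.

(** * Bounded Lipschitz functions and truncation *)

Section BoundedLipschitz.
Context {R : realType}.
Implicit Types k : R -> R -> R.

(** Boundedness belongs to the notion so that it is closed under products. *)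
Definition bounded_lipschitz k := exists B L : R, [/\ 0 <= B, 0 <= L,
  forall x y, `|k x y| <= B
  & forall x y x' y', `|k x y - k x' y'| <= L * (`|x - x'| + `|y - y'|)].

Lemma bounded_lipschitz_cst (a : R) : bounded_lipschitz (fun _ _ => a).
Proof. by exists `|a|, 0; split=> // *; rewrite subrr normr0 mul0r. Qed.

Lemma bounded_lipschitzD k1 k2 : bounded_lipschitz k1 -> bounded_lipschitz k2 ->
  bounded_lipschitz (fun x y => k1 x y + k2 x y).
Proof.
move=> [B1 [L1 [B10 L10 b1 l1]]] [B2 [L2 [B20 L20 b2 l2]]].
exists (B1 + B2), (L1 + L2); split=> [||x y|x y x' y']; [exact: addr_ge0|exact: addr_ge0| |].
  by apply: le_trans (ler_normD _ _) _; exact: lerD.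
rewrite opprD addrACA mulrDl; apply: le_trans (ler_normD _ _) _; exact: lerD.
Qed.

Lemma bounded_lipschitzM k1 k2 : bounded_lipschitz k1 -> bounded_lipschitz k2 ->
  bounded_lipschitz (fun x y => k1 x y * k2 x y).
Proof.
move=> [B1 [L1 [B10 L10 b1 l1]]] [B2 [L2 [B20 L20 b2 l2]]].
exists (B1 * B2), (B1 * L2 + L1 * B2); split=> [||x y|x y x' y'].
- exact: mulr_ge0.
- by rewrite addr_ge0 // mulr_ge0.
- by rewrite normrM ler_pM.
set d := `|_| + `|_|.
have -> : k1 x y * k2 x y - k1 x' y' * k2 x' y' =
    k1 x y * (k2 x y - k2 x' y') + (k1 x y - k1 x' y') * k2 x' y' by ring.
apply: le_trans (ler_normD _ _) _; rewrite 2!normrM mulrDl; apply: lerD.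
  by rewrite -mulrA ler_pM.
by rewrite mulrAC ler_pM.
Qed.

Lemma bounded_lipschitzX k n : bounded_lipschitz k -> bounded_lipschitz (fun x y => k x y ^+ n).
Proof.
move=> kb; elim: n => [|n IHn]; first exact: bounded_lipschitz_cst.
by under eq_fun do under eq_fun do rewrite exprS; exact: bounded_lipschitzM.
Qed.

Variable rho : R.
Hypothesis rho0 : 0 < rho.

Definition clamp (x : R) : R := Num.max (- rho) (Num.min rho x).

Lemma clamp_id x : `|x| <= rho -> clamp x = x.
Proof.
rewrite ler_norml => /andP[x1 x2]; rewrite /clamp min_r // max_r //.
Qed.

Lemma clamp_le x : `|clamp x| <= rho.
Proof.
rewrite ler_norml /clamp le_max lexx /= ge_max ge_min lexx /= andbT.
by have := rho0; lra.
Qed.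

Lemma clamp_lipschitz x x' : `|clamp x - clamp x'| <= `|x - x'|.
Proof.
have key a b : a <= b -> 0 <= clamp b - clamp a <= b - a.
  move=> ab; rewrite /clamp; have := rho0.
  case: (leP rho a) => ha; case: (leP rho b) => hb;
  (try case: (leP (-rho) rho) => ?; try case: (leP (-rho) a) => ?; try case: (leP (-rho) b) => ?); lra.
have [xx|xx] := leP x x'.
  rewrite distrC [`|x - _|]distrC; have /andP[h1 h2] := key _ _ xx.
  by rewrite (ger0_norm h1) (le_trans h2) // ler_norm.
have /andP[h1 h2] := key _ _ (ltW xx).
by rewrite (ger0_norm h1) (le_trans h2) // ler_norm.
Qed.

(** Oddness lets the truncated field keep both reflections. *)
Lemma clampN x : clamp (- x) = - clamp x.
Proof.
rewrite /clamp; have := rho0.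
case: (leP rho x) => ha; case: (leP rho (-x)) => hb;
  (try case: (leP (-rho) rho) => ?; try case: (leP (-rho) x) => ?; try case: (leP (-rho) (-x)) => ?); lra.
Qed.

Lemma bounded_lipschitz_clamp1 : bounded_lipschitz (fun x _ => clamp x).
Proof.
exists rho, 1; split=> // [|x y|x y x' y']; [exact: ltW|exact: clamp_le|].
by rewrite mul1r (le_trans (clamp_lipschitz _ _)) // lerDl.
Qed.

Lemma bounded_lipschitz_clamp2 : bounded_lipschitz (fun _ y => clamp y).
Proof.
exists rho, 1; split=> // [|x y|x y x' y']; [exact: ltW|exact: clamp_le|].
by rewrite mul1r (le_trans (clamp_lipschitz _ _)) // lerDr.
Qed.
End BoundedLipschitz.

(** * Closed orbits *)

Section SignArgument.
Context {R : realType}.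

(* If w > 0 somewhere, then w is bounded below by a positive constant on a past
   half-line, where u decreases backwards at a definite rate and turns negative;
   a negative value of w is excluded in the same way in the future. *)
Lemma positive_partner (u w du dw : R -> R) :
  (forall t : R, is_derive t 1 u (du t)) -> (forall t : R, is_derive t 1 w (dw t)) ->
  (forall t, 0 < u t) -> (forall t, dw t <= 0) ->
  (forall k, 0 < k -> exists2 mu, 0 < mu & forall t,
     (k <= w t -> mu <= du t) /\ (w t <= - k -> du t <= - mu)) ->
  forall t, w t = 0.
Proof.
move=> ud wd u0 dw0 rate t.
have wdec s r : s <= r -> w r <= w s.
  by move=> sr; exact: (is_derive_le0 sr (fun q _ => wd q)).
apply/eqP; rewrite eq_le; apply/andP; split; rewrite leNgt; apply/negP => wt.
- have [mu mu0 muP] := rate _ wt.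
  pose s := t - u t / mu.
  have st : s <= t by rewrite /s lerBlDr lerDl divr_ge0 // ltW.
  have [c] := mean_value st (fun q _ => ud q).
  rewrite in_itv /= => /andP[_ ct] e.
  have [/(_ (wdec _ _ ct)) h _] := muP c.
  have : mu * (t - s) <= u t - u s by rewrite e ler_wpM2r // subr_ge0.
  have -> : mu * (t - s) = u t by rewrite /s; field; rewrite gt_eqF.
  by have := u0 s; lra.
- have wt' : 0 < - w t by rewrite oppr_gt0.
  have [mu mu0 muP] := rate _ wt'.
  pose s := t + u t / mu.
  have st : t <= s by rewrite /s lerDl divr_ge0 // ltW.
  have [c] := mean_value st (fun q _ => ud q).
  rewrite in_itv /= => /andP[ct _] e.
  have [_ ] := muP c; rewrite opprK => /(_ (wdec _ _ ct)) h.
  have : u s - u t <= - mu * (s - t) by rewrite e ler_wpM2r // subr_ge0.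
  have -> : - mu * (s - t) = - u t by rewrite /s; field; rewrite gt_eqF.
  by have := u0 s; lra.
Qed.

Lemma nonzero_sign (u : R -> R) : continuous u -> (forall t, u t != 0) ->
  (forall t, 0 < u t) \/ (forall t, u t < 0).
Proof.
move=> uc un.
have key (s t : R) : s <= t -> (0 < u s) = (0 < u t).
  move=> st; apply/idP/idP => h; rewrite ltNge; apply/negP => h'.
  - have [c _ /eqP] : exists2 c, c \in `[s, t] & u c = 0.
      apply: IVT => //; first by move=> x; exact: continuous_subspaceT.
      by rewrite ge_min h' orbT le_max (ltW h).
    exact/negP.
  - have [c _ /eqP] : exists2 c, c \in `[s, t] & u c = 0.
      apply: IVT => //; first by move=> x; exact: continuous_subspaceT.
      by rewrite ge_min h' le_max (ltW h) orbT.
    exact/negP.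
have key2 s t : (0 < u s) = (0 < u t) by have [/key|/ltW/key->] := leP s t.
have [h|h] := boolP (0 < u 0); [left|right] => t; first by rewrite -(key2 0).
by rewrite lt_neqAle un leNgt -(key2 0).
Qed.
End SignArgument.

Section Continuity.
Context {R : realType}.
Variables (c : nat -> nat -> R) (rho r0 : R).
Hypotheses (rho0 : 0 < rho) (c_le : forall k l, `|c k l| <= rho ^+ (k + l)).
Hypotheses (r00 : 0 < r0) (r0_small : 4 * rho * r0 <= 1).

Lemma double_sum_continuous p q : `|p| <= r0 -> `|q| <= r0 ->
  {for (p, q), continuous (fun z : R * R => double_sum c z.1 z.2)}.
Proof.
move=> pr qr; apply/cvgrPdist_lt => /= e e0.
set A := `|shifted_coef c p q 1 0|; set B := `|shifted_coef c p q 0 1|.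
pose M : R := A + B + 256 * r0^-1 ^+ 2 + 1.
have i0 : 0 <= r0^-1 ^+ 2 by rewrite sqr_ge0.
have A0 : 0 <= A by exact: normr_ge0.
have B0 : 0 <= B by exact: normr_ge0.
have M0 : 0 < M by rewrite /M; lra.
pose s : R := Num.min (Num.min 1 (r0 / 4)) (e / M).
have s0 : 0 < s by rewrite /s !lt_min ltr01 !divr_gt0.
have [s1 sr sM] : [/\ s <= 1, 4 * s <= r0 & s * M <= e].
  have : s <= s by [].
  rewrite {2}/s !le_min => /andP[/andP[-> s4] sM]; split=> //; first by lra.
  by rewrite -ler_pdivlMr.
have := @nbhsx_ballx R (R * R)%type (p, q) s s0; apply: filterS => z [zp zq].
have x_s : `|z.1 - p| <= s by rewrite distrC ltW.
have y_s : `|z.2 - q| <= s by rewrite distrC ltW.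
have := double_sum_taylor rho0 c_le r00 r0_small pr qr x_s y_s sr.
rewrite (subrKC p) (subrKC q) => h.
set D := double_sum c z.1 z.2; set D0 := double_sum c p q.
have hA : `|shifted_coef c p q 1 0 * (z.1 - p)| <= A * s by rewrite normrM ler_wpM2l.
have hB : `|shifted_coef c p q 0 1 * (z.2 - q)| <= B * s by rewrite normrM ler_wpM2l.
have hs : (s / r0) ^+ 2 <= s * r0^-1 ^+ 2.
  by rewrite exprMn ler_wpM2r // expr2 ler_piMl // ltW.
rewrite distrC; apply: (@lt_le_trans _ _ (s * M)) => //.
have : `|D - D0| <= A * s + B * s + 256 * (s * r0^-1 ^+ 2).
  move: h hA hB hs; rewrite -/D -/D0 !ler_norml => /andP[? ?] /andP[? ?] /andP[? ?] ?.
  by apply/andP; split; lra.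
by rewrite /M; move: s0; lra.
Qed.
End Continuity.

(** * The reversible system *)

Section ReversibleCenter.
Context {R : realType}.
Variables f10 f01 f20 f11 f02 : R.
Let F := Ffun f10 f01 f20 f11 f02.
Let H (x y : R) := first_integral f10 f01 f20 f11 f02 (x, y).
Let S := int_base f10 f01 f20 f11 f02.
Let r0 := int_radius f10 f01 f20 f11 f02.
Let rho := bound_radius f10 f01 f20 f11 f02.

Let r0_small : 2 * S * (4 * r0) <= 1.
Proof.
have := int_radius_small f10 f01 f20 f11 f02.
by rewrite /int_rate -/S -/r0; lra.
Qed.

Let rho_r0 : 256 * rho <= r0. Proof. exact: bound_radius_le. Qed.
Let r0_le : 16 * r0 <= 1. Proof. exact: int_radius_le. Qed.

Let rho_gt0 : 0 < rho.
Proof.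
rewrite /rho /bound_radius invr_gt0 mulr_gt0 // exprn_gt0 //.
exact: int_rate_gt0.
Qed.

Let rho_lt1 : rho < 1.
Proof. have := rho_r0; have := r0_le; have := rho_gt0; lra. Qed.

Let S_rho : S * rho <= 1 / 2.
Proof.
have S2 : 2 <= S := int_base_ge2 f10 f01 f20 f11 f02.
have h : S * (256 * rho) <= S * r0 by rewrite ler_wpM2l // (le_trans _ S2).
have := r0_small; have := rho_gt0; lra.
Qed.

Let sq_le (x : R) : `|x| <= rho -> `|x ^+ 2| <= rho.
Proof.
move=> xr; rewrite normrX expr2; apply: (le_trans _ xr); rewrite ler_piMl //.
by apply: (le_trans xr); exact: ltW.
Qed.

(** [F] differs from 1 by at most [rho] times the sum of the [|f|], and [S rho <= 1 / 2]. *)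
Let F_ge u v : `|u| <= rho -> `|v| <= rho -> 1 / 2 <= F u v.
Proof.
move=> ur vr.
have m1 (a b : R) : `|b| <= rho -> - (`|a| * rho) <= a * b.
  move=> br; have : `|a * b| <= `|a| * rho by rewrite normrM ler_wpM2l.
  by rewrite ler_norml => /andP[].
have le1 (b c : R) : `|b| <= rho -> `|c| <= rho -> `|b * c| <= rho.
  move=> br cr; rewrite normrM -[leRHS]mulr1 ler_pM // (le_trans cr) //.
  exact: ltW.
have := m1 f10 _ ur; have := m1 f01 _ vr; have := m1 f20 _ (le1 _ _ ur ur).
have := m1 f11 _ (le1 _ _ ur vr); have := m1 f02 _ (le1 _ _ vr vr).
have := S_rho; rewrite /F /Ffun /S /int_base !mulrDl !expr2 !mulrA.
have := rho_gt0; lra.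
Qed.

Lemma first_integral_bounds x y : `|x| <= rho -> `|y| <= rho ->
  y ^+ 2 + x ^+ 4 / 2 <= H x y <= y ^+ 2 + 3 * x ^+ 4 / 2.
Proof.
move=> xr yr; have := first_integral_bound (sq_le xr) (sq_le yr).
rewrite /H /first_integral /= ler_norml -exprM => /andP[h1 h2].
by apply/andP; split; lra.
Qed.

Lemma first_integral_y y : `|y| <= rho -> H 0 y = y ^+ 2.
Proof.
move=> yr; have := @first_integral_bounds 0 y; rewrite normr0 => /(_ (ltW rho_gt0) yr).
by rewrite expr0n /= mulr0 !mul0r !addr0 => /le_anti.
Qed.

Lemma first_integral_pos x y : `|x| <= rho -> `|y| <= rho -> (x, y) != (0, 0) -> 0 < H x y.
Proof.
move=> xr yr xy; have /andP[h _] := first_integral_bounds xr yr.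
apply: lt_le_trans h; rewrite lt_neqAle eq_sym; apply/andP; split; last first.
  by rewrite addr_ge0 ?sqr_ge0 // divr_ge0 // exprn_even_ge0.
apply: contra xy; rewrite paddr_eq0 ?sqr_ge0 ?divr_ge0 ?exprn_even_ge0 //.
rewrite expf_eq0 /= => /andP[/eqP -> x4].
by move: x4; rewrite mulf_eq0 invr_eq0 pnatr_eq0 orbF expf_eq0 /= => /eqP ->.
Qed.

Let cl := clamp rho.
Definition clamped_f (x y : R) : R := cl y * F (cl x ^+ 2) (cl y ^+ 2).
Definition clamped_g (x y : R) : R := - 2 * cl x ^+ 3.
Let f := clamped_f.
Let g := clamped_g.

Lemma clamped_bounded_lipschitz : bounded_lipschitz f /\ bounded_lipschitz g.
Proof.
have c1 : bounded_lipschitz (fun x _ => cl x) := bounded_lipschitz_clamp1 rho_gt0.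
have c2 : bounded_lipschitz (fun _ y => cl y) := bounded_lipschitz_clamp2 rho_gt0.
have cst := @bounded_lipschitz_cst R.
have u2 := bounded_lipschitzX 2 c1; have v2 := bounded_lipschitzX 2 c2.
split.
- apply: (bounded_lipschitzM c2).
  exact: (bounded_lipschitzD (bounded_lipschitzD (bounded_lipschitzD
    (bounded_lipschitzD (bounded_lipschitzD (cst 1) (bounded_lipschitzM (cst f10) u2))
      (bounded_lipschitzM (cst f01) v2)) (bounded_lipschitzM (cst f20) (bounded_lipschitzX 2 u2)))
    (bounded_lipschitzM (bounded_lipschitzM (cst f11) u2) v2))
    (bounded_lipschitzM (cst f02) (bounded_lipschitzX 2 v2))).
- exact: (bounded_lipschitzM (cst (-2)) (bounded_lipschitzX 3 c1)).
Qed.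

Lemma clamped_flow_exists p q : exists x y, [/\ flow f g x y, x 0 = p & y 0 = q].
Proof.
have [[B1 [L1 [B10 L10 b1 l1]]] [B2 [L2 [B20 L20 b2 l2]]]] := clamped_bounded_lipschitz.
have L0 : 0 < L1 + L2 + 1 by rewrite ltr_wpDl // addr_ge0.
apply: (@flow_exists _ f g (B1 + B2) _ L0) => [x y|x y|x y x' y'|x y x' y'].
- by apply: le_trans (b1 _ _) _; rewrite lerDl.
- by apply: le_trans (b2 _ _) _; rewrite lerDr.
- by apply: le_trans (l1 _ _ _ _) _; rewrite ler_wpM2r ?addr_ge0 //; lra.
- by apply: le_trans (l2 _ _ _ _) _; rewrite ler_wpM2r ?addr_ge0 //; lra.
Qed.

Lemma clamped_flow_unique x y x' y' (s t : R) : flow f g x y -> flow f g x' y' ->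
  x s = x' t -> y s = y' t -> forall r, x (s + r) = x' (t + r) /\ y (s + r) = y' (t + r).
Proof.
have [[B1 [L1 [B10 L10 b1 l1]]] [B2 [L2 [B20 L20 b2 l2]]]] := clamped_bounded_lipschitz.
have L0 : 0 < L1 + L2 + 1 by rewrite ltr_wpDl // addr_ge0.
apply: (@flow_unique _ f g (B1 + B2) _ L0) => [a b|a b|a b a' b'|a b a' b'].
- by apply: le_trans (b1 _ _) _; rewrite lerDl.
- by apply: le_trans (b2 _ _) _; rewrite lerDr.
- by apply: le_trans (l1 _ _ _ _) _; rewrite ler_wpM2r ?addr_ge0 //; lra.
- by apply: le_trans (l2 _ _ _ _) _; rewrite ler_wpM2r ?addr_ge0 //; lra.
Qed.

Let clN z : cl (- z) = - cl z. Proof. exact: clampN. Qed.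

Lemma flow_reflect_x x y : flow f g x y -> flow f g (fun t => - x (- t)) (fun t => y (- t)).
Proof.
move=> [xd yd]; split=> t.
- have h := is_deriveN (is_derive_reflect (xd (- t))).
  by apply: is_derive_eq h _; rewrite opprK /f /clamped_f clN sqrrN.
- have h := is_derive_reflect (yd (- t)).
  by apply: is_derive_eq h _; rewrite /g /clamped_g clN; ring.
Qed.

Lemma flow_reflect_y x y : flow f g x y -> flow f g (fun t => x (- t)) (fun t => - y (- t)).
Proof.
move=> [xd yd]; split=> t.
- have h := is_derive_reflect (xd (- t)).
  by apply: is_derive_eq h _; rewrite /f /clamped_f clN sqrrN mulNr.
- have h := is_deriveN (is_derive_reflect (yd (- t))).
  by apply: is_derive_eq h _; rewrite opprK.
Qed.

Lemma flow_opp x y : flow f g x y -> flow f g (fun t => - x t) (fun t => - y t).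
Proof.
move=> /flow_reflect_x /flow_reflect_y.
by congr flow; apply/funext => t; rewrite opprK.
Qed.

Definition inner (x y : R) := `|x| < rho /\ `|y| < rho.
(** This is a lower bound for [H] on the boundary of the square: [H] is at least [rho^4 / 2] on the
    sides [|x| = rho] and at least [rho^2] on the sides [|y| = rho]. *)
Let E0 := rho ^+ 4 / 2.

Lemma first_integral_boundary x y : `|x| <= rho -> `|y| <= rho -> H x y < E0 -> inner x y.
Proof.
move=> xr yr hE; have /andP[h _] := first_integral_bounds xr yr.
have x2 := sqr_ge0 x; have y2 := sqr_ge0 y.
have h4 (z : R) : `|z| = rho -> z ^+ 4 = rho ^+ 4.
  by move=> zr; rewrite -zr -normrX ger0_norm // exprn_even_ge0.
have h2 (z : R) : `|z| = rho -> z ^+ 2 = rho ^+ 2.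
  by move=> zr; rewrite -zr -normrX ger0_norm // exprn_even_ge0.
have x4 : 0 <= x ^+ 4 by rewrite exprn_even_ge0.
split; rewrite lt_neqAle ?xr ?yr andbT; apply/negP => /eqP zr.
- by move: hE; rewrite ltNge => /negP; apply; apply: le_trans h; rewrite h4 // lerDr.
- move: hE; rewrite ltNge => /negP; apply; apply: le_trans h; rewrite (h2 _ zr).
  apply: (@le_trans _ _ (rho ^+ 2)); last by rewrite lerDl divr_ge0.
  have r4 : rho ^+ 4 <= rho ^+ 2.
    by rewrite ler_wiXn2l ?(ltW rho_gt0) ?(ltW rho_lt1).
  by rewrite /E0; have := sqr_ge0 rho; lra.
Qed.

Lemma flow_conserved x y (s t : R) : flow f g x y -> s <= t ->
  (forall r, s <= r <= t -> `|x r| <= rho /\ `|y r| <= rho) -> H (x t) (y t) = H (x s) (y s).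
Proof.
move=> [xd yd] st box.
have hd (r : R) : r \in `[s, t] -> is_derive r 1 (fun q => H (x q) (y q)) (cst 0 r).
  rewrite in_itv /= => /box[xr yr].
  have xr' : `|x r| <= int_radius f10 f01 f20 f11 f02.
    by apply: le_trans xr _; have := rho_r0; have := rho_gt0; rewrite /r0; lra.
  have yr' : `|y r| <= int_radius f10 f01 f20 f11 f02.
    by apply: le_trans yr _; have := rho_r0; have := rho_gt0; rewrite /r0; lra.
  have dx : is_derive r 1 x (y r * Ffun f10 f01 f20 f11 f02 (x r ^+ 2) (y r ^+ 2)).
    by apply: is_derive_eq (xd r) _; rewrite /f /clamped_f /cl !clamp_id.
  have dy : is_derive r 1 y (- 2 * x r ^+ 3).
    by apply: is_derive_eq (yd r) _; rewrite /g /clamped_g /cl !clamp_id.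
  exact: (is_derive_first_integral dx dy xr' yr').
have [c _] := mean_value st hd; rewrite mul0r => e.
by apply/eqP; rewrite -subr_eq0 e.
Qed.

(** Until the boundary is first reached the field is the original one and [H] is constant, hence
    below its values on the boundary. *)
Let flow_confined0 x y : flow f g x y -> inner (x 0) (y 0) -> H (x 0) (y 0) < E0 ->
  forall t, 0 <= t -> inner (x t) (y t).
Proof.
move=> z [x0 y0] hE t t0.
pose m (s : R) : R := Num.max `|x s| `|y s|.
have xc := is_derive_continuous z.1; have yc := is_derive_continuous z.2.
have mc : continuous m.
  move=> s; apply: (@continuous_max _ _ (fun s => `|x s|) (fun s => `|y s|)).
    by apply: cvg_norm; exact: xc.
  by apply: cvg_norm; exact: yc.
have [//|] : inner (x t) (y t) \/ rho <= m t.
  have [h|] := ltP (m t) rho; last by right.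
  by left; move: h; rewrite gt_max => /andP.
move=> mt; have m0 : m 0 < rho by rewrite gt_max x0.
have [s [s0 ms sle]] := first_hit mc m0 t0 mt.
have box r : 0 <= r <= s -> `|x r| <= rho /\ `|y r| <= rho.
  by move=> /sle; rewrite ge_max => /andP.
have hs := flow_conserved z s0 box.
have [] : inner (x s) (y s).
  have [xs ys] : `|x s| <= rho /\ `|y s| <= rho by apply: box; rewrite s0 lexx.
  by apply: first_integral_boundary => //; rewrite hs.
move=> xs ys; have : m s < rho by rewrite gt_max xs.
by rewrite ms ltxx.
Qed.

Lemma first_integralN x y : (H (- x) y = H x y) * (H x (- y) = H x y).
Proof. by rewrite /H /first_integral /= !sqrrN. Qed.

Lemma flow_confined x y : flow f g x y -> inner (x 0) (y 0) -> H (x 0) (y 0) < E0 ->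
  forall t, inner (x t) (y t).
Proof.
move=> z z0 hE t; have [t0|t0] := leP 0 t; first exact: flow_confined0.
have zr := flow_reflect_x z.
have := @flow_confined0 _ _ zr; rewrite oppr0 first_integralN /inner normrN.
move=> /(_ z0 hE (- t)); rewrite opprK normrN; apply.
by rewrite oppr_ge0 ltW.
Qed.

Lemma flow_level x y : flow f g x y -> (forall t, inner (x t) (y t)) ->
  forall t, H (x t) (y t) = H (x 0) (y 0).
Proof.
move=> z box t.
have box' r : `|x r| <= rho /\ `|y r| <= rho by have [/ltW ? /ltW] := box r.
have [t0|/ltW t0] := leP 0 t.
  by apply: flow_conserved => // r _; exact: box'.
by apply/esym; apply: flow_conserved => // r _; exact: box'.
Qed.

Section Orbit.
Variables (x y : R -> R).
Hypothesis z : flow f g x y.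
Hypothesis box : forall t, inner (x t) (y t).
Hypothesis z0 : (x 0, y 0) != (0, 0).

Let box_le t : `|x t| <= rho /\ `|y t| <= rho.
Proof. by have [/ltW ? /ltW] := box t. Qed.

Let xd (t : R) : is_derive t 1 x (y t * F (x t ^+ 2) (y t ^+ 2)).
Proof.
have [xt yt] := box_le t.
by apply: is_derive_eq (z.1 t) _; rewrite /f /clamped_f /cl !clamp_id.
Qed.

Let yd (t : R) : is_derive t 1 y (- 2 * x t ^+ 3).
Proof.
have [xt yt] := box_le t.
by apply: is_derive_eq (z.2 t) _; rewrite /g /clamped_g /cl !clamp_id.
Qed.

Let Fge t : 1 / 2 <= F (x t ^+ 2) (y t ^+ 2).
Proof. by have [xt yt] := box_le t; apply: F_ge; exact: sq_le. Qed.

Lemma orbit_nonzero t : (x t, y t) != (0, 0).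
Proof.
apply/eqP => -[xt yt].
have : 0 < H (x 0) (y 0) by have [xt' yt'] := box_le 0; exact: first_integral_pos.
by rewrite -(flow_level z box t) xt yt first_integral_y ?normr0 ?(ltW rho_gt0) // expr0n ltxx.
Qed.

Let neg_cube (k a : R) : 0 < k -> a <= - k -> a ^+ 3 <= - k ^+ 3.
Proof.
move=> k0 ak; have : k ^+ 3 <= (- a) ^+ 3 by rewrite lerXn2r ?nnegrE; lra.
by rewrite !exprS expr0 => ?; lra.
Qed.

(** In [positive_partner] with [u = x] and [w = y], the rate comes from [F >= 1 / 2]; the conclusion
    [y = 0] contradicts [y' = -2 x^3]. *)
Lemma not_x_positive : ~ forall t, 0 < x t.
Proof.
move=> x0.
have y0 : forall t, y t = 0.
  apply: (positive_partner xd yd x0).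
    by move=> t; rewrite mulNr oppr_le0 mulr_ge0 // exprn_ge0 // ltW.
  move=> k k0; exists (k / 2); first by rewrite divr_gt0.
  move=> t; have := Fge t; set G := F _ _ => G2; split=> yk.
  - rewrite -[k / 2]mul1r mulrCA -[1 / _]/(1 / 2) ler_pM //; lra.
  - have : k * (1 / 2) <= (- y t) * G by rewrite ler_pM //; lra.
    by rewrite mulNr; lra.
have y0n : \forall t \near (0 : R), y t = 0 by apply/nbhs_ballP; exists 1 => //= t _; exact: y0.
have := is_derive_cst_near y0n (yd 0).
by apply/eqP; rewrite mulf_neq0 ?oppr_eq0 ?pnatr_eq0 // expf_neq0 // gt_eqF.
Qed.

Lemma not_y_positive : ~ forall t, 0 < y t.
Proof.
move=> y0.
have nxd (t : R) := is_deriveN (xd t).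
have x0 : forall t, (- x) t = 0.
  apply: (positive_partner yd nxd y0).
    move=> t; rewrite oppr_le0 mulr_ge0 ?(ltW (y0 t)) //.
    by apply: le_trans (Fge t); lra.
  move=> k k0; exists (2 * k ^+ 3); first by rewrite mulr_gt0 // exprn_gt0.
  move=> t; rewrite -[(- x) t]/(- x t); split=> xk.
  - have : x t ^+ 3 <= - k ^+ 3 by apply: neg_cube => //; lra.
    lra.
  - have : k ^+ 3 <= x t ^+ 3 by rewrite lerXn2r ?nnegrE; lra.
    lra.
have x0n : \forall t \near (0 : R), x t = 0.
  apply/nbhs_ballP; exists 1 => //= t _.
  by apply: oppr_inj; rewrite oppr0 -(x0 t).
have := is_derive_cst_near x0n (xd 0).
apply/eqP; rewrite mulf_neq0 ?(gt_eqF (y0 _)) // gt_eqF //.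
by apply: lt_le_trans (Fge 0); lra.
Qed.
End Orbit.

Lemma orbit_x_zero x y : flow f g x y -> (forall t, inner (x t) (y t)) ->
  (x 0, y 0) != (0, 0) -> exists t, x t = 0.
Proof.
move=> z box z0; apply: contrapT => xn.
have xn0 t : x t != 0 by apply/eqP => xt; apply: xn; exists t.
have [xp|xp] := nonzero_sign (is_derive_continuous z.1) xn0.
  exact: (not_x_positive z box xp).
have box' t : inner (- x t) (- y t) by rewrite /inner !normrN; exact: box.
apply: (not_x_positive (flow_opp z) box') => t.
by rewrite oppr_gt0.
Qed.

Lemma orbit_y_zero x y : flow f g x y -> (forall t, inner (x t) (y t)) ->
  (x 0, y 0) != (0, 0) -> exists t, y t = 0.
Proof.
move=> z box z0; apply: contrapT => yn.
have yn0 t : y t != 0 by apply/eqP => yt; apply: yn; exists t.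
have [yp|yp] := nonzero_sign (is_derive_continuous z.2) yn0.
  exact: (not_y_positive z box yp).
have box' t : inner (- x t) (- y t) by rewrite /inner !normrN; exact: box.
apply: (not_y_positive (flow_opp z) box') => t.
by rewrite oppr_gt0.
Qed.

(* The reflections fixing the points where the orbit crosses the two axes
   compose to a rotation by half a turn, which is then a time translation. *)
Lemma orbit_antiperiod x y : flow f g x y -> (forall t, inner (x t) (y t)) ->
  (x 0, y 0) != (0, 0) -> exists2 T, T != 0 & forall t, x (t + T) = - x t /\ y (t + T) = - y t.
Proof.
move=> z box z0.
have [t0 xt0] := orbit_x_zero z box z0; have [t1 yt1] := orbit_y_zero z box z0.
exists (2 * (t1 - t0)).
  rewrite mulf_neq0 ?pnatr_eq0 // subr_eq0; apply/eqP => t10.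
  by have := orbit_nonzero z box z0 t1; rewrite {1}t10 xt0 yt1 eqxx.
have ry := @clamped_flow_unique _ _ _ _ t1 (- t1) z (flow_reflect_y z).
have rx := @clamped_flow_unique _ _ _ _ t0 (- t0) z (flow_reflect_x z).
move: ry rx; rewrite !opprK => /(_ erefl) ry /(_ _ erefl) rx.
rewrite yt1 oppr0 in ry; rewrite xt0 oppr0 in rx.
have {}ry := ry erefl; have {}rx := rx erefl.
move=> t.
have [a1 a2] := ry (t + t1 - 2 * t0); have [b1 b2] := rx (t0 - t).
rewrite (_ : t + 2 * (t1 - t0) = t1 + (t + t1 - 2 * t0)); last by ring.
rewrite a1 a2 (_ : - (- t1 + (t + t1 - 2 * t0)) = t0 + (t0 - t)); last by ring.
by rewrite b1 b2 (_ : - (- t0 + (t0 - t)) = t) //; ring.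
Qed.

Lemma orbit_through p q : inner p q -> H p q < E0 -> exists x y,
  [/\ flow f g x y, x 0 = p, y 0 = q & forall t, inner (x t) (y t)].
Proof.
move=> pq hE; have [x [y [z x0 y0]]] := clamped_flow_exists p q.
exists x, y; split => //; apply: flow_confined => //; by rewrite x0 y0.
Qed.

(** Both orbits meet the [y]-axis, where [H = y^2] leaves two opposite points; the antiperiod takes
    the first orbit through both of them. *)
Lemma orbit_level_set x y p q : flow f g x y -> (forall t, inner (x t) (y t)) ->
  (x 0, y 0) != (0, 0) -> inner p q -> H p q < E0 -> H p q = H (x 0) (y 0) ->
  exists t, x t = p /\ y t = q.
Proof.
move=> z box z0 pq pqE pqH.
have [x' [y' [z' x0' y0' box']]] := orbit_through pq pqE.
have xy0 : 0 < H (x 0) (y 0).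
  by have [/ltW ? /ltW ?] := box 0; exact: first_integral_pos.
have z0' : (x' 0, y' 0) != (0, 0).
  apply/eqP => -[xe ye]; move: xy0; rewrite -pqH -x0' -y0' xe ye.
  by rewrite first_integral_y ?normr0 ?(ltW rho_gt0) // expr0n ltxx.
have [s xs] := orbit_x_zero z box z0; have [s' xs'] := orbit_x_zero z' box' z0'.
have [T _ zT] := orbit_antiperiod z box z0.
have yy : y s ^+ 2 = y' s' ^+ 2.
  have [_ /ltW ys] := box s; have [_ /ltW ys'] := box' s'.
  rewrite -(first_integral_y ys) -(first_integral_y ys') -{1}xs -xs'.
  by rewrite (flow_level z box) (flow_level z' box') x0' y0' pqH.
have found r : x r = x' s' -> y r = y' s' -> exists t, x t = p /\ y t = q.
  move=> xr yr; exists (r - s').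
  have [-> ->] := clamped_flow_unique z z' xr yr (- s').
  by rewrite subrr x0' y0'.
move/eqP: yy; rewrite eqf_sqr => /orP[/eqP yy|/eqP yy].
  by apply: (found s) => //; rewrite xs xs'.
by have [xT yT] := zT s; apply: (found (s + T)); rewrite ?xT ?yT ?xs ?xs' ?oppr0 // yy opprK.
Qed.

Lemma first_integral_continuous a b : `|a| <= rho -> `|b| <= rho ->
  {for (a, b), continuous (fun z : R * R => H z.1 z.2)}.
Proof.
move=> ar br.
have sr (c : R) : `|c| <= rho -> `|c ^+ 2| <= r0.
  by move=> /sq_le h; apply: le_trans h _; have := rho_r0; have := rho_gt0; lra.
have dc := double_sum_continuous (int_rate_gt0 f10 f01 f20 f11 f02)
  (int_coef_le f10 f01 f20 f11 f02) (int_radius_gt0 f10 f01 f20 f11 f02)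
  (int_radius_small f10 f01 f20 f11 f02) (sr a ar) (sr b br).
have sqc (c : R) : (fun t : R => t ^+ 2) @ c --> c ^+ 2 by exact: exprn_continuous.
have c1 : (fun z : R * R => z.1 ^+ 2) @ (a, b) --> a ^+ 2.
  exact: (cvg_comp _ _ (@cvg_fst _ _ _ _ _) (sqc a)).
have c2 : (fun z : R * R => z.2 ^+ 2) @ (a, b) --> b ^+ 2.
  exact: (cvg_comp _ _ (@cvg_snd _ _ _ _ _) (sqc b)).
exact: (cvg_comp _ _ (cvg_pair c1 c2) dc).
Qed.

(** The sublevel set [D] is open, and relatively closed in the component [A]: a limit point has
    [H <= E], and [H = E] would put it on the orbit. By connectedness [A] lies in the bounded set
    [D]; this replaces the Jordan curve theorem. *)
Lemma orbit_surrounds x y : flow f g x y -> (forall t, inner (x t) (y t)) ->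
  (x 0, y 0) != (0, 0) -> H (x 0) (y 0) < E0 ->
  surrounds (range (fun t : R => (x t, y t))) (0, 0).
Proof.
move=> z box z0 zE0; set O := range _; set E := H (x 0) (y 0) in zE0 *.
have E_gt0 : 0 < E by have [/ltW ? /ltW ?] := box 0; exact: first_integral_pos.
have O0 : ~ O (0, 0).
  by move=> [t _ /eqP]; apply/negP; exact: (orbit_nonzero z box z0).
split=> //; set A := connected_component _ _.
have AO : A `<=` ~` O by exact: connected_component_sub.
have A0 : A (0, 0) by exact: connected_component_refl.
pose D : set (R * R) := [set q | inner q.1 q.2 /\ H q.1 q.2 < E].
have absc1 q : {for q, continuous (fun q : R * R => `|q.1|)}.
  by apply: cvg_norm; exact: cvg_fst.
have absc2 q : {for q, continuous (fun q : R * R => `|q.2|)}.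
  by apply: cvg_norm; exact: cvg_snd.
have oD : open D.
  rewrite openE => -[a b] [[/= ar br] hE].
  have hc := first_integral_continuous (ltW ar) (ltW br).
  have n1 : \forall q \near ((a, b) : R * R), `|q.1| < rho.
    by exact: (cvgr_lt _ (absc1 (a, b)) _ ar).
  have n2 : \forall q \near ((a, b) : R * R), `|q.2| < rho.
    by exact: (cvgr_lt _ (absc2 (a, b)) _ br).
  have n3 : \forall q \near ((a, b) : R * R), H q.1 q.2 < E.
    by exact: (cvgr_lt _ hc _ hE).
  by near=> q; split; [split|]; near: q.
have clD : A `&` closure D `<=` D.
  move=> [a b] [Aab cD].
  have ar : `|a| <= rho.
    rewrite leNgt; apply/negP => ar.
    have [q [[[qr _] _]]] := cD _ (cvgr_gt (_ : R) (absc1 (a, b)) _ ar).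
    by rewrite /= => /lt_trans/(_ qr); rewrite ltxx.
  have br : `|b| <= rho.
    rewrite leNgt; apply/negP => br.
    have [q [[[_ qr] _]]] := cD _ (cvgr_gt (_ : R) (absc2 (a, b)) _ br).
    by rewrite /= => /lt_trans/(_ qr); rewrite ltxx.
  have hE : H a b <= E.
    rewrite leNgt; apply/negP => hE.
    have hc := first_integral_continuous ar br.
    have [q [[_ qE]]] := cD _ (cvgr_gt (_ : R) hc _ hE).
    by rewrite /= => /lt_trans/(_ qE); rewrite ltxx.
  have abE := le_lt_trans hE zE0.
  have ab := first_integral_boundary ar br abE.
  split => //=; rewrite lt_neqAle hE andbT; apply/eqP => abH.
  have [t [xt yt]] := orbit_level_set z box z0 ab abE abH.
  by apply: (AO _ Aab); exists t => //; rewrite xt yt.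
have AD : A `&` D = A.
  apply: component_connected.
  - exists (0, 0); split => //; split=> /=; first by split; rewrite normr0.
    by rewrite first_integral_y ?normr0 ?(ltW rho_gt0) // expr0n.
  - by exists D.
  - exists (closure D); first exact: closed_closure.
    apply/seteqP; split=> q [Aq Dq]; split => //; first exact: subset_closure.
    exact: clD.
exists rho; split; first exact: num_real.
move=> M rM q; rewrite /= -AD => -[_ [[q1 q2] _]].
by rewrite prod_normE /= ge_max !(ltW (lt_trans _ rM)).
Unshelve. all: by end_near. Qed.

Variable X : R * R -> R * R.
Hypothesis XE : forall x y, X (x, y) = (y * F (x ^+ 2) (y ^+ 2), - 2 * x ^+ 3).

Lemma flow_solution x y : flow f g x y -> (forall t, inner (x t) (y t)) ->
  solution_on X setT (fun t => (x t, y t)).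
Proof.
move=> z box t _; apply/is_derive_fun_pair; rewrite XE /=.
have [/ltW xt /ltW yt] := box t.
split.
- by apply: is_derive_eq (z.1 t) _; rewrite /f /clamped_f /cl !clamp_id.
- by apply: is_derive_eq (z.2 t) _; rewrite /g /clamped_g /cl !clamp_id.
Qed.

Lemma reversible_is_center : is_center X (0, 0).
Proof.
split; first by rewrite XE mul0r expr0n mulr0.
exists [set q : R * R | inner q.1 q.2 /\ H q.1 q.2 < E0]; split.
  have r0' : `|0 : R| < rho by rewrite normr0.
  have hE : H 0 0 < E0.
    by rewrite first_integral_y ?(ltW r0') // expr0n divr_gt0 // exprn_gt0.
  have c1 : {for (0, 0), continuous (fun q : R * R => `|q.1|)}.
    by apply: cvg_norm; exact: cvg_fst.
  have c2 : {for (0, 0), continuous (fun q : R * R => `|q.2|)}.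
    by apply: cvg_norm; exact: cvg_snd.
  have hc := first_integral_continuous (ltW r0') (ltW r0').
  have n1 : \forall q \near ((0, 0) : R * R), `|q.1| < rho.
    by exact: (cvgr_lt _ c1 _ r0').
  have n2 : \forall q \near ((0, 0) : R * R), `|q.2| < rho.
    by exact: (cvgr_lt _ c2 _ r0').
  have n3 : \forall q \near ((0, 0) : R * R), H q.1 q.2 < E0.
    by exact: (cvgr_lt _ hc _ hE).
  by near=> q; split; [split|]; near: q.
move=> [p q] [/= pq pqE] pq0.
have [x [y [z x0 y0 box]]] := orbit_through pq pqE.
have z0 : (x 0, y 0) != (0, 0) by rewrite x0 y0; apply/eqP.
exists (range (fun t : R => (x t, y t))); split.
- have [T T0 zT] := orbit_antiperiod z box z0.
  (* Twice the antiperiod is a period, and [T] may be negative. *)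
  exists (fun t => (x t, y t)), `|T + T|; split => //.
  + exact: flow_solution.
  + by rewrite normr_gt0 -mulr2n mulrn_eq0.
  + have per t : (x (t + (T + T)), y (t + (T + T))) = (x t, y t).
      have [xT yT] := zT t; have [xT2 yT2] := zT (t + T).
      by rewrite addrA xT2 yT2 xT yT !opprK.
    move=> t; have [_|_] := ger0P (T + T); first exact: per.
    by have := per (t - (T + T)); rewrite subrK => <-.
  + exists T; have [] := zT 0; rewrite add0r => -> -> [xN yN].
    have xz : x 0 = 0 by lra.
    have yz : y 0 = 0 by lra.
    by move: z0; rewrite xz yz eqxx.
- by exists 0; rewrite ?x0 ?y0.
- move=> _ [t _ <-]; split; first exact: box.
  by rewrite /= (flow_level z box) x0 y0.
- by apply: orbit_surrounds => //; rewrite x0 y0.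
Unshelve. all: by end_near. Qed.

Lemma reversible_first_integral : has_analytic_first_integral X (0, 0).
Proof.
have r00 : 0 < r0 by exact: int_radius_gt0.
exists [set q : R * R | `|q.1| < r0 /\ `|q.2| < r0], (fun q => H q.1 q.2); split.
- rewrite openE => -[a b] [/= ar br].
  have c1 : {for (a, b), continuous (fun q : R * R => `|q.1|)}.
    by apply: cvg_norm; exact: cvg_fst.
  have c2 : {for (a, b), continuous (fun q : R * R => `|q.2|)}.
    by apply: cvg_norm; exact: cvg_snd.
  have n1 : \forall q \near ((a, b) : R * R), `|q.1| < r0.
    by exact: (cvgr_lt _ c1 _ ar).
  have n2 : \forall q \near ((a, b) : R * R), `|q.2| < r0.
    by exact: (cvgr_lt _ c2 _ br).
  by near=> q; split; near: q.
- by rewrite /= normr0.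
- move=> [a b] [/= ar br]; have := first_integral_analytic ar br.
  by congr analytic_at; apply/funext => -[].
- move=> a b gam sol box.
  have key s t : s \in `]a, b[ -> t \in `]a, b[ -> s <= t ->
      H (gam s).1 (gam s).2 = H (gam t).1 (gam t).2.
    move=> sab tab st.
    have hd (r : R) : r \in `[s, t] ->
        is_derive r 1 (fun q => H (gam q).1 (gam q).2) (cst 0 r).
      move=> rst; have rab : r \in `]a, b[.
        move: rst sab tab; rewrite !in_itv /= => /andP[sr rt] /andP[as_ _] /andP[_ tb].
        by rewrite (lt_le_trans as_ sr) (le_lt_trans rt tb).
      have [/ltW xr /ltW yr] := box r rab.
      have /is_derive_fun_pair[] := sol r rab.
      rewrite [gam r]surjective_pairing XE /= => dx dy.
      exact: (is_derive_first_integral dx dy xr yr).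
    have [c _] := mean_value st hd; rewrite mul0r => e.
    by apply/esym/eqP; rewrite -subr_eq0 e.
  move=> s t sab tab; have [st|/ltW ts] := leP s t; first exact: key.
  by apply/esym; exact: key.
- move=> /nbhs00_box[d d0 hd].
  (* On the [y]-axis [H = y^2], which is not constant near 0. *)
  pose e : R := Num.min (d / 2) rho.
  have e0 : 0 < e by rewrite lt_min divr_gt0.
  have ed : `|e| < d.
    by rewrite gtr0_norm //; apply: le_lt_trans (_ : d / 2 < d); [rewrite ge_min lexx|lra].
  have er : `|e| <= rho by rewrite gtr0_norm // ge_min lexx orbT.
  have := hd 0 e; rewrite normr0 => /(_ d0 ed) /=.
  rewrite !first_integral_y ?normr0 ?(ltW rho_gt0) // expr0n /= => /eqP.
  by rewrite expf_eq0 /= gt_eqF.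
Unshelve. all: by end_near. Qed.

End ReversibleCenter.

Theorem proposition3p1 (R : realType)
    (a30 a21 a12 a03 a50 a41 a32 a23 a14 a05 : R) :
  is_analytic_center
    (cubic_quintic_field a30 a21 a12 a03 a50 a41 a32 a23 a14 a05) (0, 0)
  <-> [/\ a30 = 0, a12 = 0, a32 = 0, a14 = 0 & a50 = 0].
Proof.
split; first by move=> [/center_coefs].
move=> [-> -> -> -> ->].
have XE x y : cubic_quintic_field 0 a21 0 a03 0 a41 0 a23 0 a05 (x, y) =
    (y * Ffun a21 a03 a41 a23 a05 (x ^+ 2) (y ^+ 2), - 2 * x ^+ 3).
  by rewrite /cubic_quintic_field /Ffun /=; congr pair; ring.
by split; [exact: reversible_is_center XE|exact: reversible_first_integral XE].
Qed.
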